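(* Let $\alpha\in(0,2)$, $\beta\in(-1,1)$, let $g\in C^1([0,1],\mathbb{R})$ with $g(0)=g(1)=0$, and let $u_0\in C(\mathbb{R},\mathbb{R})$ satisfy $0\le u_0(x)\le 1$ for all $x\in\mathbb{R}$, $\lim_{x\to\infty}u_0(x)=1$, and $\operatorname{supp}(u_0)\subset[0,\infty)$. Let $u$ be the (unique, global, $[0,1]$-valued) mild solution of $\partial_t u+Au=g(u)$ on $\mathbb{R}\times(0,\infty)$ with $u(\cdot,0)=u_0$, where $A=A_{\alpha,\beta}$. a) Let $\alpha>1$. Assume that $g>0$ on $(0,1)$ and that there are constants $c_0>0$ and $0<\gamma<\frac{\alpha}{\alpha-1}$ such that $g(\zeta)\ge c_0\zeta^\gamma$ for all $\zeta\in[0,\frac12]$. Then for all $c>0$ $$\liminf_{t\to\infty}\ \inf_{x\ge -ct}u(x,t)=1.$$ b) Let $\alpha=1$. Assume that $g>0$ on $(0,1)$. Then for all $c>0$ $$\liminf_{t\to\infty}\ \inf_{x\ge -ct}u(x,t)=1.$$ c) Let $\alpha<1$. Assume that $g\ge 0$ on $(0,1)$ and $g(\zeta)>0$ for all $\zeta\in[\frac{1-\beta}{2},1)$. Then for all $c>0$ $$\liminf_{t\to\infty}\ \inf_{x\ge -ct}u(x,t)=1.$$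
   Context: For $\alpha\in(0,2)$ and $\beta\in(-1,1)$ put $\rho=\alpha\beta$ if $\alpha<1$, $\rho=\beta$ if $\alpha=1$, $\rho=\beta(\alpha-2)$ if $\alpha>1$, and $p(\lambda)=e^{-i\frac{\pi}{2}\operatorname{sign}(\lambda)\rho}|\lambda|^\alpha$ for $\lambda\in\mathbb{R}$. $A=A_{\alpha,\beta}$ is the pseudo-differential operator on $\mathbb{R}$ with symbol $p$, with the Fourier transform convention $\hat w(\lambda)=\int_{\mathbb{R}}e^{i\lambda x}w(x)\,dx$ (i.e. $\widehat{Aw}=p\,\hat w$). Let $f_{\alpha\beta}$ be the (stable) probability density on $\mathbb{R}$ with characteristic function $\int_{\mathbb{R}}e^{i\lambda x}f_{\alpha\beta}(x)\,dx=e^{-p(\lambda)}$. Let $\mathcal{C}_{lim}$ be the Banach space of all $w\in C(\mathbb{R})$ for which $\lim_{x\to\infty}w(x)$ and $\lim_{x\to-\infty}w(x)$ exist (finite), with the supremum norm. For $\varphi\in\mathcal{C}_{lim}$ let $S(0)\varphi=\varphi$ and, for $t>0$, $S(t)\varphi(x)=\int_{\mathbb{R}}t^{-1/\alpha}f_{\alpha\beta}\big(\tfrac{x-y}{t^{1/\alpha}}\big)\varphi(y)\,dy$; this is a positive $C_0$ semigroup on $\mathcal{C}_{lim}$, solving $\partial_t u+Au=0$. A mild solution of $\partial_t u+Au=g(u)$ with initial data $u_0\in\mathcal{C}_{lim}$ is a continuous curve $t\mapsto u(\cdot,t)\in\mathcal{C}_{lim}$ such that $u(\cdot,t)=S(t)u_0+\int_0^tS(t-s)\,g(u(\cdot,s))\,ds$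 for all $t\ge0$. For $g$ and $u_0$ as in the claim there is a unique mild solution defined for all $t\ge 0$ with $0\le u(x,t)\le1$ for all $(x,t)$. *)

(* Defs.v *)
From HB Require Import structures.
From mathcomp Require Import all_boot all_order all_algebra.
From mathcomp Require Import all_classical all_reals all_analysis.
From mathcomp Require Import complex.

Set Implicit Arguments.
Unset Strict Implicit.
Unset Printing Implicit Defensive.

Import Order.TTheory GRing.Theory Num.Theory.
Import numFieldNormedType.Exports.

Local Open Scope classical_set_scope.
Local Open Scope ring_scope.
Local Open Scope complex_scope.

Section Complex.
Variable R : realType.

Definition cexp (z : R[i]) : R[i] :=
  (expR (complex.Re z))%:C * (cos (complex.Im z) +i* sin (complex.Im z)).

Definition cintegral (h : R -> R[i]) : R[i] :=
  (\int[@lebesgue_measure R]_x complex.Re (h x)) +i*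
  (\int[@lebesgue_measure R]_x complex.Im (h x)).

End Complex.

Section StableSemigroup.
Variable R : realType.
Notation mu := (@lebesgue_measure R).

Definition skewness (alpha beta : R) : R :=
  if alpha < 1 then alpha * beta
  else if alpha == 1 then beta
  else beta * (alpha - 2).

Definition symbol (alpha beta lambda : R) : R[i] :=
  cexp (0 -i* (pi / 2 * Num.sg lambda * skewness alpha beta)) *
  (`|lambda| `^ alpha)%:C.

(* Determines f up to a Lebesgue-null set; [semigroup] below depends only on
   the almost-everywhere class of f. *)
Definition is_stable_density (alpha beta : R) (f : R -> R) : Prop :=
  [/\ measurable_fun setT f,
      forall x, 0 <= f x,
      (\int[mu]_x (f x)%:E = 1)%E &
      forall lambda : R,
        cintegral (fun x => cexp (0 +i* (lambda * x)) * (f x)%:C) =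
        cexp (- symbol alpha beta lambda)].

Definition semigroup (alpha : R) (f : R -> R) (t : R) (phi : R -> R) : R -> R :=
  fun x => if t == 0 then phi x
  else \int[mu]_y (t `^ (- alpha^-1) * f ((x - y) / t `^ (alpha^-1)) * phi y).

Definition C_lim : set (R -> R) :=
  [set w | [/\ continuous w, cvg (w x @[x --> +oo]) & cvg (w x @[x --> -oo])]].

(* [u t] is the profile x |-> u(x,t); values at t < 0 are irrelevant.  The
   topology of [{uniform R -> R}] restricted to [C_lim] is that of the supremum
   norm.  The C_lim-valued integral of the continuous curve
   s |-> S(t - s) g(u(s)) over [0, t] is evaluated pointwise in x. *)
Definition mild_solution (alpha : R) (f g u0 : R -> R) (u : R -> R -> R) : Prop :=
  [/\ forall t, 0 <= t -> C_lim (u t),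
      {within `[0, +oo[, continuous (u : R -> {uniform R -> R})} &
      forall t x, 0 <= t ->
        u t x = semigroup alpha f t u0 x +
          \int[mu]_(s in `[0, t]) semigroup alpha f (t - s) (g \o u s) x].

(* Differentiable on the open interval, with g and g' extending continuously
   to the closed one; values of g outside [a, b] are irrelevant. *)
Definition C1_itv (a b : R) (g : R -> R) : Prop :=
  derivable_oo_LRcontinuous g a b /\
  exists2 dg : R -> R,
    {within `[a, b], continuous dg} & {in `]a, b[, derive1 g =1 dg}.

End StableSemigroup.

(* Main.v *)
Require Import Defs.
From HB Require Import structures.
From mathcomp Require Import all_boot all_order all_algebra.
From mathcomp Require Import all_classical all_reals all_analysis.
From mathcomp Require Import measurable_realfun.
From mathcomp Require Import ring lra.

Set Implicit Arguments.
Unset Strict Implicit.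
Unset Printing Implicit Defensive.

Import Order.TTheory GRing.Theory Num.Theory.
Import numFieldNormedType.Exports.

Local Open Scope classical_set_scope.
Local Open Scope ring_scope.

(** The semigroup averages against the law of [t ^ (1 / alpha) X], where [X] is a stable
    variable, and three facts about [X] carry the theorem.  Stability makes these averages
    a semigroup ([stable_mean_add]).  For [1 <= alpha] the left tail is at least of order
    [y ^ (- alpha)] ([stable_left_tail]).  For [alpha < 1] the negative half-line has mass
    [(1 - beta) / 2] ([stable_cdf_step_cvg]).

    All three are read off the characteristic function with real Fourier analysis built on
    the Cauchy kernel, which is a superposition of cosines and an approximate identity:
    laws with the same transform coincide ([fourier_unique]), and the expectation of a test
    function is an integral of transforms ([parseval]).  Stability follows from uniqueness,
    as the exponents add up.  For the tail the test function is a Gamma density reflected to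
    the left half-line, whose transform is explicit ([gamma_transform]); at small scales its
    expectation is governed by the term [l ^ alpha] of the characteristic function, with a
    positive coefficient computed exactly.  For the mass of the half-line the test functions
    approximate the sign, and the limit is an integral linear in the argument of the exponent
    ([angle_integral]).

    For the evolution, Duhamel's formula can be restarted at any time ([duhamel_restart]).
    As the forcing is nonnegative, [u t] dominates both the propagated earlier values
    [S (t - s) (u s)] and the propagated forcing.  If [g u >= k (b - u)] to the right of a
    front during a time [tau], these two bounds give
    [(1 + k tau) u >= k tau b (1 - e)] ([mild_growth]), where [e] is the small probability
    of a jump across the front.  Everything else is a choice of [b], [k] and [tau].

    The initial datum alone gives, for [x >= - C t] with any [C], a lower bound that is close
    to [(1 - beta) / 2] if [alpha < 1], a positive constant if [alpha = 1], and of order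
    [t ^ (- (alpha - 1))] if [1 < alpha].  In the last case a lower bound [t ^ (- q)] makes
    the reaction rate at that height at least of order [t ^ (- gam q)], and growth during the
    time [t / 2] improves [q] to any nonnegative number at least [gam q - 1]
    ([front_decay_improve]); since [(gam - 1) (alpha - 1) < 1], finitely many improvements
    reach [q = 0] ([front_decay0]).  In every case the solution is eventually above a level
    from which [g] is positive up to one, and a fixed waiting time then raises it arbitrarily
    close to one ([front_level1]). *)

(** * Real-valued integrals *)

Section RealIntegrals.
Context d (T : measurableType d) (R : realType) (mu : {measure set T -> \bar R}).

Lemma integrable_dominated (D : set T) (f g : T -> R) :
  measurable D -> measurable_fun D f -> (forall x, D x -> `|f x| <= g x) ->
  mu.-integrable D (EFin \o g) -> mu.-integrable D (EFin \o f).
Proof.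
move=> mD mf fg ig; apply: (le_integrable mD _ _ ig); first exact/measurable_EFinP.
by move=> x Dx; rewrite /= lee_fin (le_trans (fg x Dx))// ler_norm.
Qed.

Lemma integrable_mul_bounded (D : set T) (f g : T -> R) (K : R) :
  measurable D -> mu.-integrable D (EFin \o f) -> measurable_fun D g ->
  (forall x, D x -> `|g x| <= K) ->
  mu.-integrable D (EFin \o (fun x => f x * g x)).
Proof.
move=> mD fi mg gK.
have mf : measurable_fun D f by apply/measurable_EFinP; case/integrableP: fi.
apply: (@integrable_dominated _ _ (fun x => `|K| * `|f x|)) => //.
- exact: measurable_funM.
- by move=> x Dx; rewrite normrM mulrC ler_wpM2r// (le_trans (gK x Dx))// ler_norm.
- exact: (integrableZl mD _ (integrable_abse fi)).
Qed.

Lemma Rintegral_cvg (D : set T) (f_ : nat -> T -> R) (f g : T -> R) :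
  measurable D -> (forall n, measurable_fun D (f_ n)) ->
  (forall x, D x -> f_ n x @[n --> \oo] --> f x) ->
  (forall n x, D x -> `|f_ n x| <= g x) ->
  mu.-integrable D (EFin \o g) ->
  \int[mu]_(x in D) f_ n x @[n --> \oo] --> \int[mu]_(x in D) f x.
Proof.
move=> mD mf_ cf fg ig.
have mf : measurable_fun D f by apply: (measurable_fun_cvg mf_ cf).
have [|||||intf _ cvgf] := @dominated_convergence _ _ _ mu _ mD
  (fun n => EFin \o f_ n) (EFin \o f) (EFin \o g).
- by move=> n; exact/measurable_EFinP.
- exact/measurable_EFinP.
- by apply: aeW => x Dx; apply: cvg_EFin; [exact: nearW|exact: cf].
- exact: ig.
- by apply: aeW => x n Dx; rewrite /= lee_fin fg.
rewrite /Rintegral; apply: fine_cvg.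
by rewrite fineK//; exact: integrable_fin_num.
Qed.

(** Monotone convergence along an exhaustion yields integrability together with the
    value of the integral, which is what improper integrals of nonnegative functions
    need. *)
Lemma integrable_monotone (D : set T) (f : T -> R) (A : nat -> set T) (l : R) :
  measurable D -> (forall n, measurable (A n)) ->
  (forall n m, (n <= m)%N -> A n `<=` A m) -> D = \bigcup_n A n ->
  (forall x, D x -> 0 <= f x) -> (forall n, measurable_fun (A n) f) ->
  ((\int[mu]_(x in A n) (f x)%:E)%E @[n --> \oo] --> l%:E) ->
  mu.-integrable D (EFin \o f) /\ \int[mu]_(x in D) f x = l.
Proof.
move=> mD mA Amono DA f0 mf fl.
have mfD : measurable_fun D f by rewrite DA; apply/measurable_fun_bigcup.
have il : (\int[mu]_(x in D) (f x)%:E = l%:E)%E.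
  have : ((\int[mu]_(x in A n) (f x)%:E)%E @[n --> \oo] -->
     (\int[mu]_(x in D) (f x)%:E)%E).
    rewrite DA; apply: ge0_nondecreasing_set_cvg_integral => //.
    - by move=> n m nm; apply/subsetPset; exact: Amono.
    - by move=> n; exact/measurable_EFinP.
    - by move=> n x Ax; rewrite lee_fin f0// DA; exists n.
  by move=> /cvg_lim <-//; apply/cvg_lim.
split; last by rewrite /Rintegral il.
apply/integrableP; split; first exact/measurable_EFinP.
under eq_integral.
  by move=> x /set_mem Dx /=; rewrite ger0_norm ?f0//; over.
by rewrite il ltry.
Qed.

End RealIntegrals.

Section Fubini.
Context d1 d2 (T1 : measurableType d1) (T2 : measurableType d2) (R : realType).
Variables (m1 : {sigma_finite_measure set T1 -> \bar R}).
Variables (m2 : {sigma_finite_measure set T2 -> \bar R}).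
Variables (D1 : set T1) (D2 : set T2) (F : T1 -> T2 -> R) (G1 : T1 -> R) (G2 : T2 -> R).
Hypotheses (mD1 : measurable D1) (mD2 : measurable D2).
Hypothesis mF : measurable_fun setT (fun p : T1 * T2 => F p.1 p.2).
Hypothesis iG1 : m1.-integrable D1 (EFin \o G1).
Hypothesis iG2 : m2.-integrable D2 (EFin \o G2).
Hypothesis FG : forall x y, D1 x -> D2 y -> `|F x y| <= G1 x * G2 y.

Let f (p : T1 * T2) : \bar R := (F p.1 p.2 * \1_D1 p.1 * \1_D2 p.2)%:E.

Let mf : measurable_fun setT f.
Proof.
apply/measurable_EFinP; apply: measurable_funM; first apply: measurable_funM => //.
- by apply: (measurableT_comp _ measurable_fst); exact: measurable_indic.
- by apply: (measurableT_comp _ measurable_snd); exact: measurable_indic.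
Qed.

Let intf : (m1 \x m2)%E.-integrable setT f.
Proof.
apply/(integrable12ltyP m1 m2 mf).
pose g1 x := (G1 x * \1_D1 x)%R; pose g2 y := (G2 y * \1_D2 y)%R.
have ig1 : m1.-integrable setT (EFin \o g1).
  by move/(integrable_mkcond _ mD1) : iG1; rewrite epatch_indic.
have ig2 : m2.-integrable setT (EFin \o g2).
  by move/(integrable_mkcond _ mD2) : iG2; rewrite epatch_indic.
have fg x y : `|F x y * \1_D1 x * \1_D2 y| <= `|g1 x| * `|g2 y|.
  rewrite /g1 /g2 !indicE.
  have [xD|xD] := boolP (x \in D1); last by rewrite !mulr0 !mul0r normr0.
  have [yD|yD] := boolP (y \in D2); last by rewrite !mulr0 normr0 mulr0.
  rewrite !mulr1 -normrM [leRHS]ger0_norm ?FG//; try exact: set_mem.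
  by rewrite (le_trans (normr_ge0 (F x y)))// FG//; exact: set_mem.
have [mg1 fin1] := integrableP _ _ _ ig1.
have [mg2 fin2] := integrableP _ _ _ ig2.
have mag2 : measurable_fun setT (fun y => `|(g2 y)%:E|%E) by exact: measurableT_comp.
have mag1 : measurable_fun setT (fun x => `|(g1 x)%:E|%E) by exact: measurableT_comp.
apply: (@le_lt_trans _ _ (\int[m1]_x (`|(g1 x)%:E| * (\int[m2]_y `|(g2 y)%:E|)))%E).
  apply: ge0_le_integral => //.
  - by move=> x _; exact: integral_ge0.
  - have maf : measurable_fun setT (abse \o f) by exact: measurableT_comp.
    exact: (measurable_fun_fubini_tonelli_F (m2 := m2) _ maf (fun p => abse_ge0 (f p))).
  - by apply: emeasurable_funM => //; exact: measurable_cst.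
  - move=> x _; rewrite -ge0_integralZl//.
    apply: ge0_le_integral => //.
    + apply: measurableT_comp => //.
      exact: (measurableT_comp mf (pair1_measurable x)).
    + by apply: emeasurable_funM => //; exact: measurable_cst.
    + by move=> y _; rewrite /f/= lee_fin fg.
under eq_integral do rewrite muleC.
rewrite ge0_integralZl//; last exact: integral_ge0.
by rewrite lte_mul_pinfty// ?ge0_fin_numE// ?integral_ge0.
Qed.

Let sec1 x : D1 x -> m2.-integrable D2 (EFin \o F x).
Proof.
move=> Dx; apply: (@integrable_dominated _ _ _ _ _ _ (fun y => G1 x * G2 y)) => //.
- by apply: measurable_funTS; exact: (measurableT_comp mF (pair1_measurable x)).
- by move=> y Dy; exact: FG.
- exact: (integrableZl mD2 _ iG2).
Qed.

Let sec2 y : D2 y -> m1.-integrable D1 (EFin \o F ^~ y).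
Proof.
move=> Dy; apply: (@integrable_dominated _ _ _ _ _ _ (fun x => G2 y * G1 x)) => //.
- by apply: measurable_funTS; exact: (measurableT_comp mF (pair2_measurable y)).
- by move=> x Dx; rewrite mulrC; exact: FG.
- exact: (integrableZl mD1 _ iG1).
Qed.

Let F1 x : fubini_F m2 f x = (\int[m2]_(y in D2) F x y * \1_D1 x)%:E.
Proof.
rewrite /fubini_F /f /= indicE; have [xD|xD] := boolP (x \in D1); last first.
  by rewrite mulr0; apply: integral0_eq => y _; rewrite mulr0 mul0r.
rewrite mulr1 /Rintegral fineK; last by apply: integrable_fin_num => //; exact: sec1 (set_mem xD).
rewrite [RHS]integral_mkcond epatch_indic; apply: eq_integral => y _.
by rewrite mulr1.
Qed.

Let F2 y : fubini_G m1 f y = (\int[m1]_(x in D1) F x y * \1_D2 y)%:E.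
Proof.
rewrite /fubini_G /f /= indicE; have [yD|yD] := boolP (y \in D2); last first.
  by rewrite mulr0; apply: integral0_eq => x _; rewrite mulr0.
rewrite mulr1 /Rintegral fineK; last by apply: integrable_fin_num => //; exact: sec2 (set_mem yD).
rewrite [RHS]integral_mkcond epatch_indic; apply: eq_integral => x _.
by rewrite mulr1.
Qed.

Lemma integrable_section : m1.-integrable D1 (EFin \o (fun x => \int[m2]_(y in D2) F x y)).
Proof.
apply/(integrable_mkcond _ mD1); rewrite epatch_indic.
have := integrable_fubini_F intf.
by apply: eq_integrable => // x _; rewrite F1.
Qed.

(** Fubini's theorem under a product majorant; unlike mere integrability on the
    product, it makes every section integrable. *)
Lemma Rintegral_exchange :
  \int[m1]_(x in D1) \int[m2]_(y in D2) F x y =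
  \int[m2]_(y in D2) \int[m1]_(x in D1) F x y.
Proof.
rewrite /Rintegral; congr fine.
rewrite integral_mkcond epatch_indic [RHS]integral_mkcond epatch_indic.
transitivity (\int[m1]_x fubini_F m2 f x)%E.
  by apply: eq_integral => x _; rewrite F1.
rewrite integral12_prod_meas1// -integral21_prod_meas1//.
by apply: eq_integral => x _; rewrite F2.
Qed.

End Fubini.

Section Product.
Context d1 d2 (T1 : measurableType d1) (T2 : measurableType d2) (R : realType).
Variables (m1 : {sigma_finite_measure set T1 -> \bar R}).
Variables (m2 : {sigma_finite_measure set T2 -> \bar R}).

Lemma integrable_prod (G1 : T1 -> R) (G2 : T2 -> R) :
  m1.-integrable setT (EFin \o G1) -> m2.-integrable setT (EFin \o G2) ->
  (m1 \x m2)%E.-integrable setT (EFin \o (fun p => G1 p.1 * G2 p.2)).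
Proof.
move=> i1 i2; have [mg1 fin1] := integrableP _ _ _ i1.
have [mg2 fin2] := integrableP _ _ _ i2.
have mG : measurable_fun setT (EFin \o (fun p : T1 * T2 => G1 p.1 * G2 p.2)).
  apply/measurable_EFinP/measurable_funM.
  - by apply: (measurableT_comp _ measurable_fst); exact/measurable_EFinP.
  - by apply: (measurableT_comp _ measurable_snd); exact/measurable_EFinP.
apply/(integrable12ltyP m1 m2 mG).
have mag1 : measurable_fun setT (fun x => `|(G1 x)%:E|%E) by exact: measurableT_comp.
have mag2 : measurable_fun setT (fun y => `|(G2 y)%:E|%E) by exact: measurableT_comp.
rewrite (eq_integral (fun x => (\int[m2]_y `|(G2 y)%:E|) * `|(G1 x)%:E|)%E); last first.
  move=> x _; rewrite muleC -ge0_integralZl//.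
  by apply: eq_integral => y _; rewrite /= normrM.
rewrite ge0_integralZl//; last exact: integral_ge0.
by rewrite lte_mul_pinfty// ?ge0_fin_numE// ?integral_ge0.
Qed.

Lemma Rintegral_prod (F : T1 * T2 -> R) (G1 : T1 -> R) (G2 : T2 -> R) :
  measurable_fun setT F ->
  m1.-integrable setT (EFin \o G1) -> m2.-integrable setT (EFin \o G2) ->
  (forall p, `|F p| <= G1 p.1 * G2 p.2) ->
  \int[(m1 \x m2)%E]_p F p = \int[m1]_x \int[m2]_y F (x, y).
Proof.
move=> mF i1 i2 FG.
have iF : (m1 \x m2)%E.-integrable setT (EFin \o F).
  by apply: integrable_dominated (integrable_prod i1 i2) => // p _; exact: FG.
rewrite /Rintegral -integral12_prod_meas1//; congr fine.
apply: eq_integral => x _; rewrite /fubini_F fineK//.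
apply: integrable_fin_num => //.
apply: (@integrable_dominated _ _ _ _ _ _ (fun y => G1 x * G2 y)) => //.
- exact: (measurableT_comp mF (pair1_measurable x)).
- exact: (integrableZl measurableT _ i2).
Qed.

End Product.

(** * Improper integrals and affine substitution *)

Lemma halfline_gt0 (R : realType) (z : R) : `]0, +oo[%classic z -> 0 < z.
Proof. by rewrite /= in_itv/= andbT. Qed.

Section ImproperFTC.
Context (R : realType).
Notation mu := (@lebesgue_measure R).
Implicit Types (F f : R -> R).

Let cutoff (n : nat) : set R := `[n.+1%:R^-1, n.+1%:R].

Let cutoffE : `]0%R, +oo[%classic = \bigcup_n cutoff n.
Proof.
apply/seteqP; split => x /=; last first.
  move=> [n _]; rewrite /cutoff/= !in_itv/= andbT => /andP[+ _].
  by apply: lt_le_trans; rewrite invr_gt0.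
rewrite in_itv/= andbT => x0.
exists (maxn (Num.truncn x) (Num.truncn x^-1)) => //.
rewrite /cutoff/= in_itv/=; apply/andP; split; last first.
  by rewrite (le_trans (ltW (truncnS_gt x)))// ler_nat ltnS leq_maxl.
rewrite invf_ple ?posrE//.
by rewrite (le_trans (ltW (truncnS_gt _)))// ler_nat ltnS leq_maxr.
Qed.

Let cutoff_mono n m : (n <= m)%N -> cutoff n `<=` cutoff m.
Proof.
move=> nm x; rewrite /cutoff/= !in_itv/= => /andP[xn nx]; apply/andP; split.
- by rewrite (le_trans _ xn)// lef_pV2 ?posrE// ler_nat ltnS.
- by rewrite (le_trans nx)// ler_nat ltnS.
Qed.

Lemma integral_segment_derive F f (a b : R) : 0 < a -> a <= b ->
  (forall x : R, 0 < x -> is_derive x 1 F (f x)) ->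
  (forall x : R, 0 < x -> {for x, continuous f}) ->
  (\int[mu]_(x in `[a, b]) (f x)%:E = (F b - F a)%:E)%E.
Proof.
move=> a0 ab dF cf; have b0 := lt_le_trans a0 ab.
move: ab; rewrite le_eqVlt => /predU1P[<-|ab].
  by rewrite set_itv1 integral_set1 subrr.
have cF (x : R) : 0 < x -> {for x, continuous F}.
  move=> x0; apply/differentiable_continuous/derivable1_diffP.
  by have [] := dF x x0.
rewrite (@continuous_FTC2 _ f F)//.
- apply: continuous_in_subspaceT => x /set_mem/=; rewrite in_itv/= => /andP[ax _].
  by apply: cf; exact: lt_le_trans ax.
- split.
  + move=> x; rewrite in_itv/= => /andP[ax _].
    by have [] := dF x (lt_trans a0 ax).
  + by apply: cvg_at_right_filter; exact: cF.
  + by apply: cvg_at_left_filter; exact: cF.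
- move=> x; rewrite in_itv/= => /andP[ax _].
  by rewrite derive1E; have [_ ->] := dF x (lt_trans a0 ax).
Qed.

Let measurable_pos f : (forall x : R, 0 < x -> {for x, continuous f}) ->
  measurable_fun (`]0, +oo[ : set R) f.
Proof.
move=> cf; apply: open_continuous_measurable_fun => // x /set_mem/=.
by rewrite in_itv/= andbT; exact: cf.
Qed.

Let cvg_boundary F (A B : R) : F x @[x --> 0^'+] --> A -> F x @[x --> +oo] --> B ->
  F n.+1%:R - F n.+1%:R^-1 @[n --> \oo] --> B - A.
Proof.
move=> FA FB; apply: cvgB.
- apply: ((cvg_pinftyP F B).1 FB (fun n => n.+1%:R)).
  have := @cvgr_idn R; rewrite -(cvg_shiftn 1).
  by under eq_fun do rewrite addn1.
- apply: ((cvg_at_rightP F 0 A).1 FA (fun n => n.+1%:R^-1)); split.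
  + by move=> n; rewrite invr_gt0.
  + exact: cvg_harmonic.
Qed.

(** Both endpoints are improper, so the segments [[1 / (n + 1), n + 1]] are exhausted;
    monotone convergence makes integrability a conclusion here. *)
Lemma ge0_FTC_halfline F f (A B : R) :
  (forall x : R, 0 < x -> is_derive x 1 F (f x)) ->
  (forall x : R, 0 < x -> {for x, continuous f}) ->
  (forall x : R, 0 < x -> 0 <= f x) ->
  F x @[x --> 0^'+] --> A -> F x @[x --> +oo] --> B ->
  mu.-integrable `]0%R, +oo[ (EFin \o f) /\ \int[mu]_(x in `]0, +oo[) f x = B - A.
Proof.
move=> dF cf f0 FA FB; have := @integrable_monotone _ _ R mu `]0%R, +oo[%classic f cutoff (B - A).
apply => //.
- by move=> n; exact: measurable_itv.
- by move=> x /=; rewrite in_itv/= andbT; exact: f0.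
- move=> n; apply: measurable_funS (measurable_pos cf) => //.
  by rewrite cutoffE; exact: bigcup_sup.
- rewrite (_ : (fun n => _) = (fun n => (F n.+1%:R - F n.+1%:R^-1)%:E)).
    by apply: cvg_EFin; [exact: nearW|exact: cvg_boundary].
  apply/funext => n.
  by rewrite (@integral_segment_derive F f)// (@le_trans _ _ 1)// ?invf_le1// ler1n.
Qed.

Lemma FTC_halfline F f (A B : R) :
  (forall x : R, 0 < x -> is_derive x 1 F (f x)) ->
  (forall x : R, 0 < x -> {for x, continuous f}) ->
  mu.-integrable `]0%R, +oo[ (EFin \o f) ->
  F x @[x --> 0^'+] --> A -> F x @[x --> +oo] --> B ->
  \int[mu]_(x in `]0, +oo[) f x = B - A.
Proof.
move=> dF cf fi FA FB.
have lim : \int[mu]_(x in `]0, +oo[) (f x * \1_(cutoff n) x) @[n --> \oo] -->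
    \int[mu]_(x in `]0, +oo[) f x.
  apply: (@Rintegral_cvg _ _ _ mu _ _ _ (fun x => `|f x|)) (integrable_abse fi) => //.
  - move=> n; apply: measurable_funM; first exact: measurable_pos.
    by apply: measurable_indic; exact: measurable_itv.
  - move=> x; rewrite cutoffE => -[N _ Nx].
    apply: cvg_near_cst; near=> n; rewrite indicE mem_set ?mulr1//.
    by apply: cutoff_mono Nx; near: n; exact: nbhs_infty_ge.
  - move=> n x _; rewrite normrM indicE.
    by case: (_ \in _); rewrite ?normr1 ?normr0 ?mulr1 ?mulr0.
have E n : \int[mu]_(x in `]0, +oo[) (f x * \1_(cutoff n) x) =
    F n.+1%:R - F n.+1%:R^-1.
  rewrite /Rintegral -[RHS]/(fine (F n.+1%:R - F n.+1%:R^-1)%:E); congr fine.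
  rewrite -(@integral_segment_derive F f)//; last first.
    by rewrite (@le_trans _ _ 1)// ?invf_le1// ler1n.
  rewrite [RHS]integral_mkcond [LHS]integral_mkcond !epatch_indic.
  apply: eq_integral => x _ /=; rewrite !indicE -!EFinM; congr EFin.
  have [xn|xn] := boolP (x \in _); last by rewrite !mulr0 mul0r.
  have -> : x \in `]0%R, +oo[%classic.
    by rewrite cutoffE; apply/mem_set; exists n => //; exact: set_mem.
  by rewrite mulr1.
move: lim; under eq_fun do rewrite E.
by move=> lim; apply: (cvg_unique _ lim (cvg_boundary FA FB)).
Unshelve. all: by end_near. Qed.

End ImproperFTC.

Section AffineChange.
Context (R : realType).
Notation mu := (@lebesgue_measure R).

Lemma lebesgue_measure_affine (x c : R) (A : set R) : 0 < c -> measurable A ->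
  (c%:E * pushforward mu (fun z : R => (x - c * z)%R : measurableTypeR R) A = mu A)%E.
Proof.
move=> c0 mA; pose phi (z : R) : measurableTypeR R := x - c * z.
have mphi : measurable_fun setT phi.
  by apply: measurable_funB => //; exact: measurable_funM.
have -> : (c%:E * pushforward mu phi A)%E =
  mscale (NngNum (ltW c0)) (pushforward mu phi) A by [].
apply/esym/lebesgue_measure_unique => //= _ [[a b]] _ <-.
rewrite /mscale/= /pushforward.
have -> : phi @^-1` `]a, b] = `[(x - b) / c, (x - a) / c[%classic.
  apply/seteqP; split => z /=; rewrite !in_itv/= /phi;
    rewrite ler_pdivrMr// ltr_pdivlMr// (mulrC z); lra.
rewrite !lebesgue_measure_itv/= !lte_fin ltr_pM2r ?invr_gt0//.
rewrite ltrD2l ltrN2; case: ifPn => ab; last by rewrite mule0.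
by rewrite -!EFinB -EFinM; congr EFin; field; rewrite gt_eqF.
Qed.

(** Lebesgue measure is [c] times its image under [z |-> x - c z]; nonnegative
    functions come first, and signed ones are split into their two parts. *)
Lemma Rintegral_affine (f : R -> R) (x c : R) : 0 < c ->
  mu.-integrable setT (EFin \o f) ->
  mu.-integrable setT (EFin \o (fun z => f (x - c * z))) /\
  \int[mu]_y f y = c * \int[mu]_z f (x - c * z).
Proof.
move=> c0 fi; have [mf _] := integrableP _ _ _ fi.
pose phi (z : measurableTypeR R) : measurableTypeR R := x - c * z.
have mphi : measurable_fun setT phi.
  by apply: measurable_funB => //; exact: measurable_funM.
have ge0E (h : R -> \bar R) : measurable_fun setT h -> (forall y, 0 <= h y)%E ->
    (\int[mu]_y h y = c%:E * \int[mu]_z h (x - c * z)%R)%E.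
  move=> mh h0.
  have -> : (\int[mu]_z h (x - c * z)%R =
     \int[pushforward mu (fun z : R => (x - c * z)%R : measurableTypeR R)]_y h y)%E.
    apply/esym; apply: (ge0_integral_pushforward (phi := phi) mphi mu measurableT mh).
    by move=> y _; exact: h0.
  rewrite -[c%:E]/((NngNum (ltW c0))%:num%:E) -ge0_integral_mscale//.
  by apply: eq_measure_integral => A mA _; exact/esym/lebesgue_measure_affine.
have fi' : mu.-integrable setT (EFin \o (fun z => f (x - c * z))).
  apply/integrableP; split; first exact: (measurableT_comp mf).
  have : (\int[mu]_y `|(f y)%:E| < +oo)%E by case/integrableP: fi.
  rewrite ge0E//; last exact: measurableT_comp.
  rewrite !ltey; apply: contra => /eqP ->.
  by rewrite gt0_muley// lte_fin.
split => //.
have E : (\int[mu]_y (f y)%:E = c%:E * \int[mu]_z (f (x - c * z)%R)%:E)%E.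
  rewrite integralE [in RHS]integralE muleBr//; last first.
    by rewrite fin_num_adde_defr// integrable_pos_fin_num.
  congr (_ - _)%E; rewrite ge0E//.
  - by congr (_ * _)%E; apply: eq_integral => z _; rewrite !funeposE.
  - exact: measurable_funepos.
  - by congr (_ * _)%E; apply: eq_integral => z _; rewrite !funenegE.
  - exact: measurable_funeneg.
by rewrite /Rintegral E fineM//; exact: integrable_fin_num.
Qed.

End AffineChange.

(** * Joint measurability *)

Section JointMeasurability.
Context d (T : measurableType d) (R : realType).

(** Round the continuous variable to a grid of mesh [1 / (n + 1)]: the rounded function
    is measurable on each strip and converges pointwise.  Continuity is only available
    for nonnegative parameters, whence the absolute value. *)
Lemma measurable_caratheodory (F : R -> T -> R) :
  (forall x, 0 <= x -> measurable_fun setT (F x)) ->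
  (forall x y, 0 <= x -> forall e, 0 < e -> exists2 dl, 0 < dl &
    forall x', 0 <= x' -> `|x - x'| < dl -> `|F x y - F x' y| < e) ->
  measurable_fun setT (fun p : R * T => F `|p.1| p.2).
Proof.
move=> mF cF.
pose grid (n : nat) (x : R) : R := (Num.truncn (n.+1%:R * `|x|))%:R / n.+1%:R.
apply: (@measurable_fun_cvg _ _ _ _ (fun n (p : R * T) => F (grid n p.1) p.2)).
- move=> n.
  pose E k : set (R * T) := [set p | (k%:R <= n.+1%:R * `|p.1| < k.+1%:R)%R].
  have -> : [set: R * T] = \bigcup_k E k.
    apply/seteqP; split => // p _; exists (Num.truncn (n.+1%:R * `|p.1|)) => //.
    by apply: truncn_itv; rewrite mulr_ge0.
  have mE k : measurable (E k).
    have mh : measurable_fun setT (fun p : R * T => n.+1%:R * `|p.1|).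
      apply: measurable_funM => //.
      by apply: measurableT_comp => //; exact: measurable_fst.
    rewrite [E k](_ : _ = setT `&` (fun p : R * T => n.+1%:R * `|p.1|) @^-1`
        `[k%:R, k.+1%:R[%classic); first exact: mh.
    by rewrite setTI; apply/seteqP; split => p /=; rewrite in_itv.
  apply/measurable_fun_bigcup => // k.
  apply: (@eq_measurable_fun _ _ _ _ _ (fun p : R * T => F (k%:R / n.+1%:R) p.2)).
    move=> p /set_mem /= /truncn_def pk.
    by rewrite /grid pk.
  apply: measurable_funTS; apply: (measurableT_comp _ measurable_snd).
  by apply: mF; rewrite divr_ge0.
- move=> p _ /=; apply/cvgrPdist_lt => e e0.
  have [dl dl0 H] := cF `|p.1| p.2 (normr_ge0 _) e e0.
  near=> n; apply: H; first by rewrite divr_ge0.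
  have n0 : (0 : R) < n.+1%:R by [].
  have /andP[lo hi] : ((Num.truncn (n.+1%:R * `|p.1|))%:R <= n.+1%:R * `|p.1| <
      (Num.truncn (n.+1%:R * `|p.1|)).+1%:R)%R by apply: truncn_itv; rewrite mulr_ge0.
  rewrite ger0_norm; last by rewrite subr_ge0 /grid ler_pdivrMr// [leRHS]mulrC.
  rewrite /grid (_ : `|p.1| - _ = (n.+1%:R * `|p.1| -
     (Num.truncn (n.+1%:R * `|p.1|))%:R) / n.+1%:R); last by field.
  rewrite ltr_pdivrMr// (@lt_trans _ _ 1)//.
    by rewrite ltrBlDl natr1.
  rewrite -ltr_pdivrMl// mulr1.
  by rewrite (@lt_trans _ _ n%:R)// ?ltr_nat//; near: n; exact: nbhs_infty_gtr.
Unshelve. all: by end_near. Qed.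

End JointMeasurability.

(** * The Cauchy kernel *)

Section CauchyKernel.
Context (R : realType).
Notation mu := (@lebesgue_measure R).
Implicit Types (e v x y l : R).

Lemma is_derive_continuous (f : R -> R) x df : is_derive x 1 f df -> {for x, continuous f}.
Proof.
by move=> [fx _]; apply/differentiable_continuous/derivable1_diffP.
Qed.

Lemma is_derive_measurable (f df : R -> R) :
  (forall x, is_derive x 1 f (df x)) -> measurable_fun setT f.
Proof.
by move=> fd; apply: continuous_measurable_fun => x; exact: is_derive_continuous (fd x).
Qed.

Lemma measurable_cos : measurable_fun setT (@cos R).
Proof. by apply: continuous_measurable_fun; exact: continuous_cos. Qed.
Lemma measurable_sin : measurable_fun setT (@sin R).
Proof. by apply: continuous_measurable_fun; exact: continuous_sin. Qed.

Lemma cvg0_dominated (T : Type) (F : set_system T) (FF : Filter F) (f g : T -> R) :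
  (\forall x \near F, `|f x| <= g x) -> g x @[x --> F] --> 0 -> f x @[x --> F] --> 0.
Proof.
move=> fg g0; apply: norm_cvg0; apply: (squeeze_cvgr _ (cvg_cst 0) g0).
by apply: filterS fg => x ->; rewrite normr_ge0.
Qed.

Lemma cvg_expR_scale e : 0 < e -> expR (- (e * l)) @[l --> +oo] --> 0.
Proof.
move=> e0; apply: (@cvg_comp _ _ _ (fun l => e * l) (fun l => expR (- l)) _ +oo).
  by apply: gt0_cvgMry => //; exact: cvg_id.
exact: cvgr_expR.
Qed.

Lemma integrable_expR e : 0 < e ->
  mu.-integrable `]0, +oo[ (EFin \o (fun l => expR (- (e * l)))).
Proof.
move=> e0.
have D l : is_derive l 1 (fun l => - e^-1 * expR (- (e * l))) (expR (- (e * l))).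
  by apply: is_derive_eq; rewrite /GRing.scale/=; field; rewrite gt_eqF.
have [||||] := @ge0_FTC_halfline _ (fun l => - e^-1 * expR (- (e * l)))
  (fun l => expR (- (e * l))) (- e^-1 * expR (- (e * 0))) (- e^-1 * 0) => //.
- by move=> l _; apply: is_derive_continuous; apply: is_derive_eq; reflexivity.
- by apply: cvg_at_right_filter; exact: is_derive_continuous (D 0).
- by apply: cvgM; [exact: cvg_cst|exact: cvg_expR_scale].
Qed.

(** The Cauchy density of scale [e], up to the factor [pi]. *)
Definition cauchy e v : R := e / (e ^+ 2 + v ^+ 2).

Let den_gt0 e v : 0 < e -> 0 < e ^+ 2 + v ^+ 2.
Proof. by move=> e0; rewrite ltr_wpDr ?sqr_ge0 ?exprn_gt0. Qed.

Lemma cauchy_ge0 e v : 0 < e -> 0 <= cauchy e v.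
Proof. by move=> e0; rewrite divr_ge0 ?(ltW e0) ?(ltW (den_gt0 v e0)). Qed.

Let laplace_trig (trig : R -> R) e v : 0 < e -> (forall x, `|trig x| <= 1) ->
  measurable_fun setT trig ->
  mu.-integrable `]0, +oo[ (EFin \o (fun l => expR (- (e * l)) * trig (l * v))).
Proof.
move=> e0 t1 mt; apply: (integrable_mul_bounded (K := 1)) => //.
- exact: integrable_expR.
- apply: measurable_funTS; apply: (measurableT_comp mt).
  exact: measurable_funM.
Qed.

(* The primitives used for both Laplace transforms are of this form. *)
Let primitive_cvg0 (a b e v : R) : 0 < e ->
  expR (- (e * l)) * (a * sin (l * v) + b * cos (l * v)) @[l --> +oo] --> 0.
Proof.
move=> e0; apply: (@cvg0_dominated _ _ _ _ (fun l => (`|a| + `|b|) * expR (- (e * l)))).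
  apply: nearW => l; rewrite normrM [leRHS]mulrC ger0_norm ?expR_ge0//.
  rewrite ler_wpM2l ?expR_ge0// (le_trans (ler_normD _ _))// lerD// normrM ler_piMr//.
  - exact: sin_max.
  - exact: cos_max.
rewrite -(mulr0 (`|a| + `|b|)); apply: cvgM; first exact: cvg_cst.
exact: cvg_expR_scale.
Qed.

Lemma laplace_cos e v : 0 < e ->
  \int[mu]_(l in `]0, +oo[) (expR (- (e * l)) * cos (l * v)) = cauchy e v.
Proof.
move=> e0; have d0 := den_gt0 v e0.
pose F l := expR (- (e * l)) * (v / (e ^+ 2 + v ^+ 2) * sin (l * v) +
   (- e / (e ^+ 2 + v ^+ 2)) * cos (l * v)).
have D l : is_derive l 1 F (expR (- (e * l)) * cos (l * v)).
  by apply: is_derive_eq; rewrite /GRing.scale/=; field; rewrite gt_eqF.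
rewrite (@FTC_halfline _ F _ (F 0) 0)//.
- by rewrite /F !(mul0r, mulr0, oppr0, expR0, sin0, cos0, mul1r, mulr1, add0r, sub0r) mulNr opprK.
- by move=> l _; apply: is_derive_continuous; apply: is_derive_eq; reflexivity.
- apply: laplace_trig => //; first exact: cos_max.
  by apply: continuous_measurable_fun; exact: continuous_cos.
- by apply: cvg_at_right_filter; exact: is_derive_continuous (D 0).
- exact: primitive_cvg0.
Qed.

Lemma laplace_sin e v : 0 < e ->
  \int[mu]_(l in `]0, +oo[) (expR (- (e * l)) * sin (l * v)) = v / (e ^+ 2 + v ^+ 2).
Proof.
move=> e0; have d0 := den_gt0 v e0.
pose F l := expR (- (e * l)) * (- e / (e ^+ 2 + v ^+ 2) * sin (l * v) +
   (- v / (e ^+ 2 + v ^+ 2)) * cos (l * v)).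
have D l : is_derive l 1 F (expR (- (e * l)) * sin (l * v)).
  by apply: is_derive_eq; rewrite /GRing.scale/=; field; rewrite gt_eqF.
rewrite (@FTC_halfline _ F _ (F 0) 0)//.
- by rewrite /F !(mul0r, mulr0, oppr0, expR0, sin0, cos0, mul1r, mulr1, add0r, sub0r) mulNr opprK.
- by move=> l _; apply: is_derive_continuous; apply: is_derive_eq; reflexivity.
- apply: laplace_trig => //; first exact: sin_max.
  by apply: continuous_measurable_fun; exact: continuous_sin.
- by apply: cvg_at_right_filter; exact: is_derive_continuous (D 0).
- exact: primitive_cvg0.
Qed.

Lemma integral_oneDsqrV : (\int[mu]_z ((oneDsqr z)^-1)%:E = pi%:E)%E.
Proof.
rewrite ge0_symfun_integralT//.
- by rewrite -set_itvcy integral0y_oneDsqr -EFinM; congr EFin; field.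
- exact: continuous_oneDsqrV.
- by move=> z; rewrite /= /oneDsqr sqrrN.
Qed.

Lemma Rintegral_oneDsqrV : \int[mu]_z (oneDsqr z)^-1 = pi.
Proof. by rewrite /Rintegral integral_oneDsqrV. Qed.

Lemma integrable_oneDsqrV : mu.-integrable setT (EFin \o (fun z : R => (oneDsqr z)^-1)).
Proof.
have m1 : measurable_fun setT (fun z : R => (oneDsqr z)^-1).
  by apply: continuous_measurable_fun; exact: continuous_oneDsqrV.
apply/integrableP; split; first exact/measurable_EFinP.
under eq_integral do rewrite /= ger0_norm ?invr_ge0//.
by rewrite integral_oneDsqrV ltry.
Qed.

End CauchyKernel.

Section ParametricMeasurability.
Context d1 d2 (T1 : measurableType d1) (T2 : measurableType d2) (R : realType).
Variable m2 : {sigma_finite_measure set T2 -> \bar R}.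

Lemma measurable_Rintegral (D : set T2) (F : T1 -> T2 -> R) : measurable D ->
  measurable_fun setT (fun p : T1 * T2 => F p.1 p.2) ->
  measurable_fun setT (fun x => \int[m2]_(y in D) F x y).
Proof.
move=> mD mF; pose f (p : T1 * T2) : \bar R := (F p.1 p.2 * \1_D p.2)%:E.
have mf : measurable_fun setT f.
  apply/measurable_EFinP; apply: measurable_funM => //.
  by apply: (measurableT_comp _ measurable_snd); exact: measurable_indic.
have -> : (fun x => \int[m2]_(y in D) F x y) =
    fine \o (fun x => fubini_F m2 f^\+ x - fubini_F m2 f^\- x)%E.
  apply/funext => x; rewrite /Rintegral /=; congr fine.
  rewrite integral_mkcond epatch_indic integralE.
  by congr (_ - _)%E; apply: eq_integral => y _; rewrite ?funeposE ?funenegE.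
apply: (measurableT_comp (fine_measurable _)) => //.
apply: emeasurable_funB.
- by apply: (measurable_fun_fubini_tonelli_F (m2 := m2) f^\+%E) => //; exact: measurable_funepos.
- by apply: (measurable_fun_fubini_tonelli_F (m2 := m2) f^\-%E) => //; exact: measurable_funeneg.
Qed.

End ParametricMeasurability.

Section CharacteristicFunctions.
Context (R : realType).
Notation mu := (@lebesgue_measure R).
Local Notation step n := (n.+1%:R^-1 : R).

Lemma step_gt0 n : 0 < step n. Proof. by rewrite invr_gt0. Qed.

Lemma measurable_cauchy (e : R) : 0 < e -> measurable_fun setT (cauchy e).
Proof.
move=> e0; apply: continuous_measurable_fun => v.
have d0 : e ^+ 2 + v ^+ 2 != 0 by rewrite gt_eqF// ltr_wpDr ?sqr_ge0 ?exprn_gt0.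
by apply: is_derive_continuous; apply: is_derive_eq; reflexivity.
Qed.

Lemma cauchy_le (e v : R) : 0 < e -> cauchy e v <= e^-1.
Proof.
move=> e0; have d0 : 0 < e ^+ 2 + v ^+ 2 by rewrite ltr_wpDr ?sqr_ge0 ?exprn_gt0.
rewrite /cauchy ler_pdivrMr// mulrDr -[X in X <= _]addr0 lerD//.
- by rewrite expr2 mulKf// gt_eqF.
- by rewrite mulr_ge0 ?invr_ge0 ?(ltW e0)// sqr_ge0.
Qed.

(** Rescaling turns the smoothing by [cauchy e] into an average against a fixed kernel. *)
Lemma cauchy_smoothing (h : R -> R) (K e x : R) : 0 < e ->
  measurable_fun setT h -> (forall y, `|h y| <= K) ->
  \int[mu]_y (h y * cauchy e (x - y)) = \int[mu]_z ((oneDsqr z)^-1 * h (x - e * z)).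
Proof.
move=> e0 mh hK; have e1 : 0 < e^-1 by rewrite invr_gt0.
have E y : cauchy e (x - y) = e^-1 * (oneDsqr (x / e - e^-1 * y))^-1.
  rewrite /cauchy /oneDsqr.
  have d0 : e ^+ 2 + (x - y) ^+ 2 != 0 by rewrite gt_eqF// ltr_wpDr ?sqr_ge0 ?exprn_gt0.
  have d1 : 1 + (x / e - e^-1 * y) ^+ 2 != 0 by rewrite gt_eqF// ltr_wpDr ?sqr_ge0.
  apply: (mulIf d0); apply: (mulIf d1); field.
  by rewrite (gt_eqF e0).
have [iq _] := Rintegral_affine (x / e) e1 (integrable_oneDsqrV R).
have ic : mu.-integrable setT (EFin \o (fun y => cauchy e (x - y))).
  under eq_fun do rewrite /= E.
  exact: (integrableZl measurableT _ iq).
have ich : mu.-integrable setT (EFin \o (fun y => h y * cauchy e (x - y))).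
  under eq_fun do rewrite /= mulrC.
  exact: (integrable_mul_bounded (K := K)).
have [_ ->] := Rintegral_affine x e0 ich.
have [ich' _] := Rintegral_affine x e0 ich.
rewrite -RintegralZl//; apply: eq_Rintegral => z _.
rewrite subKr /cauchy /oneDsqr.
have d1 : 1 + z ^+ 2 != 0 by rewrite gt_eqF// ltr_wpDr ?sqr_ge0.
have d0 : e ^+ 2 + (e * z) ^+ 2 != 0 by rewrite gt_eqF// ltr_wpDr ?sqr_ge0 ?exprn_gt0.
by field; rewrite ?d1 ?d0 ?(gt_eqF e0).
Qed.

Lemma cauchy_smoothing_cvg (h : R -> R) (K x : R) :
  measurable_fun setT h -> (forall y, `|h y| <= K) -> {for x, continuous h} ->
  \int[mu]_y (h y * cauchy (step n) (x - y)) @[n --> \oo] --> pi * h x.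
Proof.
move=> mh hK ch; under eq_fun do rewrite (cauchy_smoothing _ (step_gt0 _) mh hK).
rewrite (_ : pi * h x = \int[mu]_z ((oneDsqr z)^-1 * h x)); last first.
  rewrite RintegralZr//; last exact: integrable_oneDsqrV.
  by rewrite /Rintegral integral_oneDsqrV.
apply: (@Rintegral_cvg _ _ R mu setT (fun n z => (oneDsqr z)^-1 * h (x - step n * z))
   _ (fun z => K * (oneDsqr z)^-1)) => //.
- move=> n; apply: measurable_funM.
    by apply: continuous_measurable_fun; exact: continuous_oneDsqrV.
  by apply: (measurableT_comp mh); apply: measurable_funB.
- move=> z _; apply: cvgM; first exact: cvg_cst.
  apply: (@cvg_comp _ _ _ (fun n => x - step n * z) h _ (nbhs x)) ch.
  have : x - step n * z @[n --> \oo] --> x - 0 * z.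
    apply: cvgB; first exact: cvg_cst.
    by apply: cvgM; [exact: cvg_harmonic|exact: cvg_cst].
  by rewrite mul0r subr0.
- move=> n z _; rewrite normrM mulrC [X in _ * X]ger0_norm ?invr_ge0//.
  by rewrite ler_wpM2r ?invr_ge0.
- exact: (integrableZl measurableT _ (integrable_oneDsqrV R)).
Qed.

End CharacteristicFunctions.

(** * Fourier uniqueness and Parseval's identity *)

Section Smoothing.
Context d (T : measurableType d) (R : realType) (m : {sigma_finite_measure set T -> \bar R}).
Notation mu := (@lebesgue_measure R).
Local Notation step n := (n.+1%:R^-1 : R).
Variables (w X : T -> R).
Hypotheses (iw : m.-integrable setT (EFin \o w)) (mX : measurable_fun setT X).

(** Real and imaginary parts of the Fourier transform of the law of [X] under
    the weight [w]. *)
Definition ecos (l : R) := \int[m]_x (w x * cos (l * X x)).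
Definition esin (l : R) := \int[m]_x (w x * sin (l * X x)).

Let mw : measurable_fun setT w.
Proof. by apply/measurable_EFinP; case/integrableP: iw. Qed.

Let iaw : m.-integrable setT (EFin \o (fun x => `|w x|)).
Proof. exact: integrable_abse iw. Qed.

Lemma integrable_weight (h : R -> R) (K : R) : measurable_fun setT h ->
  (forall y, `|h y| <= K) -> m.-integrable setT (EFin \o (fun x => w x * h (X x))).
Proof.
move=> mh hK; apply: (integrable_mul_bounded (K := K)) => //.
exact: (measurableT_comp mh).
Qed.

Let measurable_trig (trig : R -> R) : measurable_fun setT trig ->
  measurable_fun setT (fun l : R => \int[m]_x (w x * trig (l * X x))).
Proof.
move=> mt; apply: (@measurable_Rintegral _ _ (measurableTypeR R) T R m setT
  (fun l x => w x * trig (l * X x))) => //.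
apply: measurable_funM; first exact: (measurableT_comp mw measurable_snd).
apply: (measurableT_comp mt); apply: measurable_funM; first exact: measurable_fst.
exact: (measurableT_comp mX measurable_snd).
Qed.

Lemma measurable_ecos : measurable_fun setT ecos.
Proof. exact: measurable_trig (@measurable_cos R). Qed.
Lemma measurable_esin : measurable_fun setT esin.
Proof. exact: measurable_trig (@measurable_sin R). Qed.

Let integrable_trig (trig : R -> R) l : measurable_fun setT trig -> (forall y, `|trig y| <= 1) ->
  m.-integrable setT (EFin \o (fun x => w x * trig (l * X x))).
Proof.
move=> mt t1; apply: (integrable_weight (h := fun y => trig (l * y)) (K := 1)) => //.
by apply: (measurableT_comp mt); exact: measurable_funM.
Qed.
Let icos l := integrable_trig l (@measurable_cos R) (@cos_max R).
Let isin l := integrable_trig l (@measurable_sin R) (@sin_max R).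

Let trig_int_le (trig : R -> R) l : measurable_fun setT trig -> (forall y, `|trig y| <= 1) ->
  `|\int[m]_x (w x * trig (l * X x))| <= \int[m]_x `|w x|.
Proof.
move=> mt t1; have it := integrable_trig l mt t1.
rewrite (le_trans (le_normr_Rintegral _ it))//; apply: le_Rintegral => //.
- exact: integrable_abse it.
- by move=> x _; rewrite normrM ler_piMr.
Qed.

Lemma ecos_le (l : R) : `|ecos l| <= \int[m]_x `|w x|.
Proof. exact: trig_int_le (@measurable_cos R) (@cos_max R). Qed.
Lemma esin_le (l : R) : `|esin l| <= \int[m]_x `|w x|.
Proof. exact: trig_int_le (@measurable_sin R) (@sin_max R). Qed.

(** Convolving with the Cauchy kernel only sees the Fourier transform, because the
    kernel is itself a superposition of cosines. *)
Lemma cauchy_transform (e y : R) : 0 < e ->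
  \int[m]_x (w x * cauchy e (X x - y)) =
  \int[mu]_(l in `]0, +oo[) (expR (- (e * l)) *
     (cos (l * y) * ecos l + sin (l * y) * esin l)).
Proof.
move=> e0.
transitivity (\int[m]_x \int[mu]_(l in `]0, +oo[)
    (w x * (expR (- (e * l)) * cos (l * (X x - y))))).
  apply: eq_Rintegral => x _; rewrite RintegralZl ?laplace_cos//.
  apply: (integrable_mul_bounded (K := 1)) => //.
  - exact: integrable_expR.
  - apply: measurable_funTS; apply: (measurableT_comp (@measurable_cos R)).
    exact: measurable_funM.
  - by move=> l _; exact: cos_max.
have mF : measurable_fun setT (fun p : T * measurableTypeR R =>
    w p.1 * (expR (- (e * p.2)) * cos (p.2 * (X p.1 - y)))).
  have m2 : measurable_fun setT (fun p : T * measurableTypeR R => p.2) by exact: measurable_snd.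
  have mX1 : measurable_fun setT (fun p : T * measurableTypeR R => X p.1).
    exact: (measurableT_comp mX measurable_fst).
  apply: measurable_funM; first exact: (measurableT_comp mw measurable_fst).
  apply: measurable_funM.
  - apply: measurableT_comp => //; apply: measurableT_comp => //.
    exact: measurable_funM.
  - apply: (measurableT_comp (@measurable_cos R)); apply: measurable_funM => //.
    exact: measurable_funB.
rewrite (@Rintegral_exchange _ _ T (measurableTypeR R) R m mu setT `]0, +oo[%classic _
  (fun x => `|w x|) (fun l => expR (- (e * l))) _ _ mF)//; last 2 first.
- exact: integrable_expR.
- move=> x l _ _; rewrite !normrM ler_wpM2l// ger0_norm ?expR_ge0// ler_piMr ?expR_ge0//.
  exact: cos_max.
apply: eq_Rintegral => l _; rewrite /ecos /esin -!RintegralZl//.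
rewrite -RintegralD//; last 2 first.
- exact: (integrableZl measurableT _ (icos l)).
- exact: (integrableZl measurableT _ (isin l)).
rewrite -RintegralZl//; last first.
  apply: (integrableD measurableT (f := EFin \o _) (g := EFin \o _)).
  - exact: (integrableZl measurableT _ (icos l)).
  - exact: (integrableZl measurableT _ (isin l)).
by apply: eq_Rintegral => x _; rewrite mulrBr cosB; ring.
Qed.

(** Fubini moves the smoothing from the law of [X] to the test function, on which the
    Cauchy kernel acts as an approximate identity. *)
Lemma cauchy_transform_cvg (h : R -> R) (K : R) :
  continuous h -> (forall y, `|h y| <= K) -> mu.-integrable setT (EFin \o h) ->
  \int[mu]_y (h y * \int[m]_x (w x * cauchy (step n) (X x - y))) @[n --> \oo] -->
    pi * \int[m]_x (w x * h (X x)).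
Proof.
move=> ch hK ih; have mh : measurable_fun setT h by exact: continuous_measurable_fun.
have mc (e : R) : 0 < e -> measurable_fun setT (fun p : measurableTypeR R * T =>
    h p.1 * (w p.2 * cauchy e (X p.2 - p.1))).
  move=> e0; apply: measurable_funM; first exact: (measurableT_comp mh measurable_fst).
  apply: measurable_funM; first exact: (measurableT_comp mw measurable_snd).
  apply: (measurableT_comp (measurable_cauchy e0)); apply: measurable_funB => //.
  exact: (measurableT_comp mX measurable_snd).
have ic (e y : R) : 0 < e ->
    m.-integrable setT (EFin \o (fun x => w x * cauchy e (X x - y))).
  move=> e0; apply: (integrable_weight (h := fun z => cauchy e (z - y)) (K := e^-1)) => [|z].
  - by apply: (measurableT_comp (measurable_cauchy e0)); exact: measurable_funB.
  - by rewrite ger0_norm ?cauchy_ge0 ?cauchy_le.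
have E n : \int[mu]_y (h y * \int[m]_x (w x * cauchy (step n) (X x - y))) =
    \int[m]_x (w x * \int[mu]_y (h y * cauchy (step n) (X x - y))).
  have n0 := step_gt0 R n.
  transitivity (\int[mu]_y \int[m]_x (h y * (w x * cauchy (step n) (X x - y)))).
    by apply: eq_Rintegral => y _; rewrite RintegralZl//; exact: ic.
  rewrite (@Rintegral_exchange _ _ (measurableTypeR R) T R mu m setT setT _
    (fun y => `|h y|) (fun x => (step n)^-1 * `|w x|) _ _ (mc _ n0))//; last 3 first.
  - exact: integrable_abse ih.
  - exact: (integrableZl measurableT _ iaw).
  - move=> y x _ _; rewrite (normrM (h y)) (normrM (w x)) ler_wpM2l// mulrC ler_wpM2r//.
    by rewrite ger0_norm ?cauchy_ge0 ?cauchy_le.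
  apply: eq_Rintegral => x _; rewrite -RintegralZl//; last first.
    apply: (integrable_mul_bounded (K := (step n)^-1)) => //.
    - by apply: (measurableT_comp (measurable_cauchy n0)); exact: measurable_funB.
    - by move=> y _; rewrite ger0_norm ?cauchy_ge0 ?cauchy_le.
  by apply: eq_Rintegral => y _; rewrite mulrCA.
under eq_fun do rewrite E.
rewrite -RintegralZl//; last exact: (integrable_weight mh hK).
under eq_Rintegral do rewrite mulrCA.
apply: (@Rintegral_cvg _ T R m setT _ _ (fun x => `|w x| * (pi * K))) => //.
- move=> n; apply: measurable_funM => //.
  have n0 := step_gt0 R n.
  have mS : measurable_fun setT (fun z : R => \int[mu]_y (h y * cauchy (step n) (z - y))).
    apply: (@measurable_Rintegral _ _ (measurableTypeR R) (measurableTypeR R) R mu setT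
      (fun z y => h y * cauchy (step n) (z - y))) => //.
    apply: measurable_funM; first exact: (measurableT_comp mh measurable_snd).
    apply: (measurableT_comp (measurable_cauchy n0)).
    by apply: measurable_funB; [exact: measurable_fst|exact: measurable_snd].
  exact: (measurableT_comp mS mX).
- move=> x _; apply: cvgM; first exact: cvg_cst.
  exact: (cauchy_smoothing_cvg mh hK (ch _)).
- move=> n x _; rewrite normrM ler_wpM2l//.
  rewrite (cauchy_smoothing _ (step_gt0 R n) mh hK).
  have iq := integrable_oneDsqrV R.
  have iqh : mu.-integrable setT (EFin \o (fun z => (oneDsqr z)^-1 * h (X x - step n * z))).
    apply: (integrable_mul_bounded (K := K)) => //.
    by apply: (measurableT_comp mh); exact: measurable_funB.
  rewrite (le_trans (le_normr_Rintegral _ _))//.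
  rewrite -{1}(Rintegral_oneDsqrV R) -RintegralZr//; apply: le_Rintegral => //.
  + exact: integrable_abse iqh.
  + by under eq_fun do rewrite /= mulrC; exact: (integrableZl measurableT K iq).
  + by move=> z _; rewrite normrM ger0_norm ?invr_ge0// ler_wpM2l ?invr_ge0.
- by under eq_fun do rewrite /= mulrC; exact: (integrableZl measurableT (pi * K) iaw).
Qed.

(** Inserting [cauchy_transform] in [cauchy_transform_cvg] and exchanging integrals
    leaves the damping factor [exp (- e l)], which dominated convergence removes because
    the transforms of [h] are integrable. *)
Lemma parseval (h ch sh : R -> R) (K : R) :
  continuous h -> (forall y, `|h y| <= K) -> mu.-integrable setT (EFin \o h) ->
  (forall l, 0 < l -> \int[mu]_y (h y * cos (l * y)) = ch l) ->
  (forall l, 0 < l -> \int[mu]_y (h y * sin (l * y)) = sh l) ->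
  mu.-integrable `]0, +oo[ (EFin \o ch) -> mu.-integrable `]0, +oo[ (EFin \o sh) ->
  pi * \int[m]_x (w x * h (X x)) =
  \int[mu]_(l in `]0, +oo[) (ch l * ecos l + sh l * esin l).
Proof.
move=> ch0 hK ih chE shE ich ish.
have mh : measurable_fun setT h by exact: continuous_measurable_fun.
pose W := \int[m]_x `|w x|.
have W0 : 0 <= W by apply: Rintegral_ge0.
have icosh l : mu.-integrable setT (EFin \o (fun y => h y * cos (l * y))).
  apply: (integrable_mul_bounded (K := 1)) => // [|y _]; last exact: cos_max.
  by apply: (measurableT_comp (@measurable_cos R)); exact: measurable_funM.
have isinh l : mu.-integrable setT (EFin \o (fun y => h y * sin (l * y))).
  apply: (integrable_mul_bounded (K := 1)) => // [|y _]; last exact: sin_max.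
  by apply: (measurableT_comp (@measurable_sin R)); exact: measurable_funM.
have iU : mu.-integrable `]0, +oo[ (EFin \o (fun l => ch l * ecos l + sh l * esin l)).
  apply: (integrableD _ (f := EFin \o _) (g := EFin \o _)) => //.
  - apply: (integrable_mul_bounded (K := W)) => // [|l _]; last exact: ecos_le.
    by apply: measurable_funTS; exact: measurable_ecos.
  - apply: (integrable_mul_bounded (K := W)) => // [|l _]; last exact: esin_le.
    by apply: measurable_funTS; exact: measurable_esin.
pose U l := ch l * ecos l + sh l * esin l.
have E n : \int[mu]_y (h y * \int[m]_x (w x * cauchy (step n) (X x - y))) =
    \int[mu]_(l in `]0, +oo[) (U l * expR (- (step n * l))).
  have n0 := step_gt0 R n.
  pose V y l := h y * (expR (- (step n * l)) * (cos (l * y) * ecos l + sin (l * y) * esin l)).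
  have mV : measurable_fun setT (fun p : measurableTypeR R * measurableTypeR R => V p.1 p.2).
    have m1 : measurable_fun setT (fun p : measurableTypeR R * measurableTypeR R => p.1)
      by exact: measurable_fst.
    have m2 : measurable_fun setT (fun p : measurableTypeR R * measurableTypeR R => p.2)
      by exact: measurable_snd.
    apply: measurable_funM; first exact: (measurableT_comp mh m1).
    apply: measurable_funM.
      apply: measurableT_comp => //; apply: measurableT_comp => //.
      exact: measurable_funM.
    apply: measurable_funD; apply: measurable_funM.
    - by apply: (measurableT_comp (@measurable_cos R)); exact: measurable_funM.
    - exact: (measurableT_comp measurable_ecos m2).
    - by apply: (measurableT_comp (@measurable_sin R)); exact: measurable_funM.
    - exact: (measurableT_comp measurable_esin m2).
  have Vb y l : `|cos (l * y) * ecos l + sin (l * y) * esin l| <= W + W.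
    rewrite (le_trans (ler_normD _ _))// lerD// normrM -[leRHS]mul1r ler_pM//.
    - exact: cos_max.
    - exact: ecos_le.
    - exact: sin_max.
    - exact: esin_le.
  transitivity (\int[mu]_y \int[mu]_(l in `]0, +oo[) V y l).
    apply: eq_Rintegral => y _; rewrite cauchy_transform// -RintegralZl//.
    apply: (integrable_mul_bounded (K := W + W)) => //; first exact: integrable_expR.
    apply: measurable_funTS; apply: measurable_funD; apply: measurable_funM.
    - by apply: (measurableT_comp (@measurable_cos R)); exact: measurable_funM.
    - exact: measurable_ecos.
    - by apply: (measurableT_comp (@measurable_sin R)); exact: measurable_funM.
    - exact: measurable_esin.
  rewrite (@Rintegral_exchange _ _ (measurableTypeR R) (measurableTypeR R) R mu mu setT
    `]0, +oo[%classic V (fun y => `|h y|) (fun l => (W + W) * expR (- (step n * l))) _ _ mV)//;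
    last 3 first.
  - exact: integrable_abse ih.
  - by apply: (integrableZl _ _ (integrable_expR n0)).
  - move=> y l _ _; rewrite /V normrM ler_wpM2l// normrM mulrC.
    by rewrite [X in _ * X]ger0_norm ?expR_ge0// ler_wpM2r ?expR_ge0.
  apply: eq_Rintegral => l /set_mem/=; rewrite in_itv/= andbT => l0.
  rewrite /V /U -(chE _ l0) -(shE _ l0) -!RintegralZr//.
  rewrite -RintegralD//; last 2 first.
  - exact: (integrableZr measurableT (ecos l) (icosh l)).
  - exact: (integrableZr measurableT (esin l) (isinh l)).
  rewrite -RintegralZr//; last first.
    apply: (integrableD _ (f := EFin \o _) (g := EFin \o _)) => //.
    - exact: (integrableZr measurableT (ecos l) (icosh l)).
    - exact: (integrableZr measurableT (esin l) (isinh l)).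
  by apply: eq_Rintegral => y _; ring.
have := cauchy_transform_cvg ch0 hK ih; under eq_fun do rewrite E.
move=> H; apply: (cvg_unique _ H) => //.
apply: (@Rintegral_cvg _ (measurableTypeR R) R mu _ _ _ (fun l => `|U l|)) => //.
- move=> n; apply: measurable_funM; first by apply/measurable_EFinP; case/integrableP: iU.
  by apply: measurable_funTS; apply: measurableT_comp => //; apply: measurableT_comp.
- move=> l _.
  have : U l * expR (- (step n * l)) @[n --> \oo] --> U l * expR (- (0 * l)).
    apply: cvgM; first exact: cvg_cst.
    apply: (@cvg_comp _ _ _ (fun n => - (step n * l)) expR _ (nbhs (- (0 * l)))).
      by apply: cvgN; apply: cvgM; [exact: cvg_harmonic|exact: cvg_cst].
    exact: continuous_expR.
  by rewrite mul0r oppr0 expR0 mulr1.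
- move=> n l; rewrite /= in_itv/= andbT => l0; rewrite normrM ler_piMr//.
  by rewrite ger0_norm ?expR_ge0// expR_le1 oppr_le0 mulr_ge0 ?(ltW l0).
- exact: integrable_abse iU.
Qed.

End Smoothing.

Section Uniqueness.
Context d1 d2 (T1 : measurableType d1) (T2 : measurableType d2) (R : realType).
Variables (m1 : {sigma_finite_measure set T1 -> \bar R}).
Variables (m2 : {sigma_finite_measure set T2 -> \bar R}).
Variables (w1 X1 : T1 -> R) (w2 X2 : T2 -> R).
Hypotheses (iw1 : m1.-integrable setT (EFin \o w1)) (mX1 : measurable_fun setT X1).
Hypotheses (iw2 : m2.-integrable setT (EFin \o w2)) (mX2 : measurable_fun setT X2).
Notation mu := (@lebesgue_measure R).
Local Notation step n := (n.+1%:R^-1 : R).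

(** Laws with the same Fourier transform integrate bounded continuous functions
    alike. Integrability of the test function is removed by the cut-offs
    [1 / (1 + (y / (n + 1)) ^ 2)]. *)
Lemma fourier_unique (h : R -> R) (K : R) :
  (forall l, 0 < l -> ecos m1 w1 X1 l = ecos m2 w2 X2 l) ->
  (forall l, 0 < l -> esin m1 w1 X1 l = esin m2 w2 X2 l) ->
  continuous h -> (forall y, `|h y| <= K) ->
  \int[m1]_x (w1 x * h (X1 x)) = \int[m2]_x (w2 x * h (X2 x)).
Proof.
move=> ec es ch hK; have mh : measurable_fun setT h by exact: continuous_measurable_fun.
have K0 : 0 <= K by apply: le_trans (normr_ge0 _) (hK 0).
have pi0 : (pi : R) != 0 by rewrite gt_eqF ?pi_gt0.
have integrable_case (k : R -> R) : continuous k -> (forall y, `|k y| <= K) ->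
    mu.-integrable setT (EFin \o k) ->
    \int[m1]_x (w1 x * k (X1 x)) = \int[m2]_x (w2 x * k (X2 x)).
  move=> ck kK ik; apply: (mulfI pi0).
  have := cauchy_transform_cvg iw2 mX2 ck kK ik.
  under eq_fun.
    move=> n; under eq_Rintegral => y _.
      rewrite (cauchy_transform iw2 mX2 _ (step_gt0 R n)).
      rewrite (_ : \int[mu]_(l in _) _ = \int[m1]_x (w1 x * cauchy (step n) (X1 x - y))).
        over.
      rewrite (cauchy_transform iw1 mX1 _ (step_gt0 R n)).
      apply: eq_Rintegral => l /set_mem/=; rewrite in_itv/= andbT => l0.
      by rewrite ec// es.
    over.
  by move=> H; apply: cvg_unique (cauchy_transform_cvg iw1 mX1 ck kK ik) H.
pose chi n (y : R) : R := (oneDsqr (0 - step n * y))^-1.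
have chi01 n y : 0 <= chi n y <= 1.
  by rewrite /chi invr_ge0 (le_trans ler01 (oneDsqr_ge1 _))/= oneDsqrV_le1.
have chi_ch n : continuous (chi n).
  move=> y; apply: (@continuous_comp _ _ _ (fun y => 0 - step n * y) (fun z => (oneDsqr z)^-1)).
    by apply: is_derive_continuous; apply: is_derive_eq; reflexivity.
  exact: continuous_oneDsqrV.
have khK n y : `|h y * chi n y| <= K.
  have /andP[c0 c1] := chi01 n y.
  by rewrite normrM (ger0_norm c0) -[leRHS]mulr1 ler_pM.
have lim d (T : measurableType d) (m : {sigma_finite_measure set T -> \bar R}) (w X : T -> R) :
    m.-integrable setT (EFin \o w) -> measurable_fun setT X ->
    \int[m]_x (w x * (h (X x) * chi n (X x))) @[n --> \oo] -->
    \int[m]_x (w x * h (X x)).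
  move=> iw mX; have mw : measurable_fun setT w by apply/measurable_EFinP; case/integrableP: iw.
  apply: (@Rintegral_cvg _ _ R m setT _ _ (fun x => K * `|w x|)) => //.
  - move=> n; apply: measurable_funM => //; apply: measurable_funM.
    + exact: (measurableT_comp mh).
    + by apply: (measurableT_comp (continuous_measurable_fun (chi_ch n))).
  - move=> x _; apply: cvgM; first exact: cvg_cst.
    have : h (X x) * chi n (X x) @[n --> \oo] --> h (X x) * (oneDsqr (0 - 0 * X x))^-1.
      apply: cvgM; first exact: cvg_cst.
      apply: (@cvg_comp _ _ _ (fun n => 0 - step n * X x) (fun z => (oneDsqr z)^-1) _
        (nbhs (0 - 0 * X x))).
        apply: cvgB; first exact: cvg_cst.
        by apply: cvgM; [exact: cvg_harmonic|exact: cvg_cst].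
      exact: continuous_oneDsqrV.
    by rewrite /oneDsqr mul0r subr0 expr0n addr0 invr1 mulr1.
  - by move=> n x _; rewrite normrM mulrC ler_wpM2r.
  - exact: (integrableZl measurableT K (integrable_abse iw)).
have H1 := lim _ _ m1 w1 X1 iw1 mX1; have H2 := lim _ _ m2 w2 X2 iw2 mX2.
apply: cvg_unique H1 _ => //.
rewrite (_ : (fun n => _) = (fun n => \int[m2]_x (w2 x * (h (X2 x) * chi n (X2 x)))))//.
apply/funext => n; apply: (integrable_case (fun y => h y * chi n y)) => //.
- by move=> y; apply: continuousM; [exact: ch|exact: chi_ch].
- under eq_fun do rewrite /= mulrC.
  apply: (integrable_mul_bounded (K := K)) => //.
  exact: (Rintegral_affine 0 (step_gt0 R n) (integrable_oneDsqrV R)).1.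
Qed.

End Uniqueness.

Section Convolution.
Context d1 d2 d3 (T1 : measurableType d1) (T2 : measurableType d2) (T3 : measurableType d3).
Context (R : realType).
Variables (m1 : {sigma_finite_measure set T1 -> \bar R}).
Variables (m2 : {sigma_finite_measure set T2 -> \bar R}).
Variables (m3 : {sigma_finite_measure set T3 -> \bar R}).
Variables (w1 X1 : T1 -> R) (w2 X2 : T2 -> R) (w3 X3 : T3 -> R).
Hypotheses (iw1 : m1.-integrable setT (EFin \o w1)) (mX1 : measurable_fun setT X1).
Hypotheses (iw2 : m2.-integrable setT (EFin \o w2)) (mX2 : measurable_fun setT X2).
Hypotheses (iw3 : m3.-integrable setT (EFin \o w3)) (mX3 : measurable_fun setT X3).

Let sigma_finite12 : sigma_finite setT (m1 \x m2)%E.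
Proof.
have /sigma_finiteP[A [TA ndA Aoo]] := sigma_finiteT m1.
have /sigma_finiteP[B [TB ndB Boo]] := sigma_finiteT m2.
exists (fun n => A n `*` B n) => [|n].
  apply/seteqP; split => // -[x y] _.
  have [i _ Ai] : (\bigcup_n A n) x by rewrite -TA.
  have [j _ Bj] : (\bigcup_n B n) y by rewrite -TB.
  exists (i + j)%N => //; split => /=.
  - by move: Ai; exact/subsetPset/ndA/leq_addr.
  - by move: Bj; exact/subsetPset/ndB/leq_addl.
have [[mA fA] [mB fB]] := (Aoo n, Boo n); split; first exact: measurableX.
by rewrite product_measure1E// lte_mul_pinfty// ge0_fin_numE.
Qed.

(* The structure is packed by hand because inference on a product of measures
   selects the one meant for sub-probabilities. *)
Let m12 : {sigma_finite_measure set (T1 * T2)%type -> \bar R} :=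
  HB.pack_for {sigma_finite_measure set (T1 * T2)%type -> \bar R} (m1 \x m2)%E
    (Measure_isSigmaFinite.Build _ _ _ (m1 \x m2)%E sigma_finite12).
Let w (p : T1 * T2) := w1 p.1 * w2 p.2.
Let X (p : T1 * T2) := X1 p.1 + X2 p.2.

Let mw : measurable_fun setT w.
Proof.
apply: measurable_funM.
- apply: (measurableT_comp _ measurable_fst).
  by apply/measurable_EFinP; case/integrableP: iw1.
- apply: (measurableT_comp _ measurable_snd).
  by apply/measurable_EFinP; case/integrableP: iw2.
Qed.

Let mX : measurable_fun setT X.
Proof.
apply: measurable_funD; first exact: (measurableT_comp mX1 measurable_fst).
exact: (measurableT_comp mX2 measurable_snd).
Qed.

Let iw : (m1 \x m2)%E.-integrable setT (EFin \o w).
Proof. exact: integrable_prod. Qed.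

Let iterated (k : R -> R) (C : R) : measurable_fun setT k -> (forall y, `|k y| <= C) ->
  \int[(m1 \x m2)%E]_p (w p * k (X p)) =
  \int[m1]_z \int[m2]_v (w1 z * (w2 v * k (X1 z + X2 v))).
Proof.
move=> mk kC; have C0 : 0 <= C by apply: le_trans (normr_ge0 _) (kC 0).
rewrite (Rintegral_prod (G1 := fun z => C * `|w1 z|) (G2 := fun v => `|w2 v|))//.
- by apply: eq_Rintegral => z _; apply: eq_Rintegral => v _; rewrite /w /X/= mulrA.
- by apply: measurable_funM => //; exact: (measurableT_comp mk mX).
- exact: (integrableZl measurableT C (integrable_abse iw1)).
- exact: (integrable_abse iw2).
- by move=> p; rewrite normrM /w normrM mulrC -mulrA ler_wpM2r// mulr_ge0.
Qed.

Let itrig d (T : measurableType d) (m : {sigma_finite_measure set T -> \bar R})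
    (v Y trig : _ -> R) (l : R) : m.-integrable setT (EFin \o v) ->
  measurable_fun setT Y -> measurable_fun setT trig -> (forall y, `|trig y| <= 1) ->
  m.-integrable setT (EFin \o (fun z => v z * trig (l * Y z))).
Proof.
move=> iv mY mt t1; apply: (integrable_weight iv mY (h := fun y => trig (l * y)) (K := 1)) => //.
by apply: (measurableT_comp mt); exact: measurable_funM.
Qed.

Let ic1 l := itrig l iw1 mX1 (@measurable_cos R) (@cos_max R).
Let is1 l := itrig l iw1 mX1 (@measurable_sin R) (@sin_max R).
Let ic2 l := itrig l iw2 mX2 (@measurable_cos R) (@cos_max R).
Let is2 l := itrig l iw2 mX2 (@measurable_sin R) (@sin_max R).

Let ecos_sum (l : R) : \int[(m1 \x m2)%E]_p (w p * cos (l * X p)) =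
  ecos m1 w1 X1 l * ecos m2 w2 X2 l - esin m1 w1 X1 l * esin m2 w2 X2 l.
Proof.
rewrite (iterated (k := fun y => cos (l * y)) (C := 1)); last 2 first.
- by apply: (measurableT_comp (@measurable_cos R)); exact: measurable_funM.
- by move=> y; exact: cos_max.
transitivity (\int[m1]_z (w1 z * cos (l * X1 z) * ecos m2 w2 X2 l -
   w1 z * sin (l * X1 z) * esin m2 w2 X2 l)).
  apply: eq_Rintegral => z _; rewrite /ecos /esin -!RintegralZl//.
  rewrite -RintegralB//; last 2 first.
  - exact: (integrableZl measurableT _ (ic2 _)).
  - exact: (integrableZl measurableT _ (is2 _)).
  by apply: eq_Rintegral => v _; rewrite mulrDr cosD; ring.
rewrite RintegralB//; last 2 first.
- exact: (integrableZr measurableT _ (ic1 _)).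
- exact: (integrableZr measurableT _ (is1 _)).
by rewrite !RintegralZr.
Qed.

Let esin_sum (l : R) : \int[(m1 \x m2)%E]_p (w p * sin (l * X p)) =
  esin m1 w1 X1 l * ecos m2 w2 X2 l + ecos m1 w1 X1 l * esin m2 w2 X2 l.
Proof.
rewrite (iterated (k := fun y => sin (l * y)) (C := 1)); last 2 first.
- by apply: (measurableT_comp (@measurable_sin R)); exact: measurable_funM.
- by move=> y; exact: sin_max.
transitivity (\int[m1]_z (w1 z * sin (l * X1 z) * ecos m2 w2 X2 l +
   w1 z * cos (l * X1 z) * esin m2 w2 X2 l)).
  apply: eq_Rintegral => z _; rewrite /ecos /esin -!RintegralZl//.
  rewrite -RintegralD//; last 2 first.
  - exact: (integrableZl measurableT _ (ic2 _)).
  - exact: (integrableZl measurableT _ (is2 _)).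
  by apply: eq_Rintegral => v _; rewrite mulrDr sinD; ring.
rewrite RintegralD//; last 2 first.
- exact: (integrableZr measurableT _ (is1 _)).
- exact: (integrableZr measurableT _ (ic1 _)).
by rewrite !RintegralZr.
Qed.

(** The addition formulas say that the transform of the convolution is the product of
    the transforms; uniqueness then identifies the convolution with the third law. *)
Lemma fourier_convolution (h : R -> R) (K : R) :
  (forall l, 0 < l -> ecos m3 w3 X3 l =
    ecos m1 w1 X1 l * ecos m2 w2 X2 l - esin m1 w1 X1 l * esin m2 w2 X2 l) ->
  (forall l, 0 < l -> esin m3 w3 X3 l =
    esin m1 w1 X1 l * ecos m2 w2 X2 l + ecos m1 w1 X1 l * esin m2 w2 X2 l) ->
  continuous h -> (forall y, `|h y| <= K) ->
  \int[m1]_z \int[m2]_v (w1 z * (w2 v * h (X1 z + X2 v))) =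
  \int[m3]_x (w3 x * h (X3 x)).
Proof.
move=> ec es ch hK; rewrite -(iterated _ hK); last exact: continuous_measurable_fun.
apply: (@fourier_unique _ _ _ _ R m12 m3 w X w3 X3 iw mX iw3 mX3 h K _ _ ch hK) => l l0.
- by rewrite ec//; exact: ecos_sum.
- by rewrite es//; exact: esin_sum.
Qed.

End Convolution.

(** * The Fourier transform of the Gamma density *)

Lemma is_derive_powR_comp (R : realType) (g : R -> R) (x dg r : R) :
  0 < g x -> is_derive x 1 g dg ->
  is_derive x 1 (fun x => g x `^ r) (r * g x `^ (r - 1) * dg).
Proof.
move=> g0 dgx.
exact: (@is_derive1_comp R (fun y => y `^ r) g x _ _ (is_derive1_powR r g0) dgx).
Qed.

Section DerivativeUnderIntegral.
Context d (T : measurableType d) (R : realType) (m : {measure set T -> \bar R}).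

Lemma is_derive_Rintegral (B : set T) (f df : R -> T -> R) (G : T -> R) (a u v : R) :
  measurable B -> u < a < v ->
  (forall x, u < x < v -> m.-integrable B (EFin \o f x)) ->
  (forall x y, u < x < v -> B y -> is_derive x 1 (f ^~ y) (df x y)) ->
  (forall y, 0 <= G y) -> m.-integrable B (EFin \o G) ->
  (forall x y, u < x < v -> B y -> `|df x y| <= G y) ->
  is_derive a 1 (fun x => \int[m]_(y in B) f x y) (\int[m]_(y in B) df a y).
Proof.
move=> mB auv fi fd G0 iG dfG.
have Ia : `]u, v[%classic a by rewrite /= in_itv.
have itvE x : `]u, v[%classic x -> u < x < v by rewrite /= in_itv.
have fi' x : `]u, v[%classic x -> m.-integrable B (EFin \o f x) by move/itvE; exact: fi.
have fd' x y : `]u, v[%classic x -> B y -> derivable (f ^~ y) x 1.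
  by move=> /itvE xI By; have [] := fd _ _ xI By.
have dfE x y : `]u, v[%classic x -> B y -> partial1of2 f x y = df x y.
  by move=> /itvE xI By; rewrite partial1of2E; have [_ ->] := fd _ _ xI By.
have dfG' x y : `]u, v[%classic x -> B y -> `|partial1of2 f x y| <= G y.
  by move=> xI By; rewrite dfE// dfG//; exact: itvE.
split; first exact: (derivable_under_integral mB Ia fi' fd' G0 iG dfG').
rewrite -derive1E (differentiation_under_integral mB Ia fi' fd' G0 iG dfG').
by apply: eq_Rintegral => y /set_mem By; rewrite dfE.
Qed.

End DerivativeUnderIntegral.

Section GammaTransform.
Context (R : realType).
Notation mu := (@lebesgue_measure R).
Notation I := (`]0, +oo[%classic : set R).
Implicit Types (p l z : R).


Lemma powR_le_expR p z : 0 < p -> 0 < z ->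
  z `^ p <= expR (p * ln (2 * p)) * expR (2^-1 * z).
Proof.
move=> p0 z0; have pp : 0 < 2 * p by rewrite mulr_gt0.
rewrite /powR (gt_eqF z0) -expRD ler_expR.
have -> : ln z = ln (2 * p) + ln (z / (2 * p)).
  by rewrite -lnM ?posrE ?divr_gt0//; congr ln; field; rewrite gt_eqF.
rewrite mulrDr lerD2l.
have H : ln (z / (2 * p)) <= z / (2 * p) - 1.
  have := @le_ln1Dx R (z / (2 * p) - 1); rewrite (addrC 1) subrK; apply.
  by rewrite ltrBrDl addrN divr_gt0.
rewrite (@le_trans _ _ (p * (z / (2 * p))))//.
  by rewrite ler_pM2l// (le_trans H)// gerBl.
by rewrite le_eqVlt; apply/orP; left; apply/eqP; field; rewrite gt_eqF.
Qed.

(** The density of the Gamma law of shape [p + 1], unnormalized. *)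
Definition gamma_fun p z := z `^ p * expR (- z).

Lemma gamma_fun_ge0 p z : 0 <= gamma_fun p z.
Proof. by rewrite mulr_ge0 ?powR_ge0 ?expR_ge0. Qed.

Lemma gamma_fun_le p z : 0 < p -> 0 < z ->
  gamma_fun p z <= expR (p * ln (2 * p)) * expR (- (2^-1 * z)).
Proof.
move=> p0 z0; rewrite /gamma_fun (_ : - (2^-1 * z) = 2^-1 * z - z); last by field.
by rewrite expRD mulrA ler_wpM2r ?expR_ge0// powR_le_expR.
Qed.

Lemma measurable_gamma_fun p : measurable_fun setT (gamma_fun p).
Proof.
apply: measurable_funM; first exact: measurable_powR.
by apply: measurableT_comp => //; exact: measurable_funN.
Qed.

Lemma integrable_gamma_fun p : 0 < p -> mu.-integrable I (EFin \o gamma_fun p).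
Proof.
move=> p0; apply: (@integrable_dominated _ (measurableTypeR R) R mu _ _
  (fun z => expR (p * ln (2 * p)) * expR (- (2^-1 * z)))) => //.
- by apply: measurable_funTS; exact: measurable_gamma_fun.
- by move=> z /halfline_gt0 z0; rewrite ger0_norm ?gamma_fun_ge0// gamma_fun_le.
- by apply: (integrableZl _ _ (integrable_expR _)); rewrite ?invr_gt0.
Qed.

Definition gcos p l := \int[mu]_(z in I) (gamma_fun p z * cos (l * z)).
Definition gsin p l := \int[mu]_(z in I) (gamma_fun p z * sin (l * z)).

Let integrable_gtrig (trig : R -> R) p l : 0 < p -> measurable_fun setT trig ->
  (forall y, `|trig y| <= 1) ->
  mu.-integrable I (EFin \o (fun z => gamma_fun p z * trig (l * z))).
Proof.
move=> p0 mt t1; apply: (integrable_mul_bounded (K := 1)) => //.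
- exact: integrable_gamma_fun.
- by apply: measurable_funTS; apply: (measurableT_comp mt); exact: measurable_funM.
Qed.

Lemma integrable_gcos p l : 0 < p ->
  mu.-integrable I (EFin \o (fun z => gamma_fun p z * cos (l * z))).
Proof. by move=> p0; exact: (integrable_gtrig l p0 (@measurable_cos R) (@cos_max R)). Qed.

Lemma integrable_gsin p l : 0 < p ->
  mu.-integrable I (EFin \o (fun z => gamma_fun p z * sin (l * z))).
Proof. by move=> p0; exact: (integrable_gtrig l p0 (@measurable_sin R) (@sin_max R)). Qed.

Let powRS p z : 0 < z -> z `^ (p + 1) = z * z `^ p.
Proof.
move=> z0; rewrite powRD; last by rewrite (gt_eqF z0) implybT.
by rewrite powRr1 ?(ltW z0)// mulrC.
Qed.

Let gammaS p z : 0 < z -> z * gamma_fun p z = gamma_fun (p + 1) z.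
Proof. by move=> z0; rewrite /gamma_fun powRS// mulrA. Qed.

Let is_derive_trig (trig dtrig : R -> R) p l : 0 < p ->
  (forall x : R, is_derive x 1 trig (dtrig x)) ->
  (forall x, `|trig x| <= 1) -> (forall x, `|dtrig x| <= 1) ->
  is_derive l 1 (fun l => \int[mu]_(z in I) (gamma_fun p z * trig (l * z)))
    (\int[mu]_(z in I) (gamma_fun (p + 1) z * dtrig (l * z))).
Proof.
move=> p0 dt t1 dt1.
have mt : measurable_fun setT trig := is_derive_measurable dt.
rewrite (_ : \int[mu]_(z in I) (gamma_fun (p + 1) z * _) =
    \int[mu]_(z in I) (gamma_fun p z * (z * dtrig (l * z)))); last first.
  by apply: eq_Rintegral => z /set_mem /halfline_gt0 z0; rewrite -gammaS//; ring.
apply: (@is_derive_Rintegral _ (measurableTypeR R) R mu I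
  (fun l z => gamma_fun p z * trig (l * z)) (fun l z => gamma_fun p z * (z * dtrig (l * z)))
  (gamma_fun (p + 1)) _ (l - 1) (l + 1)) => //.
- by rewrite gtrBl ltr01 ltrDl ltr01.
- move=> x _; apply: (integrable_mul_bounded (K := 1)) => //.
  + exact: integrable_gamma_fun.
  + by apply: measurable_funTS; apply: (measurableT_comp mt); exact: measurable_funM.
- move=> x z _ _; have dtx := dt (x * z).
  by apply: is_derive_eq; rewrite /GRing.scale/=; ring.
- by move=> z; exact: gamma_fun_ge0.
- by apply: integrable_gamma_fun; rewrite addr_gt0.
- move=> x z _ /halfline_gt0 z0; rewrite mulrA normrM -[leRHS]mulr1 ler_pM//.
  by rewrite mulrC gammaS// ger0_norm// gamma_fun_ge0.
Qed.

Lemma is_derive_gcos p l : 0 < p -> is_derive l 1 (gcos p) (- gsin (p + 1) l).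
Proof.
move=> p0.
have := @is_derive_trig cos (fun x => - sin x) p l p0 (@is_derive_cos R).
rewrite (_ : \int[mu]_(z in I) _ = - gsin (p + 1) l); last first.
  rewrite -mulN1r -RintegralZl//; last by apply: integrable_gsin; rewrite addr_gt0.
  by apply: eq_Rintegral => z _; ring.
by apply; [exact: cos_max|move=> x; rewrite normrN; exact: sin_max].
Qed.

Lemma is_derive_gsin p l : 0 < p -> is_derive l 1 (gsin p) (gcos (p + 1) l).
Proof.
move=> p0; apply: (@is_derive_trig sin cos) => //.
- exact: sin_max.
- exact: cos_max.
Qed.

Let gamma_cvg0 p (b : R -> R) : 0 < p -> (forall z, `|b z| <= 1) ->
  gamma_fun p z * b z @[z --> 0^'+] --> 0 /\ gamma_fun p z * b z @[z --> +oo] --> 0.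
Proof.
move=> p0 b1; split.
- apply: (@cvg0_dominated _ _ _ _ _ (fun z => z `^ p)); last exact: powR_cvg0.
  near=> z; rewrite normrM ger0_norm ?gamma_fun_ge0//.
  rewrite /gamma_fun -[leRHS]mulr1 -mulrA ler_wpM2l ?powR_ge0//.
  rewrite -[leRHS]mulr1 ler_pM// ?expR_ge0// expR_le1 oppr_le0.
  by near: z; exact: nbhs_right_ge.
- apply: (@cvg0_dominated _ _ _ _ _
    (fun z => expR (p * ln (2 * p)) * expR (- (2^-1 * z)))); last first.
    rewrite -[X in _ --> X](mulr0 (expR (p * ln (2 * p)))).
    by apply: cvgM; [exact: cvg_cst|exact: cvg_expR_scale].
  near=> z; rewrite normrM ger0_norm ?gamma_fun_ge0// -[leRHS]mulr1 ler_pM ?gamma_fun_ge0//.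
  by apply: gamma_fun_le => //; near: z; exact: nbhs_pinfty_gt.
Unshelve. all: by end_near. Qed.

(** Integration by parts, as the vanishing of the integral of a derivative. *)
Let gamma_parts (trig dtrig : R -> R) p l : 0 < p ->
  (forall x : R, is_derive x 1 trig (dtrig x)) -> continuous dtrig ->
  (forall x, `|trig x| <= 1) -> (forall x, `|dtrig x| <= 1) ->
  \int[mu]_(z in I) ((p + 1) * (gamma_fun p z * trig (l * z)) -
    gamma_fun (p + 1) z * trig (l * z) + l * (gamma_fun (p + 1) z * dtrig (l * z))) = 0.
Proof.
move=> p0 dt ct t1 dt1; have p1 : 0 < p + 1 by rewrite addr_gt0.
have mt : measurable_fun setT trig := is_derive_measurable dt.
have mdt : measurable_fun setT dtrig by exact: continuous_measurable_fun.
have cgam q z : 0 < z -> {for z, continuous (gamma_fun q)}.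
  move=> z0; have := is_derive1_powR q z0 => dz.
  by apply: is_derive_continuous; apply: is_derive_eq; reflexivity.
have clin z : {for z, continuous (fun z : R => l * z)}.
  by apply: is_derive_continuous; apply: is_derive_eq; reflexivity.
have [c0 cy] := @gamma_cvg0 (p + 1) (fun z => trig (l * z)) p1 (fun z => t1 _).
rewrite -[RHS](subrr 0); apply: (FTC_halfline (F := fun z => gamma_fun (p + 1) z * trig (l * z))).
- move=> z z0; have dz := is_derive1_powR (p + 1) z0; have dtz := dt (l * z).
  apply: is_derive_eq; rewrite /GRing.scale/= addrK.
  by rewrite /gamma_fun (powRS p z0); ring.
- move=> z z0; apply: continuousD; first apply: continuousB; apply: continuousM => //.
  + exact: cst_continuous.
  + apply: continuousM; first exact: cgam.
    apply: (continuous_comp (g := trig)) => //.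
    by apply: is_derive_continuous; exact: dt.
  + exact: cgam.
  + apply: (continuous_comp (g := trig)) => //.
    by apply: is_derive_continuous; exact: dt.
  + exact: cst_continuous.
  + apply: continuousM; first exact: cgam.
    by apply: (continuous_comp (g := dtrig)) => //; exact: ct.
- apply: (integrableD _ (f := EFin \o _) (g := EFin \o _)) => //.
  + apply: (integrableB _ (f := EFin \o _) (g := EFin \o _)) => //.
    * exact: (integrableZl _ (p + 1) (integrable_gtrig l p0 mt t1)).
    * exact: integrable_gtrig.
  + exact: (integrableZl _ l (integrable_gtrig l p1 mdt dt1)).
- exact: c0.
- exact: cy.
Qed.

Let parts_split (f1 f2 f3 : R -> R) (a b : R) :
  mu.-integrable I (EFin \o f1) -> mu.-integrable I (EFin \o f2) ->
  mu.-integrable I (EFin \o f3) ->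
  \int[mu]_(z in I) (a * f1 z - f2 z + b * f3 z) =
  a * \int[mu]_(z in I) f1 z - \int[mu]_(z in I) f2 z + b * \int[mu]_(z in I) f3 z.
Proof.
move=> i1 i2 i3; have mI : measurable (I : set (measurableTypeR R)) by [].
have ai1 := integrableZl mI a i1; have bi3 := integrableZl mI b i3.
rewrite RintegralD//; last exact: (integrableB mI ai1 i2).
by rewrite RintegralB// !RintegralZl.
Qed.

Let gcos_parts p l : 0 < p -> (p + 1) * gcos p l = gcos (p + 1) l + l * gsin (p + 1) l.
Proof.
move=> p0; have p1 : 0 < p + 1 by rewrite addr_gt0.
have sm (x : R) : `|- sin x| <= 1 by rewrite normrN sin_max.
have H := @gamma_parts cos (fun x => - sin x) p l p0 (@is_derive_cos R)
  (fun x => continuousN (@continuous_sin R x)) (@cos_max R) sm.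
have {H} : \int[mu]_(z in I) ((p + 1) * (gamma_fun p z * cos (l * z)) -
    gamma_fun (p + 1) z * cos (l * z) + (- l) * (gamma_fun (p + 1) z * sin (l * z))) = 0.
  by rewrite -[RHS]H; apply: eq_Rintegral => z _; ring.
rewrite parts_split; [|exact: integrable_gcos|exact: integrable_gcos|exact: integrable_gsin].
by rewrite -/(gcos p l) -/(gcos _ l) -/(gsin _ l) => H; lra.
Qed.

Let gsin_parts p l : 0 < p -> (p + 1) * gsin p l = gsin (p + 1) l - l * gcos (p + 1) l.
Proof.
move=> p0; have p1 : 0 < p + 1 by rewrite addr_gt0.
have := @gamma_parts sin cos p l p0 (@is_derive_sin R) (@continuous_cos R)
  (@sin_max R) (@cos_max R).
rewrite parts_split; [|exact: integrable_gsin|exact: integrable_gsin|exact: integrable_gcos].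
by rewrite -/(gsin p l) -/(gcos _ l) -/(gsin _ l) => H; lra.
Qed.

(** Euler's Gamma function at [p + 1]. *)
Definition Gam p := \int[mu]_(z in I) gamma_fun p z.

Let gcos0 p : gcos p 0 = Gam p.
Proof. by apply: eq_Rintegral => z _; rewrite mul0r cos0 mulr1. Qed.

Let gsin0 p : 0 < p -> gsin p 0 = 0.
Proof.
move=> p0; rewrite /gsin (_ : (fun z => _) = cst 0) ?Rintegral_cst ?mul0r//.
by apply/funext => z; rewrite mul0r sin0 mulr0.
Qed.

(** Differentiation under the integral followed by integration by parts gives a
    first-order linear system for the pair [(gcos, gsin)].  Undoing the expected modulus
    [(1 + l ^ 2) ^ (- a / 2)] and rotation by [a * atan l] turns it into two functions
    with zero derivative, whose values are read off at [l = 0]. *)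
Lemma gamma_transform p l : 0 < p ->
  let a := p + 1 in
  gcos p l = Gam p * (1 + l ^+ 2) `^ (- (a / 2)) * cos (a * atan l) /\
  gsin p l = Gam p * (1 + l ^+ 2) `^ (- (a / 2)) * sin (a * atan l).
Proof.
move=> p0 a; have p1 : 0 < p + 1 by rewrite addr_gt0.
have q0 x : 0 < 1 + x ^+ 2 :> R by rewrite ltr_wpDr ?sqr_ge0.
have dC (x : R) : is_derive x 1 (gcos p) (- (a * (x * gcos p x + gsin p x)) / (1 + x ^+ 2)).
  apply: (is_derive_eq (is_derive_gcos x p0)).
  apply: (mulIf (lt0r_neq0 (q0 x))); rewrite divfK ?lt0r_neq0//.
  rewrite (_ : a * _ = x * ((p + 1) * gcos p x) + (p + 1) * gsin p x); last first.
    by rewrite /a; ring.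
  by rewrite gcos_parts// gsin_parts//; ring.
have dS (x : R) : is_derive x 1 (gsin p) (a * (gcos p x - x * gsin p x) / (1 + x ^+ 2)).
  apply: (is_derive_eq (is_derive_gsin x p0)).
  apply: (mulIf (lt0r_neq0 (q0 x))); rewrite divfK ?lt0r_neq0//.
  rewrite (_ : a * _ = (p + 1) * gcos p x - x * ((p + 1) * gsin p x)); last first.
    by rewrite /a; ring.
  by rewrite gcos_parts// gsin_parts//; ring.
have dD (x : R) : is_derive x 1 (fun x : R => (1 + x ^+ 2) `^ (a / 2))
    ((1 + x ^+ 2) `^ (a / 2) * (a * x / (1 + x ^+ 2))).
  have dq : is_derive x 1 (fun x : R => 1 + x ^+ 2) (2 * x).
    by apply: is_derive_eq; rewrite /GRing.scale/=; ring.
  apply: (is_derive_eq (@is_derive_powR_comp R (fun x => 1 + x ^+ 2) x _ (a / 2) (q0 x) dq)).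
  rewrite powRB; last by rewrite (lt0r_neq0 (q0 x)) implybT.
  by rewrite powRr1 ?(ltW (q0 x))//; field; rewrite lt0r_neq0.
have dat (x : R) : is_derive x 1 (fun x : R => a * atan x) (a / (1 + x ^+ 2)).
  by apply: is_derive_eq; rewrite /GRing.scale/=.
pose T1 x := (1 + x ^+ 2) `^ (a / 2) *
   (gcos p x * cos (a * atan x) + gsin p x * sin (a * atan x)).
pose T2 x := (1 + x ^+ 2) `^ (a / 2) *
   (gsin p x * cos (a * atan x) - gcos p x * sin (a * atan x)).
have T1E : T1 l = Gam p.
  have dT (x : R) : is_derive x 1 T1 0.
    rewrite /T1; apply: is_derive_eq; rewrite /GRing.scale/=.
    by field; rewrite lt0r_neq0.
  rewrite (@is_derive_0_is_cst R T1 l 0 dT).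
  by rewrite /T1 atan0 mulr0 cos0 sin0 gcos0 expr0n addr0 powR1 /= mul1r mulr1 mulr0 addr0.
have T2E : T2 l = 0.
  have dT (x : R) : is_derive x 1 T2 0.
    rewrite /T2; apply: is_derive_eq; rewrite /GRing.scale/=.
    by field; rewrite lt0r_neq0.
  rewrite (@is_derive_0_is_cst R T2 l 0 dT).
  by rewrite /T2 atan0 mulr0 cos0 sin0 gsin0// mul0r mulr0 subrr mulr0.
have D0 : (1 + l ^+ 2) `^ (a / 2) != 0 by rewrite gt_eqF// powR_gt0.
have cs := cos2Dsin2 (a * atan l).
rewrite powRN; split; apply: (mulIf D0).
- transitivity (T1 l * cos (a * atan l) - T2 l * sin (a * atan l)).
    by rewrite -[LHS]mulr1 -[X in _ * X = _]cs /T1 /T2; ring.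
  by rewrite T1E T2E; field.
- transitivity (T1 l * sin (a * atan l) + T2 l * cos (a * atan l)).
    by rewrite -[LHS]mulr1 -[X in _ * X = _]cs /T1 /T2; ring.
  by rewrite T1E T2E; field.
Qed.

Lemma Gam_gt0 p : 0 < p -> 0 < Gam p.
Proof.
move=> p0; have e0 : (0 : R) < expR (- 2) by exact: expR_gt0.
have fin : (\int[mu]_(z in I) (gamma_fun p z)%:E)%E \is a fin_num.
  by apply: integrable_fin_num => //; exact: integrable_gamma_fun.
rewrite -lte_fin /Gam /Rintegral fineK//.
apply: (@lt_le_trans _ _ (\int[mu]_(z in `[1%R, 2%R]) (expR (- 2))%:E)%E).
  rewrite integral_cst//= lebesgue_measure_itv/= lte_fin ltr1n.
  by rewrite -EFinB -EFinM lte_fin mulr_gt0//; lra.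
have sub : `[1%R, 2%R]%classic `<=` I.
  by move=> z /=; rewrite !in_itv/= andbT => /andP[z1 _]; exact: lt_le_trans z1.
apply: (@le_trans _ _ (\int[mu]_(z in `[1%R, 2%R]) (gamma_fun p z)%:E)%E).
  apply: ge0_le_integral => //.
  - by apply/measurable_EFinP; apply: measurable_funTS; exact: measurable_gamma_fun.
  - move=> z /=; rewrite in_itv/= => /andP[z1 z2]; rewrite lee_fin /gamma_fun.
    rewrite -[leLHS]mul1r ler_pM ?expR_ge0// ?ler_expR ?lerN2//.
    by rewrite -[leLHS](powRr0 z) ler_powR// ltW.
apply: ge0_subset_integral => //.
- by apply/measurable_EFinP; apply: measurable_funTS; exact: measurable_gamma_fun.
- by move=> z _; rewrite lee_fin gamma_fun_ge0.
Qed.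

End GammaTransform.

(** * The stable law and its semigroup *)

Section StableLaw.
Context (R : realType) (alpha beta : R) (f : R -> R).
Notation mu := (@lebesgue_measure R).
Hypotheses (halpha : 0 < alpha < 2) (hbeta : -1 < beta < 1).
Hypothesis hf : is_stable_density alpha beta f.

(** The argument of the Levy exponent on the right half-line, up to sign. *)
Definition stable_angle : R := pi / 2 * skewness alpha beta.
Notation theta := stable_angle.

Let a0 : 0 < alpha. Proof. by case/andP: halpha. Qed.
Let a_neq0 : alpha != 0. Proof. exact: lt0r_neq0. Qed.

Lemma skewness_lt1 : -1 < skewness alpha beta < 1.
Proof.
have /andP[b1 b2] := hbeta; have /andP[_ a2] := halpha.
have H1 : 0 < (1 - beta) * (2 - alpha) by rewrite mulr_gt0 ?subr_gt0.
have H2 : 0 < (1 + beta) * (2 - alpha) by rewrite mulr_gt0 ?subr_gt0// -ltrBlDl sub0r.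
have H3 : 0 < (1 - beta) * alpha by rewrite mulr_gt0 ?subr_gt0.
have H4 : 0 < (1 + beta) * alpha by rewrite mulr_gt0 // -ltrBlDl sub0r.
rewrite /skewness; case: ifPn => [a1|]; first by apply/andP; split; lra.
rewrite -leNgt => a1.
by case: ifPn => // _; apply/andP; split; lra.
Qed.

Lemma stable_angle_bound : - (pi / 2) < theta < pi / 2.
Proof.
have /andP[s1 s2] := skewness_lt1; have p0 := pi_gt0 R.
have H1 : 0 < (1 - skewness alpha beta) * (pi / 2).
  by rewrite mulr_gt0 ?subr_gt0 ?divr_gt0.
have H2 : 0 < (1 + skewness alpha beta) * (pi / 2).
  by rewrite mulr_gt0 ?divr_gt0// -ltrBlDl sub0r.
by rewrite /theta; apply/andP; split; lra.
Qed.

Lemma cos_stable_angle_gt0 : 0 < cos theta.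
Proof. exact: cos_gt0_pihalf stable_angle_bound. Qed.

Lemma measurable_density : measurable_fun setT f. Proof. by case: hf. Qed.
Lemma density_ge0 x : 0 <= f x. Proof. by case: hf. Qed.
Lemma Rintegral_density : \int[mu]_x f x = 1.
Proof. by case: hf => _ _ fi _; rewrite /Rintegral fi. Qed.
Lemma integrable_density : mu.-integrable setT (EFin \o f).
Proof.
apply/integrableP; split; first by apply/measurable_EFinP; exact: measurable_density.
under eq_integral do rewrite /= ger0_norm ?density_ge0//.
by case: hf => _ _ -> _; rewrite ltry.
Qed.

Lemma stable_ecos_esin l : 0 <= l ->
  ecos mu f id l = expR (- (l `^ alpha * cos theta)) * cos (l `^ alpha * sin theta) /\
  esin mu f id l = expR (- (l `^ alpha * cos theta)) * sin (l `^ alpha * sin theta).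
Proof.
rewrite le_eqVlt => /predU1P[<-|l0].
  rewrite powR0// !mul0r oppr0 expR0 cos0 sin0 mul1r; split.
    rewrite /ecos -[RHS]Rintegral_density.
    by apply: eq_Rintegral => x _; rewrite mul0r cos0 mulr1.
  rewrite /esin (_ : (fun z => _) = cst 0) ?Rintegral_cst ?mul0r ?mulr0//.
  by apply/funext => z; rewrite mul0r sin0 mulr0.
case: hf => _ _ _ /(_ l).
rewrite /cintegral /symbol /cexp /= gtr0_sg// mulr1 gtr0_norm//.
rewrite -/theta !(mul0r, subr0, addr0, expR0, mul1r, oppr0, add0r, mulr0, cosN, sinN) => -[Hc Hs].
have -> : l `^ alpha * sin theta = - (- sin theta * l `^ alpha) by ring.
rewrite cosN sinN (mulrC (l `^ alpha) (cos theta)); split.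
- transitivity (expR (- (cos theta * l `^ alpha)) * cos (- sin theta * l `^ alpha) -
    0 * - sin (- sin theta * l `^ alpha)); last by ring.
  by rewrite -Hc; apply: eq_Rintegral => x _; ring.
- transitivity (expR (- (cos theta * l `^ alpha)) * - sin (- sin theta * l `^ alpha) +
    0 * cos (- sin theta * l `^ alpha)); last by ring.
  by rewrite -Hs; apply: eq_Rintegral => x _; ring.
Qed.

(** Expectation of a function of the stable variable of scale [t ^ (1 / alpha)],
    translated to start from [x]. *)
Definition stable_mean (t : R) (phi : R -> R) (x : R) : R :=
  \int[mu]_z (f z * phi (x - t `^ alpha^-1 * z)).

Let powK t : 0 <= t -> (t `^ alpha^-1) `^ alpha = t.
Proof. by move=> t0; rewrite -powRrM mulVf// powRr1. Qed.

Let ecos_scale t l : 0 <= t -> 0 <= l ->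
  ecos mu f id (l * t `^ alpha^-1) =
    expR (- (t * l `^ alpha * cos theta)) * cos (t * l `^ alpha * sin theta) /\
  esin mu f id (l * t `^ alpha^-1) =
    expR (- (t * l `^ alpha * cos theta)) * sin (t * l `^ alpha * sin theta).
Proof.
move=> t0 l0; have [-> ->] := stable_ecos_esin (mulr_ge0 l0 (powR_ge0 t alpha^-1)).
by rewrite powRM ?powR_ge0// powK// (mulrC (l `^ alpha) t).
Qed.

Let mf : measurable_fun setT f := measurable_density.
Let fi : mu.-integrable setT (EFin \o f) := integrable_density.

(** Stability: independent stable variables at times [s] and [t] add up to one at
    time [s + t], since the logarithms of their characteristic functions do. *)
Lemma stable_mean_add (s t K x : R) (phi : R -> R) : 0 <= s -> 0 <= t ->
  continuous phi -> (forall y, `|phi y| <= K) ->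
  stable_mean s (stable_mean t phi) x = stable_mean (s + t) phi x.
Proof.
move=> s0 t0 cphi phiK.
have mphi : measurable_fun setT phi by exact: continuous_measurable_fun.
have st0 : 0 <= s + t by rewrite addr_ge0.
have scaledc (r l : R) : ecos mu f (fun z => r `^ alpha^-1 * z) l =
    ecos mu f id (l * r `^ alpha^-1).
  by apply: eq_Rintegral => z _; rewrite mulrA.
have scaleds (r l : R) : esin mu f (fun z => r `^ alpha^-1 * z) l =
    esin mu f id (l * r `^ alpha^-1).
  by apply: eq_Rintegral => z _; rewrite mulrA.
have mscale (r : R) : measurable_fun setT (fun z : R => r `^ alpha^-1 * z).
  exact: measurable_funM.
have expE l : expR (- ((s + t) * l `^ alpha * cos theta)) =
    expR (- (s * l `^ alpha * cos theta)) * expR (- (t * l `^ alpha * cos theta)).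
  by rewrite -expRD; congr expR; ring.
have argE l : (s + t) * l `^ alpha * sin theta =
    s * l `^ alpha * sin theta + t * l `^ alpha * sin theta by ring.
have ec l : 0 < l -> ecos mu f (fun z => (s + t) `^ alpha^-1 * z) l =
    ecos mu f (fun z => s `^ alpha^-1 * z) l * ecos mu f (fun z => t `^ alpha^-1 * z) l -
    esin mu f (fun z => s `^ alpha^-1 * z) l * esin mu f (fun z => t `^ alpha^-1 * z) l.
  move=> l0; rewrite !scaledc !scaleds.
  have [-> ->] := ecos_scale s0 (ltW l0); have [-> ->] := ecos_scale t0 (ltW l0).
  by have [-> _] := ecos_scale st0 (ltW l0); rewrite argE expE cosD; ring.
have es l : 0 < l -> esin mu f (fun z => (s + t) `^ alpha^-1 * z) l =
    esin mu f (fun z => s `^ alpha^-1 * z) l * ecos mu f (fun z => t `^ alpha^-1 * z) l +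
    ecos mu f (fun z => s `^ alpha^-1 * z) l * esin mu f (fun z => t `^ alpha^-1 * z) l.
  move=> l0; rewrite !scaledc !scaleds.
  have [-> ->] := ecos_scale s0 (ltW l0); have [-> ->] := ecos_scale t0 (ltW l0).
  by have [_ ->] := ecos_scale st0 (ltW l0); rewrite argE expE sinD; ring.
have ch : continuous (fun y => phi (x - y)).
  move=> y; apply: (@continuous_comp _ _ _ (fun y => x - y) phi); last exact: cphi.
  by apply: is_derive_continuous; apply: is_derive_eq; reflexivity.
have H := fourier_convolution fi (mscale s) fi (mscale t) fi (mscale (s + t)) ec es ch
  (fun y => phiK (x - y)).
rewrite [RHS]/stable_mean -[RHS]H; apply: eq_Rintegral => z _.
rewrite -RintegralZl//; last first.
  apply: (integrable_mul_bounded (K := K)) => //.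
  by apply: (measurableT_comp mphi); apply: measurable_funB.
by apply: eq_Rintegral => v _; rewrite opprD addrA.
Qed.

(** The substitution [y = x - t ^ (1 / alpha) z] absorbs the normalization of the
    kernel. *)
Lemma semigroup_stable_mean (t K : R) (phi : R -> R) : 0 <= t ->
  measurable_fun setT phi -> (forall y, `|phi y| <= K) ->
  semigroup alpha f t phi =1 stable_mean t phi.
Proof.
move=> t0 mphi phiK x; rewrite /semigroup /stable_mean.
have [->|tn0] := eqVneq t 0.
  rewrite powR0 ?invr_neq0//.
  under eq_Rintegral do rewrite mul0r subr0.
  by rewrite RintegralZr// Rintegral_density mul1r.
have c0 : 0 < t `^ alpha^-1 by rewrite powR_gt0// lt_neqAle eq_sym tn0.
set c := t `^ alpha^-1 in c0 *.
have ci0 : 0 < c^-1 by rewrite invr_gt0.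
have [ifs _] := Rintegral_affine (x / c) ci0 fi.
have fE y : f ((x - y) / c) = f (x / c - c^-1 * y) by congr f; field; rewrite gt_eqF.
have ig : mu.-integrable setT
    (EFin \o (fun y => t `^ (- alpha^-1) * f ((x - y) / c) * phi y)).
  apply: (integrable_mul_bounded (K := K)) => //.
  under eq_fun do rewrite /= fE.
  exact: (integrableZl measurableT _ ifs).
have [ig' ->] := Rintegral_affine x c0 ig.
rewrite -RintegralZl//; apply: eq_Rintegral => z _.
rewrite subKr powRN -/c (_ : c * z / c = z); last by field; rewrite gt_eqF.
by rewrite !mulrA divff ?gt_eqF// mul1r.
Qed.

End StableLaw.

(** * The left tail of the stable law *)

Section HalfLine.
Context (R : realType).
Notation mu := (@lebesgue_measure R).
Notation I := (`]0, +oo[%classic : set R).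

Lemma Rintegral_support (D : set R) (k : R -> R) : measurable D ->
  (forall x, ~ D x -> k x = 0) -> \int[mu]_x k x = \int[mu]_(x in D) k x.
Proof.
move=> mD k0; rewrite [RHS]Rintegral_mkcond; apply: eq_Rintegral => x _.
by rewrite patchE; case: ifPn => // /negP; rewrite inE; exact: k0.
Qed.

Let notI x : ~ I x -> x <= 0.
Proof. by rewrite /= in_itv/= andbT => /negP; rewrite -leNgt. Qed.

Variable k : R -> R.
Hypotheses (mk : measurable_fun setT k) (k0 : forall z, z <= 0 -> k z = 0).
Hypothesis ik : mu.-integrable I (EFin \o k).

Lemma integrable_halfline : mu.-integrable setT (EFin \o k).
Proof.
have mI : measurable (I : set (measurableTypeR R)) by [].
move/(integrable_mkcond _ mI) : ik; apply: eq_integrable => // x _.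
by rewrite patchE; case: ifPn => // /negP; rewrite inE => /notI /k0 /= ->.
Qed.

Lemma integrable_halflineN : mu.-integrable setT (EFin \o (fun x => k (- x))).
Proof.
have [+ _] := Rintegral_affine 0 ltr01 integrable_halfline.
by apply: eq_integrable => // x _; rewrite /= mul1r sub0r.
Qed.

Lemma Rintegral_halfline (b : R -> R) :
  \int[mu]_x (k x * b x) = \int[mu]_(z in I) (k z * b z).
Proof. by apply: Rintegral_support => // x /notI /k0 ->; rewrite mul0r. Qed.

Lemma Rintegral_halflineN (b : R -> R) (C : R) : measurable_fun setT b ->
  (forall y, `|b y| <= C) ->
  \int[mu]_x (k (- x) * b x) = \int[mu]_(z in I) (k z * b (- z)).
Proof.
move=> mb bC; rewrite -(Rintegral_halfline (fun z => b (- z))).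
have ikb : mu.-integrable setT (EFin \o (fun x => k (- x) * b x)).
  exact: integrable_mul_bounded integrable_halflineN mb (fun x _ => bC x).
have [_ ->] := Rintegral_affine 0 ltr01 ikb.
by rewrite mul1r; apply: eq_Rintegral => z _; rewrite mul1r sub0r opprK.
Qed.

End HalfLine.

Section OneSidedPower.
Context (R : realType).
Notation mu := (@lebesgue_measure R).
Implicit Types (p x : R).

Lemma continuous_pos_powR p : 0 < p -> continuous (fun x : R => (Num.max x 0) `^ p).
Proof.
move=> p0 x; have [x0|x0|x0] := ltgtP x 0.
- apply: cvg_near_cst; near=> y; rewrite !max_r ?(ltW x0)//.
  by apply: ltW; near: y; exact: lt_nbhsl.
- apply: (@cvg_trans _ ((fun y : R => y `^ p) y @[y --> x])).
    apply: near_eq_cvg; near=> y; rewrite max_l//.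
    by apply: ltW; near: y; apply: (cvgr_gt x) => //; exact: cvg_id.
  rewrite max_l ?(ltW x0)//.
  exact: is_derive_continuous (is_derive1_powR p x0).
- rewrite x0; apply/cvgrPdist_lt => e e0.
  have d0 : 0 < e `^ p^-1 by exact: powR_gt0.
  near=> y; rewrite maxxx powR0 ?gt_eqF// sub0r normrN ger0_norm ?powR_ge0//.
  have -> : e = (e `^ p^-1) `^ p by rewrite -powRrM mulVf ?gt_eqF// powRr1// ltW.
  rewrite gt0_ltr_powR ?nnegrE ?le_max ?lexx ?orbT ?powR_ge0//.
  rewrite gt_max d0 andbT; near: y.
  by apply: (cvgr_lt (0 : R)) => //; exact: cvg_id.
Unshelve. all: by end_near. Qed.

(** The unnormalized Gamma density reflected to the left half-line.  Its Fourier
    transform is explicit, and for [p > alpha] it is flat enough at [0] for its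
    expectation at small scales to see only the left tail. *)
Definition reflected_gamma p x := (Num.max (- x) 0) `^ p * expR x.

Lemma reflected_gamma_pos p x : 0 < p -> 0 <= x -> reflected_gamma p x = 0.
Proof.
by move=> p0 x0; rewrite /reflected_gamma max_r ?oppr_le0// powR0 ?gt_eqF// mul0r.
Qed.

Lemma reflected_gamma_neg p x : x <= 0 -> reflected_gamma p x = gamma_fun p (- x).
Proof. by move=> x0; rewrite /reflected_gamma max_l ?oppr_ge0// /gamma_fun opprK. Qed.

Lemma continuous_reflected_gamma p : 0 < p -> continuous (reflected_gamma p).
Proof.
move=> p0 x; rewrite /reflected_gamma; apply: cvgM; last exact: continuous_expR.
apply: (@continuous_comp _ _ _ (fun x : R => - x) (fun x : R => (Num.max x 0) `^ p)).
- exact: (@continuousN _ _ _ id).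
- exact: continuous_pos_powR.
Qed.

Lemma reflected_gamma_ge0 p x : 0 <= reflected_gamma p x.
Proof. by rewrite mulr_ge0 ?powR_ge0 ?expR_ge0. Qed.

Lemma reflected_gamma_le p x : 0 < p -> reflected_gamma p x <= expR (p * ln (2 * p)).
Proof.
move=> p0; have [x0|x0] := leP 0 x; first by rewrite reflected_gamma_pos// expR_ge0.
have nx : 0 < - x by rewrite oppr_gt0.
rewrite reflected_gamma_neg ?(ltW x0)// (le_trans (gamma_fun_le p0 nx))//.
by rewrite ler_piMr ?expR_ge0// expR_le1 oppr_le0 mulr_ge0// ltW.
Qed.

Let k p z := reflected_gamma p (- z).

Let mk p : 0 < p -> measurable_fun setT (k p).
Proof.
move=> p0; have mt := continuous_measurable_fun (continuous_reflected_gamma p0).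
by apply: (measurableT_comp mt).
Qed.

Let k0 p z : 0 < p -> z <= 0 -> k p z = 0.
Proof. by move=> p0 z0; rewrite /k reflected_gamma_pos// oppr_ge0. Qed.

Let ik p : 0 < p -> mu.-integrable `]0, +oo[ (EFin \o k p).
Proof.
move=> p0; have := integrable_gamma_fun p0; apply: eq_integrable => // z.
rewrite inE/= in_itv/= andbT => z0.
by rewrite /= /k reflected_gamma_neg ?opprK// oppr_le0 ltW.
Qed.

Lemma integrable_reflected_gamma p : 0 < p -> mu.-integrable setT (EFin \o reflected_gamma p).
Proof.
move=> p0; have := integrable_halflineN (fun z => k0 p0) (ik p0).
by apply: eq_integrable => // x _; rewrite /= /k opprK.
Qed.

Let test_trig p (b : R -> R) : 0 < p -> measurable_fun setT b -> (forall y, `|b y| <= 1) ->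
  \int[mu]_x (reflected_gamma p x * b x) = \int[mu]_(z in `]0, +oo[) (gamma_fun p z * b (- z)).
Proof.
move=> p0 mb b1; have H := Rintegral_halflineN (fun z => k0 p0) (ik p0) mb b1.
transitivity (\int[mu]_x (k p (- x) * b x)).
  by apply: eq_Rintegral => x _; rewrite /k opprK.
rewrite H; apply: eq_Rintegral => z; rewrite inE/= in_itv/= andbT => z0.
by rewrite /k reflected_gamma_neg ?opprK// oppr_le0 ltW.
Qed.

Lemma reflected_gamma_cos p l : 0 < p -> \int[mu]_x (reflected_gamma p x * cos (l * x)) = gcos p l.
Proof.
move=> p0; rewrite (test_trig (b := fun x => cos (l * x)))//.
- by apply: eq_Rintegral => z _; rewrite mulrN cosN.
- by apply: (measurableT_comp (@measurable_cos R)); exact: measurable_funM.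
- by move=> y; exact: cos_max.
Qed.

Lemma reflected_gamma_sin p l : 0 < p -> \int[mu]_x (reflected_gamma p x * sin (l * x)) = - gsin p l.
Proof.
move=> p0; rewrite (test_trig (b := fun x => sin (l * x)))//.
- rewrite -mulN1r -RintegralZl//; last exact: integrable_gsin.
  by apply: eq_Rintegral => z _; rewrite mulrN sinN; ring.
- by apply: (measurableT_comp (@measurable_sin R)); exact: measurable_funM.
- by move=> y; exact: sin_max.
Qed.

End OneSidedPower.

Section StableTail.
Context (R : realType) (alpha beta : R) (f : R -> R).
Notation mu := (@lebesgue_measure R).
Notation I := (`]0, +oo[%classic : set R).
Hypotheses (halpha : 0 < alpha < 2) (hbeta : -1 < beta < 1).
Hypothesis hf : is_stable_density alpha beta f.
Notation theta := (stable_angle alpha beta).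
Notation p := (alpha + 1).

Let a0 : 0 < alpha. Proof. by case/andP: halpha. Qed.
Let p0 : 0 < p. Proof. by rewrite addr_gt0. Qed.
Let q0 (l : R) : 0 < 1 + l ^+ 2. Proof. by rewrite ltr_wpDr ?sqr_ge0. Qed.
Let fi : mu.-integrable setT (EFin \o f) := integrable_density hf.

(** The modulus of the Fourier transform of the test function. *)
Let env (l : R) := Gam p * (1 + l ^+ 2) `^ (- ((p + 1) / 2)).

Let env_le (l : R) : 0 < l -> l `^ alpha * env l <= Gam p * (oneDsqr l)^-1.
Proof.
move=> l0; rewrite /env mulrCA ler_wpM2l ?(ltW (Gam_gt0 p0))//.
have -> : - ((p + 1) / 2) = - (alpha / 2) - 1 by field.
rewrite powRB; last by rewrite (gt_eqF (q0 l)) implybT.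
rewrite powRr1 ?(ltW (q0 l))// /oneDsqr mulrA ler_piMl ?invr_ge0 ?(ltW (q0 l))//.
rewrite powRN ler_pdivrMr ?powR_gt0// mul1r.
have -> : alpha = 2 * (alpha / 2) by field.
rewrite (_ : 2 * (alpha / 2) / 2 = alpha / 2); last by field.
rewrite powRrM ge0_ler_powR ?nnegrE ?powR_ge0 ?(ltW (q0 l)) ?divr_ge0 ?(ltW a0)//.
by rewrite (_ : l `^ 2 = l ^+ 2) ?lerDr// -powR_mulrn// ltW.
Qed.

Let env_le1 (l : R) : env l <= Gam p * (oneDsqr l)^-1.
Proof.
rewrite /env ler_wpM2l ?(ltW (Gam_gt0 p0))// powRN lef_pV2 ?posrE ?powR_gt0//.
rewrite -[X in X <= _]powRr1 ?(ltW (q0 l))// ler_powR ?lerDl ?sqr_ge0//.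
by have := a0; lra.
Qed.

Let gcos_env l : `|gcos p l| <= env l.
Proof.
have [-> _] := gamma_transform l p0; rewrite -/(env l) normrM ger0_norm.
  by rewrite ler_piMr ?cos_max// mulr_ge0 ?powR_ge0 ?(ltW (Gam_gt0 p0)).
by rewrite mulr_ge0 ?powR_ge0 ?(ltW (Gam_gt0 p0)).
Qed.

Let gsin_env l : `|gsin p l| <= env l.
Proof.
have [_ ->] := gamma_transform l p0; rewrite -/(env l) normrM ger0_norm.
  by rewrite ler_piMr ?sin_max// mulr_ge0 ?powR_ge0 ?(ltW (Gam_gt0 p0)).
by rewrite mulr_ge0 ?powR_ge0 ?(ltW (Gam_gt0 p0)).
Qed.

Let iq : mu.-integrable I (EFin \o (fun l => Gam p * (oneDsqr l)^-1)).
Proof.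
have mI : measurable (I : set (measurableTypeR R)) by [].
have io : mu.-integrable I (EFin \o (fun l : R => (oneDsqr l)^-1)).
  exact: (integrableS measurableT mI (@subsetT _ _) (integrable_oneDsqrV R)).
exact: (integrableZl mI (Gam p) io).
Qed.

Let mgcos : measurable_fun setT (@gcos R p).
Proof. by apply: is_derive_measurable => l; exact: is_derive_gcos. Qed.
Let mgsin : measurable_fun setT (@gsin R p).
Proof. by apply: is_derive_measurable => l; exact: is_derive_gsin. Qed.

Let igcos : mu.-integrable I (EFin \o @gcos R p).
Proof.
apply: (@integrable_dominated _ (measurableTypeR R) R mu I _ _ _ _ _ iq) => //.
- exact: measurable_funTS.
- by move=> l _; exact: le_trans (gcos_env l) (env_le1 l).
Qed.

Let igsinN : mu.-integrable I (EFin \o (fun l => - gsin p l)).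
Proof.
apply: (@integrable_dominated _ (measurableTypeR R) R mu I _ _ _ _ _ iq) => //.
- by apply: measurable_funTS; exact: measurable_funN.
- by move=> l _; rewrite normrN; exact: le_trans (gsin_env l) (env_le1 l).
Qed.

Let phic (r : R) := expR (- (r * cos theta)) * cos (r * sin theta).
Let phis (r : R) := expR (- (r * cos theta)) * sin (r * sin theta).

Let M (s : R) := \int[mu]_z (f z * reflected_gamma p (s * z)).

Let parseval_test (s : R) : 0 <= s -> pi * M s =
  \int[mu]_(l in I) (gcos p l * phic ((l * s) `^ alpha) - gsin p l * phis ((l * s) `^ alpha)).
Proof.
move=> s0; have ms : measurable_fun setT (fun z : R => s * z) by exact: measurable_funM.
have tK y : `|reflected_gamma p y| <= expR (p * ln (2 * p)) by rewrite ger0_norm ?reflected_gamma_ge0 ?reflected_gamma_le.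
rewrite /M (parseval fi ms (continuous_reflected_gamma p0) tK (integrable_reflected_gamma p0)
  (fun l _ => reflected_gamma_cos l p0) (fun l _ => reflected_gamma_sin l p0) igcos igsinN).
apply: eq_Rintegral => l /set_mem /halfline_gt0 l0.
have -> : ecos mu f (fun z => s * z) l = ecos mu f id (l * s).
  by apply: eq_Rintegral => z _; rewrite mulrA.
have -> : esin mu f (fun z => s * z) l = esin mu f id (l * s).
  by apply: eq_Rintegral => z _; rewrite mulrA.
have [-> ->] := stable_ecos_esin halpha hf (mulr_ge0 (ltW l0) s0).
by rewrite /phic /phis mulNr.
Qed.

Let dphic (r : R) : is_derive r 1 phic
  (expR (- (r * cos theta)) * (- cos theta * cos (r * sin theta) + (- sin theta) * sin (r * sin theta))).
Proof. by apply: is_derive_eq; rewrite /GRing.scale/=; ring. Qed.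

Let dphis (r : R) : is_derive r 1 phis
  (expR (- (r * cos theta)) * (- cos theta * sin (r * sin theta) + sin theta * cos (r * sin theta))).
Proof. by apply: is_derive_eq; rewrite /GRing.scale/=; ring. Qed.

Let c0 : 0 < cos theta := cos_stable_angle_gt0 halpha hbeta.

Let phi0 : phic 0 = 1 /\ phis 0 = 0.
Proof. by rewrite /phic /phis !mul0r oppr0 expR0 cos0 sin0 mulr0 mulr1. Qed.

(* Both components are 2-Lipschitz on the half-line. *)
Let lipschitz0 (phi dphi : R -> R) (r : R) : 0 <= r ->
  (forall x : R, is_derive x 1 phi (dphi x)) -> (forall x, 0 <= x -> `|dphi x| <= 2) ->
  `|phi r - phi 0| <= 2 * r.
Proof.
move=> r0 dp dp2.
have cphi : {within `[0, r], continuous phi}.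
  by apply: continuous_subspaceT => x; exact: is_derive_continuous (dp x).
have [c /[!in_itv]/= /andP[cge _] ->] := MVT_segment r0 (fun x _ => dp x) cphi.
by rewrite subr0 normrM (ger0_norm r0) ler_wpM2r// dp2.
Qed.

Let trig_le (a b c d r : R) : 0 <= r -> `|a| <= 1 -> `|b| <= 1 -> `|c| <= 1 -> `|d| <= 1 ->
  `|expR (- (r * cos theta)) * (a * b + c * d)| <= 2.
Proof.
move=> r0 a1 b1 c1 d1; rewrite normrM -[leRHS]mul1r ler_pM//.
  by rewrite ger0_norm ?expR_ge0// expR_le1 oppr_le0 mulr_ge0// ltW.
rewrite (le_trans (ler_normD _ _))// !normrM (_ : 2 = 1 * 1 + 1 * 1); last by ring.
by rewrite lerD// ler_pM.
Qed.

Let phic_le (r : R) : 0 <= r -> `|phic r - 1| <= 2 * r.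
Proof.
move=> r0; have [H _] := phi0; rewrite -[X in _ - X]H; apply: (lipschitz0 r0 dphic) => x x0.
by apply: trig_le => //; rewrite ?normrN ?cos_max ?sin_max.
Qed.

Let phis_le (r : R) : 0 <= r -> `|phis r| <= 2 * r.
Proof.
move=> r0; have [_ H] := phi0; rewrite -[X in `|X|]subr0 -[X in _ - X]H.
apply: (lipschitz0 r0 dphis) => x x0.
by apply: trig_le => //; rewrite ?normrN ?cos_max ?sin_max.
Qed.

Let difference_quotient (phi : R -> R) (d : R) (r : nat -> R) :
  is_derive (0 : R) 1 phi d -> (forall n, r n != 0) -> r n @[n --> \oo] --> (0 : R) ->
  (phi (r n) - phi 0) / r n @[n --> \oo] --> d.
Proof.
move=> [dphi dE] rn0 rc0.
have : (fun h : R => h^-1 *: (phi (h *: (1 : R) + 0) - phi 0)) @ 0^' --> d.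
  by rewrite -dE; exact: dphi.
move=> /cvgr_dnbhsP /(_ r (conj rn0 rc0)).
under eq_fun do rewrite addr0 /GRing.scale/= mulr1 mulrC.
by [].
Qed.

(* A primitive of the integrand that the first-order expansion of the characteristic
   function leaves; with [w = atan l] it is [sin w ^ p cos (p w - theta) / p]. *)
Let Lam (l : R) := sin (atan l) `^ p * cos (p * atan l - theta) / p.

Let sin_atan (l : R) : sin (atan l) = l * (1 + l ^+ 2) `^ (- 2^-1).
Proof.
have ca : cos (atan l) = (1 + l ^+ 2) `^ (- 2^-1).
  by rewrite cos_atan powRN powR12_sqrt// ltW.
have ca0 : cos (atan l) != 0 by rewrite ca gt_eqF// powR_gt0.
by rewrite -{2}(atanK l) /tan -ca divfK.
Qed.

Let dLam (l : R) : 0 < l -> is_derive l 1 Lam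
  (l `^ alpha * (1 + l ^+ 2) `^ (- ((p + 1) / 2)) * cos ((p + 1) * atan l - theta)).
Proof.
move=> l0; have s0 : 0 < sin (atan l) by rewrite sin_atan mulr_gt0// powR_gt0.
have ds : is_derive l 1 (fun l : R => sin (atan l)) (cos (atan l) / (1 + l ^+ 2)).
  by apply: is_derive_eq; rewrite /GRing.scale/=.
have dsp := is_derive_powR_comp p s0 ds.
have dat := is_derive1_atan l.
have dc : is_derive l 1 (fun l : R => cos (p * atan l - theta))
    (- (p / (1 + l ^+ 2)) * sin (p * atan l - theta)).
  by apply: is_derive_eq; rewrite /GRing.scale/=; ring.
have pn0 : p != 0 by rewrite gt_eqF.
rewrite /Lam; apply: is_derive_eq; rewrite /GRing.scale/= addrK.
have -> : l `^ alpha * (1 + l ^+ 2) `^ (- ((p + 1) / 2)) =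
    sin (atan l) `^ alpha / (1 + l ^+ 2).
  rewrite sin_atan powRM ?powR_ge0 ?(ltW l0)// -powRrM -mulrA; congr (_ * _).
  have -> : - ((p + 1) / 2) = - 2^-1 * alpha - 1 by field.
  rewrite powRB; last by rewrite (gt_eqF (q0 l)) implybT.
  by rewrite powRr1 // ltW.
have -> : cos ((p + 1) * atan l - theta) = cos (atan l) * cos (p * atan l - theta) -
    sin (atan l) * sin (p * atan l - theta).
  by rewrite -cosD; congr cos; ring.
have -> : sin (atan l) `^ p = sin (atan l) * sin (atan l) `^ alpha.
  by rewrite powRD ?(gt_eqF s0) ?implybT// powRr1 ?(ltW s0)// mulrC.
by field; rewrite pn0 gt_eqF.
Qed.

Let Lam0 : Lam l @[l --> 0^'+] --> 0.
Proof.
apply: (@cvg0_dominated _ _ _ _ _ (fun l => p^-1 * l `^ p)).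
  near=> l; have l0 : 0 < l by near: l; exact: nbhs_right_gt.
  have s0 : 0 <= sin (atan l) by rewrite sin_atan mulr_ge0 ?powR_ge0// ltW.
  have sl : sin (atan l) <= l.
    rewrite sin_atan ler_piMr ?(ltW l0)// powRN invf_le1 ?powR_gt0//.
    by rewrite -[leLHS](powRr0 (1 + l ^+ 2)) ler_powR ?lerDl ?sqr_ge0 ?invr_ge0.
  rewrite /Lam normrM mulrC ger0_norm ?invr_ge0 ?(ltW p0)// ler_wpM2l ?invr_ge0 ?(ltW p0)//.
  rewrite normrM -[leRHS]mulr1 ler_pM ?cos_max// ger0_norm ?powR_ge0//.
  by rewrite ge0_ler_powR ?nnegrE ?(ltW p0) ?(ltW l0).
rewrite -[X in _ --> X](mulr0 p^-1).
by apply: cvgM; [exact: cvg_cst|exact: powR_cvg0].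
Unshelve. all: by end_near. Qed.

Let Lamy : Lam l @[l --> +oo] --> cos (p * (pi / 2) - theta) / p.
Proof.
have pi2 : (@atan R) l @[l --> +oo] --> pi / 2 := @cvgy_atan R.
have s1 : sin (atan l) @[l --> +oo] --> (1 : R).
  rewrite -(sin_pihalf R).
  by apply: (@cvg_comp _ _ _ (@atan R) sin _ (nbhs (pi / 2))) => //; exact: continuous_sin.
rewrite /Lam; apply: cvgM; last exact: cvg_cst.
rewrite -[X in _ --> X]mul1r; apply: cvgM.
  have : sin (atan l) `^ p @[l --> +oo] --> (1 : R) `^ p.
    apply: (@cvg_comp _ _ _ (fun l => sin (atan l)) (fun x => x `^ p) _ (nbhs (1 : R))) => //.
    exact: is_derive_continuous (is_derive1_powR p ltr01).
  by rewrite powR1.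
apply: (@cvg_comp _ _ _ (fun l => p * atan l - theta) cos _ (nbhs (p * (pi / 2) - theta))).
  by apply: cvgB; [apply: cvgM => //; exact: cvg_cst|exact: cvg_cst].
exact: continuous_cos.
Qed.

Let G (l : R) := l `^ alpha * (- cos theta * gcos p l - sin theta * gsin p l).

Let GE (l : R) : G l = (- Gam p) *
  (l `^ alpha * (1 + l ^+ 2) `^ (- ((p + 1) / 2)) * cos ((p + 1) * atan l - theta)).
Proof.
by rewrite /G; have [-> ->] := gamma_transform l p0; rewrite cosB; ring.
Qed.

Let i4q : mu.-integrable I (EFin \o (fun l => 4 * (Gam p * (oneDsqr l)^-1))).
Proof.
have mI : measurable (I : set (measurableTypeR R)) by [].
exact: (integrableZl mI 4 iq).
Qed.

Let test_quotient (u l : R) :=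
  (gcos p l * (phic ((l * u) `^ alpha) - 1) - gsin p l * phis ((l * u) `^ alpha)) / u `^ alpha.

Let M_quotient (u : R) : 0 < u ->
  pi * (M u / u `^ alpha) = \int[mu]_(l in I) test_quotient u l.
Proof.
move=> u0; have M0 : M 0 = 0.
  rewrite /M (_ : (fun z => _) = cst 0) ?Rintegral_cst ?mul0r//.
  by apply/funext => z; rewrite mul0r reflected_gamma_pos// mulr0.
have := parseval_test (lexx 0); rewrite M0 mulr0 => H0.
have := parseval_test (ltW u0) => H.
have mI : measurable (I : set (measurableTypeR R)) by [].
have b2 (phi : R -> R) (r : R) : `|phi r| <= 1 -> `|phi r| <= 1 by [].
have mr (v : R) : measurable_fun setT (fun l : R => (l * v) `^ alpha).
  apply: (measurableT_comp (measurable_powR alpha)).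
  by apply: measurable_funM.
have mphic : measurable_fun setT phic := is_derive_measurable dphic.
have mphis : measurable_fun setT phis := is_derive_measurable dphis.
have phi1 (r : R) : 0 <= r -> `|phic r| <= 1 /\ `|phis r| <= 1.
  move=> r0; have e1 : expR (- (r * cos theta)) <= 1.
    by rewrite expR_le1 oppr_le0 mulr_ge0// ltW.
  by split; rewrite normrM -[leRHS]mul1r ler_pM ?cos_max ?sin_max// ger0_norm ?expR_ge0.
have iI (v : R) : mu.-integrable I (EFin \o (fun l =>
    gcos p l * phic ((l * v) `^ alpha) - gsin p l * phis ((l * v) `^ alpha))).
  have i1 : mu.-integrable I (EFin \o (fun l => gcos p l * phic ((l * v) `^ alpha))).
    apply: (integrable_mul_bounded (K := 1) mI igcos).
      by apply: measurable_funTS; exact: (measurableT_comp mphic (mr v)).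
    by move=> l _; have [] := phi1 _ (powR_ge0 (l * v) alpha).
  have i2 : mu.-integrable I (EFin \o (fun l => - gsin p l * phis ((l * v) `^ alpha))).
    apply: (integrable_mul_bounded (K := 1) mI igsinN).
      by apply: measurable_funTS; exact: (measurableT_comp mphis (mr v)).
    by move=> l _; have [] := phi1 _ (powR_ge0 (l * v) alpha).
  have := integrableD mI i1 i2; apply: eq_integrable => // l _.
  by rewrite /= mulNr EFinN.
rewrite mulrA H -[X in X / _]subr0 [X in (_ - X) / _]H0 -RintegralB//.
rewrite -RintegralZr//; last exact: (integrableB mI (iI u) (iI 0)).
apply: eq_Rintegral => l _; rewrite /test_quotient mulr0 powR0 ?(gt_eqF a0)//.
by have [-> ->] := phi0; congr (_ / _); ring.
Qed.

(** By Parseval the expectation of the test function at scale [u] is an integral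
    against the characteristic function at [l u].  Since the test function vanishes at
    [0], the constant [1] may be subtracted, and what remains is of order [u ^ alpha];
    its coefficient is the integral of the first-order term [- e ^ (- i theta) l ^ alpha],
    computed by the primitive [Lam]. *)
Lemma reflected_gamma_tail_limit (u : nat -> R) : (forall n, 0 < u n) -> u n @[n --> \oo] --> (0 : R) ->
  pi * (M (u n) / (u n) `^ alpha) @[n --> \oo] -->
    - Gam p * (cos (p * (pi / 2) - theta) / p).
Proof.
move=> u0 uc.
have uac : u n `^ alpha @[n --> \oo] --> (0 : R).
  by apply: ((cvg_at_rightP _ _ _).1 (powR_cvg0 a0) u); split.
under eq_fun do rewrite M_quotient//.
have -> : - Gam p * (cos (p * (pi / 2) - theta) / p) = \int[mu]_(l in I) G l.
  have mI : measurable (I : set (measurableTypeR R)) by [].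
  pose dL (l : R) :=
    l `^ alpha * (1 + l ^+ 2) `^ (- ((p + 1) / 2)) * cos ((p + 1) * atan l - theta).
  have cdL (l : R) : 0 < l -> {for l, continuous dL}.
    move=> l0; have da := is_derive1_powR alpha l0.
    have dq : is_derive l 1 (fun l : R => 1 + l ^+ 2) (2 * l).
      by apply: is_derive_eq; rewrite /GRing.scale/=; ring.
    have dp := @is_derive_powR_comp R (fun l => 1 + l ^+ 2) l _ (- ((p + 1) / 2)) (q0 l) dq.
    by rewrite /dL; apply: is_derive_continuous; apply: is_derive_eq; reflexivity.
  have idL : mu.-integrable I (EFin \o dL).
    have := iq; move=> /(integrableZl mI (Gam p)^-1) iq'.
    apply: (@integrable_dominated _ (measurableTypeR R) R mu I _ _ _ _ _ iq') => //.
      apply: open_continuous_measurable_fun => // l /set_mem/=.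
      by rewrite in_itv/= andbT; exact: cdL.
    move=> l /halfline_gt0 l0; rewrite /dL normrM.
    rewrite (@le_trans _ _ (`|l `^ alpha * (1 + l ^+ 2) `^ (- ((p + 1) / 2))|))//.
      by rewrite ler_piMr// cos_max.
    rewrite ger0_norm ?mulr_ge0 ?powR_ge0// -(ler_pM2l (Gam_gt0 p0)).
    rewrite mulVKf ?gt_eqF ?(Gam_gt0 p0)// mulrCA.
    exact: env_le.
  rewrite -[X in _ * X]subr0 -(FTC_halfline dLam cdL idL Lam0 Lamy) -RintegralZl//.
  by apply: eq_Rintegral => l _; rewrite GE.
apply: (@Rintegral_cvg _ (measurableTypeR R) R mu I (fun n => test_quotient (u n)) G
  (fun l => 4 * (Gam p * (oneDsqr l)^-1))) => //.
- move=> n; apply: measurable_funTS; apply: measurable_funM => //.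
  have mr : measurable_fun setT (fun l : R => (l * u n) `^ alpha).
    apply: (measurableT_comp (measurable_powR alpha)).
    by apply: measurable_funM.
  have mphic := is_derive_measurable dphic; have mphis := is_derive_measurable dphis.
  apply: measurable_funB; apply: measurable_funM => //.
  - by apply: measurable_funB => //; exact: (measurableT_comp mphic mr).
  - exact: (measurableT_comp mphis mr).
- move=> l /halfline_gt0 l0; have la0 : 0 < l `^ alpha by rewrite powR_gt0.
  have E n : test_quotient (u n) l = l `^ alpha *
      (gcos p l * ((phic ((l * u n) `^ alpha) - phic 0) / (l * u n) `^ alpha) -
       gsin p l * ((phis ((l * u n) `^ alpha) - phis 0) / (l * u n) `^ alpha)).
    have [-> ->] := phi0; rewrite subr0 /test_quotient.
    rewrite (powRM _ (ltW l0) (ltW (u0 n))).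
    by field; rewrite !gt_eqF// powR_gt0.
  have rc : (l * u n) `^ alpha @[n --> \oo] --> (0 : R).
    have : l `^ alpha * u n `^ alpha @[n --> \oo] --> l `^ alpha * 0.
      by apply: cvgM => //; exact: cvg_cst.
    rewrite mulr0; under eq_fun do rewrite -(powRM _ (ltW l0) (ltW (u0 _))).
    by [].
  have rn0 n : (l * u n) `^ alpha != 0 by rewrite gt_eqF// powR_gt0// mulr_gt0.
  have dc : is_derive (0 : R) 1 phic (- cos theta).
    by apply: is_derive_eq (dphic 0) _; rewrite !mul0r oppr0 expR0 cos0 sin0; ring.
  have dsn : is_derive (0 : R) 1 phis (sin theta).
    by apply: is_derive_eq (dphis 0) _; rewrite !mul0r oppr0 expR0 cos0 sin0; ring.
  under eq_fun do rewrite E.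
  have -> : G l = l `^ alpha * (gcos p l * - cos theta - gsin p l * sin theta).
    by rewrite /G; ring.
  apply: cvgM; first exact: cvg_cst.
  apply: cvgB; apply: cvgM; try exact: cvg_cst.
  - exact: difference_quotient.
  - exact: difference_quotient.
- move=> n l /halfline_gt0 l0; have un0 := u0 n.
  set r := (l * u n) `^ alpha; have r0 : 0 <= r by exact: powR_ge0.
  have ua0 : 0 < u n `^ alpha by rewrite powR_gt0.
  rewrite /test_quotient -/r normrM [X in _ * X]ger0_norm ?invr_ge0 ?(ltW ua0)//.
  rewrite ler_pdivrMr//.
  have -> : 4 * (Gam p / oneDsqr l) * u n `^ alpha =
    4 * u n `^ alpha * (Gam p / oneDsqr l) by ring.
  apply: (@le_trans _ _ (4 * u n `^ alpha * (l `^ alpha * env l))); last first.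
    by rewrite ler_wpM2l ?env_le// mulr_ge0// ltW.
  have -> : 4 * u n `^ alpha * (l `^ alpha * env l) = env l * (2 * r) + env l * (2 * r).
    by rewrite /r powRM ?(ltW l0) ?(ltW un0)//; ring.
  rewrite (le_trans (ler_normB _ _))// lerD// normrM ler_pM ?gcos_env ?gsin_env//.
  - exact: phic_le.
  - exact: phis_le.
Qed.

End StableTail.

Lemma indic_ray (R : realType) (v z : R) : (\1_(`]-oo, v]%classic) z : R) = (z <= v)%R%:R.
Proof.
rewrite indicE (_ : (z \in _) = (z <= v))//.
by apply/idP/idP; rewrite inE/= in_itv.
Qed.

Section StableCdf.
Context (R : realType) (alpha beta : R) (f : R -> R).
Notation mu := (@lebesgue_measure R).
Hypotheses (halpha : 0 < alpha < 2) (hbeta : -1 < beta < 1).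
Hypothesis hf : is_stable_density alpha beta f.
Notation theta := (stable_angle alpha beta).
Notation p := (alpha + 1).

Definition stable_cdf (v : R) : R := \int[mu]_z (f z * \1_(`]-oo, v]%classic) z).

Let a0 : 0 < alpha. Proof. by case/andP: halpha. Qed.
Let p0 : 0 < p. Proof. by rewrite addr_gt0. Qed.
Let fi : mu.-integrable setT (EFin \o f) := integrable_density hf.

Lemma integrable_stable_indic (A : set R) : measurable A ->
  mu.-integrable setT (EFin \o (fun z => f z * \1_A z)).
Proof.
move=> mA; apply: (integrable_mul_bounded (K := 1)) => //.
by move=> z _; rewrite indicE; case: (_ \in _); rewrite ?normr1 ?normr0.
Qed.

Let K : R := expR (p * ln (2 * p)).
Let dl : R := ln (3 / 2).
Let B : R := 2 `^ (- p) * (3 / 2).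

Let dl0 : 0 < dl. Proof. by rewrite ln_gt0//; lra. Qed.
Let B0 : 0 <= B. Proof. by rewrite mulr_ge0 ?powR_ge0//; lra. Qed.

(* With [B] and [dl] as chosen, the second test function dominates the first on
   [[- dl, 0]], so that the difference is positive only further to the left. *)
Let test_cancel (x : R) :
  reflected_gamma p x - B * reflected_gamma p (2 * x) <= K * \1_(`]-oo, - dl]%classic) x.
Proof.
rewrite indic_ray; have [xd|xd] := leP x (- dl).
  by rewrite mulr1 (le_trans _ (reflected_gamma_le x p0))// gerBl mulr_ge0 ?reflected_gamma_ge0.
rewrite mulr0 subr_le0; have [x0|x0] := leP 0 x.
  by rewrite reflected_gamma_pos// mulr_ge0 ?reflected_gamma_ge0.
have nx : 0 <= - x by rewrite oppr_ge0 ltW.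
rewrite !reflected_gamma_neg ?(ltW x0)//; last by rewrite pmulr_rle0// ltW.
rewrite /gamma_fun !opprK -mulrN powRM// /B powRN.
have pe : (2 : R) `^ p != 0 by rewrite gt_eqF// powR_gt0.
have -> : (2 `^ p)^-1 * (3 / 2) * (2 `^ p * (- x) `^ p * expR (2 * x)) =
    (- x) `^ p * (3 / 2 * expR (2 * x)) by field.
rewrite ler_wpM2l ?powR_ge0//.
have -> : 2 * x = x + x by ring.
rewrite expRD mulrA ler_peMl ?expR_ge0//.
have : expR (- dl) <= expR x by rewrite ler_expR ltW.
rewrite expRN lnK ?posrE; last by lra.
by move=> h; lra.
Qed.

(** The expectation of the test function behaves like [L s ^ alpha] with [L > 0] at
    small scale [s].  In the combination with [B = (3 / 2) 2 ^ (- p)] the limit remains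
    positive, [L - B 2 ^ alpha L = L / 4], whereas [test_cancel] bounds the combination
    by a multiple of the mass to the left of [- dl / s]. *)
Lemma stable_left_tail : cos (p * (pi / 2) - theta) < 0 ->
  exists c y0 : R, [/\ 0 < c, 0 < y0 &
    forall y, y0 <= y -> c * y `^ (- alpha) <= stable_cdf (- y)].
Proof.
move=> cneg; pose M (s : R) := \int[mu]_z (f z * reflected_gamma p (s * z)).
pose L := (- Gam p * (cos (p * (pi / 2) - theta) / p)) / pi.
have pip : (0 : R) < pi by exact: pi_gt0.
have L0 : 0 < L.
  rewrite divr_gt0// mulNr -mulrN mulr_gt0 ?Gam_gt0// -mulNr divr_gt0// oppr_gt0.
  exact: cneg.
have ML : M s / s `^ alpha @[s --> 0^'+] --> L.
  apply/cvg_at_rightP => u [u0 uc].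
  have := reflected_gamma_tail_limit halpha hbeta hf u0 uc; rewrite -/(M _) => H.
  have : pi^-1 * (pi * (M (u n) / u n `^ alpha)) @[n --> \oo] -->
      pi^-1 * (- Gam p * (cos (p * (pi / 2) - theta) / p)).
    by apply: cvgM => //; exact: cvg_cst.
  rewrite [X in _ --> X]mulrC -/L; under eq_fun do rewrite mulKf ?gt_eqF//.
  by [].
have M2L : M (2 * s) / s `^ alpha @[s --> 0^'+] --> 2 `^ alpha * L.
  apply/cvg_at_rightP => u [u0 uc].
  have : 2 `^ alpha * (M (2 * u n) / (2 * u n) `^ alpha) @[n --> \oo] --> 2 `^ alpha * L.
    apply: cvgM; first exact: cvg_cst.
    apply: ((cvg_at_rightP _ _ _).1 ML (fun n => 2 * u n)); split.
      by move=> n; rewrite mulr_gt0.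
    by rewrite -[X in _ --> X](mulr0 2); apply: cvgM => //; exact: cvg_cst.
  rewrite (_ : (fun n => _) = (fun n => M (2 * u n) / u n `^ alpha))//.
  apply/funext => n; rewrite powRM ?(ltW (u0 n))//.
  by field; rewrite !gt_eqF// powR_gt0.
have Q : M s / s `^ alpha - B * (M (2 * s) / s `^ alpha) @[s --> 0^'+] --> L / 4.
  have -> : L / 4 = L - B * (2 `^ alpha * L).
    rewrite /B opprD powRD; last by rewrite pnatr_eq0 implybT.
    rewrite powRN powRN powRr1//.
    have pe : (2 : R) `^ alpha != 0 by rewrite gt_eqF// powR_gt0.
    by field.
  by apply: cvgB => //; apply: cvgM => //; exact: cvg_cst.
have L8 : L / 8 < L / 4 by lra.
have [s0 /= s00 Hs0] := cvgr_gt _ Q _ L8.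
have K0 : 0 < K by exact: expR_gt0.
have imul (s : R) : mu.-integrable setT (EFin \o (fun z => f z * reflected_gamma p (s * z))).
  apply: (integrable_mul_bounded (K := K)) => //.
    have mt := continuous_measurable_fun (continuous_reflected_gamma p0).
    by apply: (measurableT_comp mt); exact: measurable_funM.
  by move=> z _; rewrite ger0_norm ?reflected_gamma_ge0 ?reflected_gamma_le.
have key (s : R) : 0 < s -> M s - B * M (2 * s) <= K * stable_cdf (- (dl / s)).
  move=> sp; rewrite /M /stable_cdf -!RintegralZl//; last exact: integrable_stable_indic.
  have iB := integrableZl measurableT B (imul (2 * s)).
  rewrite -RintegralB//; apply: le_Rintegral => //.
  - exact: (integrableB measurableT (imul s) iB).
  - exact: (integrableZl measurableT K (integrable_stable_indic _)).
  - move=> z _; have := test_cancel (s * z); rewrite !indic_ray.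
    have -> : (z <= - (dl / s)) = (s * z <= - dl) by rewrite -mulNr ler_pdivlMr// mulrC.
    rewrite (mulrA 2) => H.
    have := ler_wpM2l (density_ge0 hf z) H.
    by rewrite mulrBr (mulrCA _ B) (mulrCA _ K).
exists (L / (8 * K) * dl `^ alpha), (2 * dl / s0); split.
- by rewrite mulr_gt0 ?powR_gt0// divr_gt0// mulr_gt0.
- by rewrite divr_gt0// mulr_gt0.
move=> y yy; have y0 : 0 < y by apply: lt_le_trans yy; rewrite divr_gt0// mulr_gt0.
pose s := dl / y; have sp : 0 < s by rewrite divr_gt0.
have ss : s < s0.
  rewrite /s ltr_pdivrMr// mulrC -ltr_pdivrMr//.
  apply: lt_le_trans yy; rewrite ltr_pM2r ?invr_gt0//.
  by have := dl0; lra.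
have := Hs0 s; rewrite /ball/= sub0r normrN gtr0_norm// => /(_ ss sp) Hq.
have := key _ sp; rewrite (_ : dl / s = y); last by rewrite /s; field; rewrite !gt_eqF.
have sa : 0 < s `^ alpha by rewrite powR_gt0.
have : L / 8 * s `^ alpha <= M s - B * M (2 * s).
  rewrite -ler_pdivlMr// ltW// (lt_le_trans Hq)// le_eqVlt; apply/orP; left; apply/eqP.
  by field; rewrite gt_eqF.
move=> h1 h2; have := le_trans h1 h2; rewrite -ler_pdivrMl//.
apply: le_trans; rewrite le_eqVlt; apply/orP; left; apply/eqP.
rewrite /s powRN powRM ?invr_ge0 ?(ltW dl0) ?(ltW y0)//.
rewrite -(powR_inv1 (ltW y0)) -powRrM mulN1r powRN.
by field; rewrite !gt_eqF// powR_gt0.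
Qed.

(** The angle is [pi + (pi / 2) (alpha - 1 - rho)] with [rho] the skewness, and
    [|alpha - 1 - rho| < 1] because [|beta| < 1]. *)
Lemma stable_tail_sign : 1 <= alpha -> cos (p * (pi / 2) - theta) < 0.
Proof.
move=> a1; have pip : (0 : R) < pi by exact: pi_gt0.
have /andP[b1 b2] := hbeta; have /andP[_ a2] := halpha.
have [r1 r2] : alpha - 2 < skewness alpha beta /\ skewness alpha beta < alpha.
  rewrite /skewness (ltNge alpha 1) a1/=; case: eqP => [->|_]; first by split; lra.
  have H1 : 0 < (1 - beta) * (2 - alpha) by rewrite mulr_gt0 ?subr_gt0.
  have H2 : 0 < (1 + beta) * (2 - alpha) by rewrite mulr_gt0 ?subr_gt0// -ltrBlDl sub0r.
  by split; lra.
have -> : p * (pi / 2) - theta = (pi / 2) * (alpha - 1 - skewness alpha beta) + pi.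
  by rewrite /stable_angle; field.
rewrite cosDpi oppr_lt0; apply: cos_gt0_pihalf.
have H1 : 0 < (pi / 2) * (alpha - skewness alpha beta) by rewrite mulr_gt0 ?divr_gt0 ?subr_gt0.
have H2 : 0 < (pi / 2) * (2 - alpha + skewness alpha beta).
  by rewrite mulr_gt0 ?divr_gt0//; lra.
by apply/andP; split; lra.
Qed.

End StableCdf.

(** * The mass of the negative half-line *)

Section AngleIntegral.
Context (R : realType) (alpha : R).
Notation mu := (@lebesgue_measure R).
Notation I := (`]0, +oo[%classic : set R).
Hypothesis a0 : 0 < alpha.
Implicit Types (l r w : R).


Lemma abs_sin_le (x : R) : `|sin x| <= `|x|.
Proof.
wlog x0 : x / 0 <= x.
  move=> H; have [/H//|/ltW xn] := leP 0 x.
  by rewrite -normrN -sinN -[leRHS]normrN; apply: H; rewrite oppr_ge0.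
have cs : {within `[0, x], continuous (@sin R)}.
  by apply: continuous_subspaceT; exact: continuous_sin.
have [c _ ] := MVT_segment x0 (fun y _ => is_derive_sin y) cs.
by rewrite sin0 !subr0 => ->; rewrite normrM ler_piMl ?cos_max.
Qed.

Lemma cvg_powRy : l `^ alpha @[l --> +oo] --> +oo.
Proof.
apply/cvgryPge => A; near=> l.
have l1 : `|A| `^ alpha^-1 <= l by near: l; exact: nbhs_pinfty_ge.
rewrite (le_trans (ler_norm A))//.
have -> : `|A| = (`|A| `^ alpha^-1) `^ alpha by rewrite -powRrM mulVf ?gt_eqF// powRr1.
by rewrite ge0_ler_powR ?nnegrE ?powR_ge0 ?(ltW a0)// (le_trans _ l1) ?powR_ge0.
Unshelve. all: by end_near. Qed.

Let damp (c l : R) := l `^ (alpha - 1) * expR (- (c * l `^ alpha)).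

Let damp_cvgy (c : R) : 0 < c -> expR (- (c * l `^ alpha)) @[l --> +oo] --> 0.
Proof.
move=> c0; apply: (@cvg_comp _ _ _ (fun l => l `^ alpha) (fun r => expR (- (c * r))) _ +oo).
  exact: cvg_powRy.
exact: cvg_expR_scale.
Qed.

Let continuous_damp (c l : R) : 0 < l -> {for l, continuous (damp c)}.
Proof.
move=> l0; have d1 := is_derive1_powR (alpha - 1) l0; have d2 := is_derive1_powR alpha l0.
by apply: is_derive_continuous; apply: is_derive_eq; reflexivity.
Qed.

Lemma integrable_damp (c : R) : 0 < c -> mu.-integrable I (EFin \o damp c).
Proof.
move=> c0; have ca0 : 0 < c * alpha by rewrite mulr_gt0.
pose F l := - (c * alpha)^-1 * expR (- (c * l `^ alpha)).
have [|||||//] := @ge0_FTC_halfline R F (damp c) (- (c * alpha)^-1 * expR (- (c * 0)))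
  (- (c * alpha)^-1 * 0).
- move=> l l0; have d2 := is_derive1_powR alpha l0.
  apply: is_derive_eq; rewrite /GRing.scale/= /damp.
  by field; rewrite !gt_eqF.
- exact: continuous_damp.
- by move=> l l0; rewrite mulr_ge0 ?powR_ge0 ?expR_ge0.
- apply: cvgM; first exact: cvg_cst.
  apply: (@cvg_comp _ _ _ (fun l => l `^ alpha) (fun r => expR (- (c * r))) _ (nbhs (0 : R))).
    exact: powR_cvg0.
  have : {for 0, continuous (fun r : R => expR (- (c * r)))}.
    by apply: is_derive_continuous; apply: is_derive_eq; reflexivity.
  by [].
- by apply: cvgM; [exact: cvg_cst|exact: damp_cvgy].
Qed.

Let arc w l := expR (- (l `^ alpha * cos w)) * sin (l `^ alpha * sin w) / l.
Let darc w l := l `^ (alpha - 1) * expR (- (l `^ alpha * cos w)) * cos (l `^ alpha * sin w - w).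

Let powE l : 0 < l -> l `^ alpha / l = l `^ (alpha - 1).
Proof.
by move=> l0; rewrite powRB ?powRr1 ?(ltW l0)// (gt_eqF l0) implybT.
Qed.

Let arc_le (c w l : R) : 0 < l -> c <= cos w -> `|arc w l| <= damp c l.
Proof.
move=> l0 cw; have la0 : 0 <= l `^ alpha by exact: powR_ge0.
rewrite /arc /damp -powE// normrM normrM.
rewrite [X in X * _ * _]ger0_norm ?expR_ge0// [X in _ * X]ger0_norm ?invr_ge0 ?(ltW l0)//.
rewrite [leRHS]mulrC mulrA ler_wpM2r ?invr_ge0 ?(ltW l0)// ler_pM ?expR_ge0//.
  by rewrite ler_expR lerN2 mulrC ler_wpM2l.
rewrite (le_trans (abs_sin_le _))// normrM (ger0_norm la0) ler_piMr//.
exact: sin_max.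
Qed.

Let darc_le (c w l : R) : 0 < l -> c <= cos w -> `|darc w l| <= damp c l.
Proof.
move=> l0 cw; rewrite /darc /damp normrM normrM -[leRHS]mulr1.
rewrite ler_pM ?mulr_ge0 ?cos_max// ger0_norm ?powR_ge0// ger0_norm ?expR_ge0//.
by rewrite ler_wpM2l ?powR_ge0// ler_expR lerN2 mulrC ler_wpM2l ?powR_ge0.
Qed.

Let is_derive_arc w l : 0 < l -> is_derive w 1 (fun w => arc w l) (darc w l).
Proof.
move=> l0; rewrite /arc; apply: is_derive_eq; rewrite /GRing.scale/= /darc -powE// cosB.
by field; rewrite gt_eqF.
Qed.

Let continuous_arc w l : 0 < l -> {for l, continuous (arc w)}.
Proof.
move=> l0; have d2 := is_derive1_powR alpha l0.
rewrite /arc; apply: cvgM; last by apply: cvgV; [rewrite gt_eqF|exact: cvg_id].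
have : {for l, continuous (fun l => expR (- (l `^ alpha * cos w)) * sin (l `^ alpha * sin w))}.
  by apply: is_derive_continuous; apply: is_derive_eq; reflexivity.
by [].
Qed.

Let continuous_darc w l : 0 < l -> {for l, continuous (darc w)}.
Proof.
move=> l0; have d2 := is_derive1_powR alpha l0; have d1 := is_derive1_powR (alpha - 1) l0.
by rewrite /darc; apply: is_derive_continuous; apply: is_derive_eq; reflexivity.
Qed.

Let measurable_pos (h : R -> R) : (forall l, 0 < l -> {for l, continuous h}) ->
  measurable_fun (I : set (measurableTypeR R)) h.
Proof.
move=> ch; apply: open_continuous_measurable_fun => // l /set_mem/=.
by rewrite in_itv/= andbT; exact: ch.
Qed.

Let integrable_arc w : 0 < cos w -> mu.-integrable I (EFin \o arc w).
Proof.
move=> cw; apply: (@integrable_dominated _ (measurableTypeR R) R mu I _ _ _ _ _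
  (integrable_damp cw)) => //.
- by apply: measurable_pos => l; exact: continuous_arc.
- by move=> l /halfline_gt0 l0; exact: arc_le.
Qed.

Let Rintegral_darc w : 0 < cos w -> \int[mu]_(l in I) darc w l = alpha^-1.
Proof.
move=> cw; pose F l := - alpha^-1 * (expR (- (l `^ alpha * cos w)) * cos (l `^ alpha * sin w)).
have F0 : F l @[l --> 0^'+] --> - alpha^-1.
  have -> : - alpha^-1 = - alpha^-1 * (expR (- (0 * cos w)) * cos (0 * sin w)).
    by rewrite !mul0r oppr0 expR0 cos0 !mulr1.
  apply: cvgM; first exact: cvg_cst.
  apply: (@cvg_comp _ _ _ (fun l => l `^ alpha)
    (fun r => expR (- (r * cos w)) * cos (r * sin w)) _ (nbhs (0 : R))).
    exact: powR_cvg0.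
  have : {for 0, continuous (fun r : R => expR (- (r * cos w)) * cos (r * sin w))}.
    by apply: is_derive_continuous; apply: is_derive_eq; reflexivity.
  by [].
have Fy : F l @[l --> +oo] --> (0 : R).
  rewrite -[X in _ --> X](mulr0 (- alpha^-1)); apply: cvgM; first exact: cvg_cst.
  apply: (@cvg0_dominated _ _ _ _ _ (fun l => expR (- (cos w * l `^ alpha)))).
    apply: nearW => l; rewrite normrM [X in X * _]ger0_norm ?expR_ge0// mulrC (mulrC (cos w)).
    by rewrite ler_piMl ?expR_ge0 ?cos_max.
  exact: damp_cvgy.
have -> : alpha^-1 = 0 - - alpha^-1 by rewrite sub0r opprK.
apply: (@FTC_halfline _ F (darc w)) F0 Fy.
- move=> l l0; have d2 := is_derive1_powR alpha l0.
  rewrite /F; apply: is_derive_eq; rewrite /GRing.scale/= /darc cosB.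
  by field; rewrite gt_eqF.
- exact: continuous_darc.
- apply: (@integrable_dominated _ (measurableTypeR R) R mu I _ _ _ _ _ (integrable_damp cw)) => //.
    by apply: measurable_pos => l; exact: continuous_darc.
  by move=> l /halfline_gt0 l0; exact: darc_le.
Qed.

Let cos_le (w b : R) : `|w| <= b -> b <= pi / 2 -> cos b <= cos w.
Proof.
move=> wb bp; have pip : (0 : R) < pi by exact: pi_gt0.
move: wb; rewrite ler_norml => /andP[w1 w2].
have H : cos w - cos b = 2 * (sin ((b + w) / 2) * sin ((b - w) / 2)).
  have -> : cos w = cos ((b + w) / 2 - (b - w) / 2) by congr cos; field.
  have -> : cos b = cos ((b + w) / 2 + (b - w) / 2) by congr cos; field.
  by rewrite cosB cosD; ring.
rewrite -subr_ge0 H mulr_ge0// mulr_ge0//; apply: sin_ge0_pi; apply/andP; split; lra.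
Qed.

Let J w := \int[mu]_(l in I) arc w l.

Let is_derive_J w : - (pi / 2) < w < pi / 2 -> is_derive w 1 J (alpha^-1).
Proof.
move=> /andP[w1 w2]; have aw : `|w| < pi / 2 by rewrite ltr_norml w1.
pose b := (`|w| + pi / 2) / 2.
have [b1 b2] : `|w| < b /\ b < pi / 2 by rewrite /b; split; lra.
have wb : - b < w < b by rewrite -ltr_norml.
have c0 : 0 < cos b by apply: cos_gt0_pihalf; apply/andP; split => //; have := normr_ge0 w; lra.
have cb x : - b < x < b -> cos b <= cos x.
  by rewrite -ltr_norml => xb; apply: cos_le; exact: ltW.
have cw0 : 0 < cos w := lt_le_trans c0 (cb _ wb).
rewrite -(Rintegral_darc cw0).
apply: (@is_derive_Rintegral _ (measurableTypeR R) R mu I arc darc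
  (fun l => damp (cos b) l) w (- b) b) => //.
- by move=> x /cb cx; apply: integrable_arc; exact: lt_le_trans cx.
- by move=> x l _ /halfline_gt0 l0; exact: is_derive_arc.
- by move=> l; rewrite mulr_ge0 ?powR_ge0 ?expR_ge0.
- exact: integrable_damp.
- by move=> x l /cb cx /halfline_gt0 l0; exact: darc_le.
Qed.

(** The derivative in the angle is the integral of an exact derivative in [l] and equals
    [1 / alpha]; the integral vanishes at angle [0]. *)
Lemma angle_integral w : - (pi / 2) < w < pi / 2 ->
  mu.-integrable I (EFin \o (fun l =>
    expR (- (l `^ alpha * cos w)) * sin (l `^ alpha * sin w) / l)) /\
  \int[mu]_(l in I) (expR (- (l `^ alpha * cos w)) * sin (l `^ alpha * sin w) / l) = w / alpha.
Proof.
move=> wp; split; first by apply: integrable_arc; exact: cos_gt0_pihalf.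
rewrite -/(arc w) -/(J w).
have J0 : J 0 = 0.
  rewrite /J (_ : arc 0 = cst 0) ?Rintegral_cst ?mul0r//.
  by apply/funext => l; rewrite /arc sin0 mulr0 sin0 mulr0 mul0r.
have pip : (0 : R) < pi by exact: pi_gt0.
wlog w0 : w wp / 0 <= w.
  move=> H; have [/H|/ltW wn] := leP 0 w; first exact.
  have /andP[w1 w2] := wp.
  have JN : J (- w) = - J w.
    have mI : measurable (I : set (measurableTypeR R)) by [].
    have N := @RintegralZl _ (measurableTypeR R) R mu I _ (- 1) mI
      (integrable_arc (cos_gt0_pihalf wp)).
    rewrite -[RHS]mulN1r; apply: etrans N; apply: eq_Rintegral => l _.
    by rewrite /arc cosN sinN !mulrN sinN; ring.
  have := H (- w); rewrite JN mulNr => /(_ _ _)/oppr_inj; apply.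
    by apply/andP; split; lra.
  by rewrite oppr_ge0.
have /andP[_ w2] := wp.
have dJ x : x \in `[0, w] -> is_derive x 1 J alpha^-1.
  by rewrite in_itv/= => /andP[x0 xw]; apply: is_derive_J; apply/andP; split; lra.
have cJ : {within `[0, w], continuous J}.
  apply: continuous_in_subspaceT => x /set_mem/= xw.
  exact: is_derive_continuous (dJ x xw).
have dJ' x : x \in `]0, w[ -> is_derive x 1 J ((fun=> alpha^-1) x).
  by move=> xw; apply: dJ; exact: subset_itv_oo_cc xw.
have [c _] := MVT_segment w0 dJ' cJ.
by rewrite J0 !subr0 mulrC.
Qed.

End AngleIntegral.

Section Positivity.
Context (R : realType) (alpha beta : R) (f : R -> R).
Notation mu := (@lebesgue_measure R).
Notation I := (`]0, +oo[%classic : set R).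
Hypotheses (halpha : 0 < alpha < 2) (hbeta : -1 < beta < 1).
Hypothesis hf : is_stable_density alpha beta f.
Notation theta := (stable_angle alpha beta).
Local Notation step n := (n.+1%:R^-1 : R).

Let a0 : 0 < alpha. Proof. by case/andP: halpha. Qed.
Let fi : mu.-integrable setT (EFin \o f) := integrable_density hf.

(* Integrable continuous approximations of the indicator of the right half-line, with
   explicit Fourier transforms. *)
Let bump (n : nat) (z : R) : R :=
  expR (- (step n * Num.max z 0)) - expR (- (n.+1%:R * Num.max z 0)).

Let bump_neg n z : z <= 0 -> bump n z = 0.
Proof. by move=> z0; rewrite /bump max_r// !mulr0 subrr. Qed.

Let bump_pos n z : 0 < z -> bump n z = expR (- (step n * z)) - expR (- (n.+1%:R * z)).
Proof. by move=> z0; rewrite /bump max_l// ltW. Qed.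

Let bump01 n z : 0 <= bump n z <= 1.
Proof.
have m0 : 0 <= Num.max z 0 by rewrite le_max lexx orbT.
apply/andP; split.
  rewrite /bump subr_ge0 ler_expR lerN2 ler_wpM2r//.
  by rewrite (@le_trans _ _ 1)// ?invf_le1// ler1n.
rewrite /bump (@le_trans _ _ (expR (- (step n * Num.max z 0))))//.
  by rewrite gerBl expR_ge0.
by rewrite expR_le1 oppr_le0 mulr_ge0.
Qed.

Let cmax : continuous (fun z : R => Num.max z 0).
Proof.
move=> z; have [z0|z0|->] := ltgtP z 0.
- apply: cvg_near_cst; near=> y; rewrite !max_r ?(ltW z0)//.
  by apply: ltW; near: y; exact: lt_nbhsl.
- apply: (@cvg_trans _ (id y @[y --> z])).
    apply: near_eq_cvg; near=> y; rewrite max_l//.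
    by apply: ltW; near: y; apply: (cvgr_gt z) => //; exact: cvg_id.
  by rewrite max_l ?(ltW z0)//; exact: cvg_id.
- apply/cvgrPdist_lt => e e0; near=> y; rewrite maxxx sub0r normrN.
  rewrite ger0_norm ?le_max ?lexx ?orbT// gt_max e0 andbT.
  by near: y; apply: (cvgr_lt (0 : R)) => //; exact: cvg_id.
Unshelve. all: by end_near. Qed.

Let cbump n : continuous (bump n).
Proof.
move=> z; rewrite /bump; apply: cvgB.
- apply: (@cvg_comp _ _ _ (fun z : R => Num.max z 0) (fun m => expR (- (step n * m))) _
    (nbhs (Num.max z 0))); first exact: cmax.
  have : {for Num.max z 0, continuous (fun m : R => expR (- (step n * m)))}.
    by apply: is_derive_continuous; apply: is_derive_eq; reflexivity.
  by [].
- apply: (@cvg_comp _ _ _ (fun z : R => Num.max z 0) (fun m => expR (- (n.+1%:R * m))) _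
    (nbhs (Num.max z 0))); first exact: cmax.
  have : {for Num.max z 0, continuous (fun m : R => expR (- (n.+1%:R * m)))}.
    by apply: is_derive_continuous; apply: is_derive_eq; reflexivity.
  by [].
Qed.

Let mI : measurable (I : set (measurableTypeR R)). Proof. by []. Qed.

Let ibump n : mu.-integrable I (EFin \o bump n).
Proof.
have i1 := integrable_expR (step_gt0 R n).
have i2 : mu.-integrable I (EFin \o (fun l => expR (- (n.+1%:R * l)))) by exact: integrable_expR.
have := integrableB mI i1 i2; apply: eq_integrable => // z /set_mem /halfline_gt0 z0.
by rewrite /= bump_pos.
Qed.

Let odd (n : nat) (x : R) : R := bump n (- x) - bump n x.

Let codd n : continuous (odd n).
Proof.
move=> x; apply: cvgB; last exact: cbump.
apply: (@cvg_comp _ _ _ (fun x : R => - x) (bump n) _ (nbhs (- x))); last exact: cbump.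
by apply: cvgN; exact: cvg_id.
Qed.

Let odd_le n x : `|odd n x| <= 1.
Proof.
have /andP[h1 h2] := bump01 n (- x); have /andP[h3 h4] := bump01 n x.
by rewrite /odd ler_norml; apply/andP; split; lra.
Qed.

Let ihalf n := integrable_halfline (@bump_neg n) (ibump n).
Let ihalfN n := integrable_halflineN (@bump_neg n) (ibump n).

Let iodd n : mu.-integrable setT (EFin \o odd n).
Proof. exact: (integrableB measurableT (ihalfN n) (ihalf n)). Qed.

Let odd_trig n (b : R -> R) : measurable_fun setT b -> (forall y, `|b y| <= 1) ->
  \int[mu]_x (odd n x * b x) =
  \int[mu]_(z in I) (bump n z * b (- z)) - \int[mu]_(z in I) (bump n z * b z).
Proof.
move=> mb b1.
rewrite -(Rintegral_halflineN (@bump_neg n) (ibump n) mb b1).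
rewrite -(Rintegral_halfline (@bump_neg n)) -RintegralB//.
- by apply: eq_Rintegral => x _; rewrite /odd mulrBl.
- exact: integrable_mul_bounded (ihalfN n) mb (fun x _ => b1 x).
- exact: integrable_mul_bounded (ihalf n) mb (fun x _ => b1 x).
Qed.

Let odd_cos n l : \int[mu]_x (odd n x * cos (l * x)) = 0.
Proof.
rewrite (odd_trig n (b := fun x => cos (l * x))).
- by apply/eqP; rewrite subr_eq0; apply/eqP; apply: eq_Rintegral => z _; rewrite mulrN cosN.
- by apply: (measurableT_comp (@measurable_cos R)); exact: measurable_funM.
- by move=> y; exact: cos_max.
Qed.

Let sker (n : nat) (l : R) : R :=
  l / (step n ^+ 2 + l ^+ 2) - l / (n.+1%:R ^+ 2 + l ^+ 2).

Let bump_sin n l : \int[mu]_(z in I) (bump n z * sin (l * z)) = sker n l.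
Proof.
have n0 : (0 : R) < n.+1%:R by [].
rewrite /sker -(laplace_sin l (step_gt0 R n)) -(laplace_sin l n0).
have is1 (e : R) : 0 < e -> mu.-integrable I (EFin \o (fun z => expR (- (e * z)) * sin (z * l))).
  move=> e0; apply: (integrable_mul_bounded (K := 1) mI (integrable_expR e0)).
  - by apply: measurable_funTS; apply: (measurableT_comp (@measurable_sin R)); exact: measurable_funM.
  - by move=> z _; exact: sin_max.
rewrite -RintegralB//; [|exact: is1|exact: is1].
by apply: eq_Rintegral => z /set_mem /halfline_gt0 z0; rewrite bump_pos// (mulrC z) mulrBl.
Qed.

Let odd_sin n l : \int[mu]_x (odd n x * sin (l * x)) = - 2 * sker n l.
Proof.
rewrite (odd_trig n (b := fun x => sin (l * x))); last 2 first.
- by apply: (measurableT_comp (@measurable_sin R)); exact: measurable_funM.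
- by move=> y; exact: sin_max.
rewrite bump_sin.
have -> : \int[mu]_(z in I) (bump n z * sin (l * - z)) = - 1 * sker n l.
  rewrite -bump_sin -RintegralZl//; last first.
    apply: (integrable_mul_bounded (K := 1) mI (ibump n)).
    - by apply: measurable_funTS; apply: (measurableT_comp (@measurable_sin R)); exact: measurable_funM.
    - by move=> z _; exact: sin_max.
  by apply: eq_Rintegral => z _; rewrite mulrN sinN; ring.
by ring.
Qed.

Let q0 (e l : R) : 0 < e -> 0 < e ^+ 2 + l ^+ 2.
Proof. by move=> e0; rewrite ltr_wpDr ?sqr_ge0// exprn_gt0. Qed.

Let sker_ge0 n l : 0 < l -> 0 <= sker n l.
Proof.
move=> l0; rewrite subr_ge0 ler_pM2l// lef_pV2 ?posrE ?q0 ?step_gt0// lerD2r.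
rewrite lerXn2r ?nnegrE ?(ltW (step_gt0 R n))//.
by rewrite (@le_trans _ _ 1)// ?invf_le1// ler1n.
Qed.

Let sker_le n l : 0 < l -> sker n l <= l^-1.
Proof.
move=> l0; rewrite (@le_trans _ _ (l / (step n ^+ 2 + l ^+ 2)))//.
  by rewrite gerBl divr_ge0 ?(ltW l0)// ltW// q0.
rewrite ler_pdivrMr ?q0 ?step_gt0// mulrDr -[leLHS]add0r lerD//.
  by rewrite mulr_ge0 ?invr_ge0 ?(ltW l0)// sqr_ge0.
by rewrite expr2 mulKf// gt_eqF.
Qed.

Let isker n : mu.-integrable I (EFin \o (fun l => - 2 * sker n l)).
Proof.
have iq : mu.-integrable I (EFin \o (fun l : R => (oneDsqr l)^-1)).
  exact: (integrableS measurableT mI (@subsetT _ _) (integrable_oneDsqrV R)).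
have iq' := integrableZl mI (n.+1%:R ^+ 3) iq.
apply: (@integrable_dominated _ (measurableTypeR R) R mu I _ _ _ _ _ iq') => //.
  apply: measurable_funTS; apply: measurable_funM => //.
  have mq (e : R) : 0 < e -> measurable_fun setT (fun l : R => l / (e ^+ 2 + l ^+ 2)).
    move=> e0; apply: continuous_measurable_fun => l.
    have d0 : e ^+ 2 + l ^+ 2 != 0 by rewrite gt_eqF ?q0.
    by apply: is_derive_continuous; apply: is_derive_eq; reflexivity.
  by apply: measurable_funB; apply: mq; rewrite ?step_gt0.
move=> l /halfline_gt0 l0; have n0 : (0 : R) < n.+1%:R by [].
have n1 : (1 : R) <= n.+1%:R by rewrite ler1n.
set N := n.+1%:R in n0 n1 *.
rewrite normrM normrN (ger0_norm (sker_ge0 n l0)) (ger0_norm (ler0n _ 2)) /oneDsqr.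
have D1 : 0 < N^-1 ^+ 2 + l ^+ 2 by rewrite q0// invr_gt0.
have D2 : 0 < N ^+ 2 + l ^+ 2 by rewrite q0.
have D3 : 0 < 1 + l ^+ 2 by rewrite ltr_wpDr ?sqr_ge0.
have -> : 2 * sker n l =
    (2 * (N^-1 * l) / (N^-1 ^+ 2 + l ^+ 2)) * (N * (N ^+ 2 - N^-1 ^+ 2) / (N ^+ 2 + l ^+ 2)).
  have sE (M e : R) : M * e = 1 -> M ^+ 2 + l ^+ 2 != 0 -> e ^+ 2 + l ^+ 2 != 0 ->
      2 * (l / (e ^+ 2 + l ^+ 2) - l / (M ^+ 2 + l ^+ 2)) =
      (2 * (e * l) / (e ^+ 2 + l ^+ 2)) * (M * (M ^+ 2 - e ^+ 2) / (M ^+ 2 + l ^+ 2)).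
    move=> Me h1 h2.
    transitivity ((M * e) * (2 * (l / (e ^+ 2 + l ^+ 2) - l / (M ^+ 2 + l ^+ 2)))).
      by rewrite Me mul1r.
    by field; rewrite h1 h2.
  by apply: sE; rewrite ?mulfV ?gt_eqF.
rewrite -[leRHS]mul1r ler_pM//.
- by rewrite divr_ge0 ?(ltW D1)// !mulr_ge0 ?invr_ge0 ?(ltW n0) ?(ltW l0).
- rewrite divr_ge0 ?(ltW D2)// mulr_ge0 ?(ltW n0)// subr_ge0.
  by rewrite lerXn2r ?nnegrE ?invr_ge0 ?(ltW n0)// (@le_trans _ _ 1)// invf_le1.
- rewrite ler_pdivrMr// mul1r -subr_ge0.
  have -> : N^-1 ^+ 2 + l ^+ 2 - 2 * (N^-1 * l) = (N^-1 - l) ^+ 2 by ring.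
  exact: sqr_ge0.
- rewrite ler_pM ?invr_ge0 ?(ltW D2)//.
  + rewrite mulr_ge0 ?(ltW n0)// subr_ge0.
    by rewrite lerXn2r ?nnegrE ?invr_ge0 ?(ltW n0)// (@le_trans _ _ 1)// invf_le1.
  + by rewrite exprS ler_pM2l// gerBl sqr_ge0.
  + rewrite lef_pV2 ?posrE// lerD2r -[leLHS](expr1n _ 2).
    by rewrite lerXn2r ?nnegrE ?(ltW n0).
Qed.

Let phis (l : R) := expR (- (l `^ alpha * cos theta)) * sin (l `^ alpha * sin theta).

Let parseval_odd n : pi * \int[mu]_x (f x * odd n x) =
  \int[mu]_(l in I) (- 2 * (sker n l * phis l)).
Proof.
have i0 : mu.-integrable I (EFin \o (fun _ : R => 0 : R)) by exact: integrable0.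
have mid : measurable_fun setT (@id R) by [].
rewrite (parseval fi mid (@codd n) (@odd_le n) (iodd n) (fun l _ => odd_cos n l)
  (fun l _ => odd_sin n l) i0 (isker n)).
apply: eq_Rintegral => l /set_mem /halfline_gt0 l0.
have [_ ->] := stable_ecos_esin halpha hf (ltW l0).
by rewrite mul0r add0r -/(phis l); ring.
Qed.

Let sker_cvg l : 0 < l -> sker n l @[n --> \oo] --> l^-1.
Proof.
move=> l0; have -> : l^-1 = l / (0 ^+ 2 + l ^+ 2) - 0.
  by rewrite expr0n/= add0r subr0 expr2 invfM mulVKf// gt_eqF.
rewrite /sker; apply: cvgB.
  apply: cvgM; first exact: cvg_cst.
  apply: cvgV; first by rewrite expr0n add0r gt_eqF// exprn_gt0.
  apply: cvgD; last exact: cvg_cst.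
  by rewrite expr2; under eq_fun do rewrite expr2; apply: cvgM; exact: cvg_harmonic.
apply: (@cvg0_dominated _ _ _ _ _ (fun n => l * step n)).
  apply: nearW => n; have n0 : (0 : R) < n.+1%:R by [].
  rewrite ger0_norm ?divr_ge0 ?(ltW l0) ?(ltW (q0 _ _))// ler_pM2l// lef_pV2 ?posrE ?q0//.
  rewrite -[leLHS]addr0 lerD ?sqr_ge0// expr2 ler_peMr ?(ltW n0)//.
  by rewrite ler1n.
by rewrite -[X in _ --> X](mulr0 l); apply: cvgM; [exact: cvg_cst|exact: cvg_harmonic].
Qed.

Let odd_cvg x : odd n x @[n --> \oo] --> - Num.sg x.
Proof.
have bc (z : R) : 0 < z -> bump n z @[n --> \oo] --> (1 : R).
  move=> z0; have -> : (1 : R) = expR (- (0 * z)) - 0 by rewrite mul0r oppr0 expR0 addr0.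
  under eq_fun do rewrite bump_pos//.
  apply: cvgB.
    apply: (@cvg_comp _ _ _ (fun n => step n) (fun e => expR (- (e * z))) _ (nbhs (0 : R))).
      exact: cvg_harmonic.
    have : {for 0, continuous (fun e : R => expR (- (e * z)))}.
      by apply: is_derive_continuous; apply: is_derive_eq; reflexivity.
    by [].
  have := @cvg_expR_scale R z z0 => /(cvg_pinftyP _ _).1 /(_ (fun n => n.+1%:R)).
  under [X in _ -> X @ _ --> _]eq_fun do rewrite mulrC.
  apply; have := @cvgr_idn R; rewrite -(cvg_shiftn 1).
  by under eq_fun do rewrite addn1.
rewrite /odd; have [x0|x0|->] := ltgtP x 0.
- rewrite ltr0_sg// opprK -[X in _ --> X]subr0; apply: cvgB.
    by apply: bc; rewrite oppr_gt0.
  by under eq_fun do rewrite bump_neg ?(ltW x0)//; exact: cvg_cst.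
- rewrite gtr0_sg// -[X in _ --> X]sub0r; apply: cvgB; last exact: bc.
  by under eq_fun do rewrite bump_neg ?oppr_le0 ?(ltW x0)//; exact: cvg_cst.
- rewrite sgr0 oppr0; apply: cvg_near_cst; apply: nearW => n; exact: subrr.
Qed.

Let msg : measurable_fun setT (fun x : R => - Num.sg x).
Proof.
apply: (@measurable_fun_cvg _ _ _ _ (fun n => odd n)) => [n|x _]; last exact: odd_cvg.
by apply: continuous_measurable_fun; exact: codd.
Qed.

Let sign_mean : pi * \int[mu]_x (f x * - Num.sg x) = - 2 * (theta / alpha).
Proof.
have [iarc arcE] := angle_integral a0 (stable_angle_bound halpha hbeta).
have lim1 : pi * \int[mu]_x (f x * odd n x) @[n --> \oo] --> pi * \int[mu]_x (f x * - Num.sg x).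
  apply: cvgM; first exact: cvg_cst.
  apply: (@Rintegral_cvg _ (measurableTypeR R) R mu setT (fun n x => f x * odd n x) _ f) => //.
  - move=> n; apply: measurable_funM; first exact: (measurable_density hf).
    by apply: continuous_measurable_fun; exact: codd.
  - by move=> x _; apply: cvgM; [exact: cvg_cst|exact: odd_cvg].
  - by move=> n x _; rewrite normrM ger0_norm ?(density_ge0 hf)// ler_piMr ?(density_ge0 hf).
have lim2 : \int[mu]_(l in I) (- 2 * (sker n l * phis l)) @[n --> \oo] -->
    \int[mu]_(l in I) (- 2 * (phis l / l)).
  have iabs := integrableZl mI 2 (integrable_abse iarc).
  apply: (@Rintegral_cvg _ (measurableTypeR R) R mu I (fun n l => - 2 * (sker n l * phis l)) _
    (fun l => 2 * `|phis l / l|)) => //.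
  - move=> n.
    have mphis : measurable_fun setT phis.
      have mr : measurable_fun setT (fun l : R => l `^ alpha) by exact: measurable_powR.
      apply: measurable_funM.
        by do 2 apply: measurableT_comp => //; exact: measurable_funM.
      by apply: (measurableT_comp (@measurable_sin R)); exact: measurable_funM.
    have -> : (fun l => - 2 * (sker n l * phis l)) = (fun l => (- 2 * sker n l) * phis l).
      by apply/funext => l; rewrite mulrA.
    apply: measurable_funM; last exact: measurable_funTS.
    by apply/measurable_EFinP; case/integrableP: (isker n).
  - move=> l /halfline_gt0 l0; apply: cvgM; first exact: cvg_cst.
    by rewrite [X in _ --> X]mulrC; apply: cvgM; [exact: sker_cvg|exact: cvg_cst].
  - move=> n l /halfline_gt0 l0; rewrite normrM normrN (ger0_norm (ler0n _ 2)) ler_pM2l//.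
    rewrite normrM [leRHS]normrM [leRHS]mulrC ler_wpM2r//.
    rewrite (ger0_norm (sker_ge0 n l0)) ger0_norm ?invr_ge0 ?(ltW l0)//.
    exact: sker_le.
have -> : - 2 * (theta / alpha) = \int[mu]_(l in I) (- 2 * (phis l / l)).
  by rewrite -arcE -RintegralZl.
move: lim1; under eq_fun do rewrite parseval_odd.
by move=> lim1; apply: (cvg_unique _ lim1 lim2) => //.
Qed.

(** Parseval for the odd approximations [odd n] of [- sg] turns the expectation of
    [- sg] into the integral of [angle_integral] as [sker n l] increases to [1 / l].
    The mass of the negative half-line follows since points are null. *)
Lemma stable_cdf_step_cvg :
  stable_cdf f (- step n) @[n --> \oo] --> 2^-1 - theta / (pi * alpha).
Proof.
have pin0 : (pi : R) != 0 by rewrite gt_eqF ?pi_gt0.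
have mneg : measurable_fun setT (fun z : R => (z < 0)%R%:R : R).
  have -> : (fun z : R => (z < 0)%R%:R : R) = \1_(`]-oo, 0[%classic : set R).
    apply/funext => z; rewrite indicE (_ : (z \in _) = (z < 0))//.
    by apply/idP/idP; rewrite inE/= in_itv.
  exact: measurable_indic.
have lim : stable_cdf f (- step n) @[n --> \oo] --> \int[mu]_z (f z * (z < 0)%R%:R).
  apply: (@Rintegral_cvg _ (measurableTypeR R) R mu setT
    (fun n z => f z * \1_(`]-oo, - step n]%classic) z) _ f) => //.
  - by move=> n; apply: measurable_funM; [exact: (measurable_density hf)|exact: measurable_indic].
  - move=> z _; apply: cvgM; first exact: cvg_cst.
    under eq_fun do rewrite indic_ray.
    have [z0|z0] := ltP z 0.
      apply: cvg_near_cst; near=> n.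
      have -> : z <= - step n; last by [].
      rewrite lerNr ltW// -[ltRHS]invrK ltf_pV2 ?posrE ?invr_gt0 ?oppr_gt0//.
      rewrite (@lt_trans _ _ n%:R)// ?ltr_nat//.
      by near: n; exact: nbhs_infty_gtr.
    apply: cvg_near_cst; apply: nearW => n.
    have -> : (z <= - step n) = false; last by [].
    by apply/negbTE; rewrite -ltNge (lt_le_trans _ z0)// oppr_lt0 step_gt0.
  - move=> n z _; rewrite indic_ray normrM ger0_norm ?(density_ge0 hf)//.
    by rewrite ler_piMr ?(density_ge0 hf)// ger0_norm// lern1 leq_b1.
have <- : \int[mu]_z (f z * (z < 0)%R%:R) = 2^-1 - theta / (pi * alpha); last exact: lim.
have null : \int[mu]_z (f z * \1_([set 0] : set R) z) = 0.
  rewrite -[RHS](Rintegral_set1 f 0) [RHS]Rintegral_mkcond.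
  by apply: eq_Rintegral => z _; rewrite patch_indic.
have isg : mu.-integrable setT (EFin \o (fun x => f x * - Num.sg x)).
  apply: (integrable_mul_bounded (K := 1)) => // x _.
  by rewrite normrN normr_sg; case: (_ == _).
have i0 : mu.-integrable setT (EFin \o (fun z => f z * \1_([set 0] : set R) z)).
  apply: (integrable_mul_bounded (K := 1)) => // x _.
  by rewrite indicE ger0_norm// lern1 leq_b1.
have h (z : R) : f z * (z < 0)%R%:R =
    2^-1 * f z + 2^-1 * (f z * - Num.sg z) - 2^-1 * (f z * \1_([set 0] : set R) z).
  rewrite indicE; case: (ltgtP z 0) => [z0|z0|->].
  - by rewrite ltr0_sg// memNset//=; [field|move=> z1; move: z0; rewrite z1 ltxx].
  - by rewrite gtr0_sg// memNset//=; [field|move=> z1; move: z0; rewrite z1 ltxx].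
  - by rewrite sgr0 mem_set//=; field.
under eq_Rintegral do rewrite h.
have j1 := integrableZl measurableT 2^-1 fi.
have j2 := integrableZl measurableT 2^-1 isg.
have j3 := integrableZl measurableT 2^-1 i0.
rewrite RintegralB//; last exact: (integrableD measurableT j1 j2).
rewrite RintegralD// !RintegralZl// null mulr0 subr0 (Rintegral_density hf) mulr1.
have -> : \int[mu]_z (f z * - Num.sg z) = - 2 * (theta / alpha) / pi.
  by rewrite -sign_mean mulrAC mulfV ?mul1r.
have al0 : alpha != 0 by rewrite gt_eqF.
move: (pi : R) theta pin0 => P th P0.
by field; rewrite P0 al0.
Unshelve. all: by end_near. Qed.

Lemma stable_cdfy_cvg : stable_cdf f n%:R @[n --> \oo] --> (1 : R).
Proof.
rewrite -[X in _ --> X](Rintegral_density hf).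
apply: (@Rintegral_cvg _ (measurableTypeR R) R mu setT
  (fun n z => f z * \1_(`]-oo, n%:R]%classic) z) _ f) => //.
- by move=> n; apply: measurable_funM; [exact: (measurable_density hf)|exact: measurable_indic].
- move=> z _; apply: cvg_near_cst; near=> n; rewrite indic_ray.
  have -> : z <= n%:R; last by rewrite mulr1.
  by apply: ltW; near: n; exact: nbhs_infty_gtr.
- move=> n z _; rewrite indic_ray normrM ger0_norm ?(density_ge0 hf)//.
  by rewrite ler_piMr ?(density_ge0 hf)// ger0_norm// lern1 leq_b1.
Unshelve. all: by end_near. Qed.

End Positivity.

(** * Duhamel's formula *)

Section Duhamel.
Context (R : realType) (alpha beta : R) (f : R -> R).
Notation mu := (@lebesgue_measure R).
Hypotheses (halpha : 0 < alpha < 2) (hbeta : -1 < beta < 1).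
Hypothesis hf : is_stable_density alpha beta f.
Let fi : mu.-integrable setT (EFin \o f) := integrable_density hf.
Let mf : measurable_fun setT f := measurable_density hf.

Let mscale (t x : R) : measurable_fun setT (fun z : R => x - t `^ alpha^-1 * z).
Proof. by apply: measurable_funB => //; exact: measurable_funM. Qed.

Lemma integrable_stable_mean (t x C : R) (phi : R -> R) :
  measurable_fun setT phi -> (forall y, `|phi y| <= C) ->
  mu.-integrable setT (EFin \o (fun z => f z * phi (x - t `^ alpha^-1 * z))).
Proof.
move=> mphi phiC; apply: (integrable_mul_bounded (K := C)) => //.
exact: (measurableT_comp mphi (mscale t x)).
Qed.

Lemma stable_mean_norm_le (t x C : R) (phi : R -> R) :
  measurable_fun setT phi -> (forall y, `|phi y| <= C) -> `|stable_mean alpha f t phi x| <= C.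
Proof.
move=> mphi phiC; have ip := integrable_stable_mean t x mphi phiC.
rewrite /stable_mean (le_trans (le_normr_Rintegral _ ip))//.
rewrite -[leRHS]mulr1 -(Rintegral_density hf) -RintegralZl//.
apply: le_Rintegral => //.
- exact: (integrable_norm ip).
- exact: (integrableZl measurableT C fi).
- move=> z _; rewrite normrM ger0_norm ?(density_ge0 hf)// mulrC.
  by rewrite ler_wpM2r ?(density_ge0 hf).
Qed.

Context (u0 : R -> R) (G u : R -> R -> R) (K0 K : R).
Hypotheses (cu0 : continuous u0) (u0K : forall y, `|u0 y| <= K0).
Hypotheses (cG : forall s, 0 <= s -> continuous (G s))
  (GK : forall s y, 0 <= s -> `|G s y| <= K).
Hypothesis tG : forall s y, 0 <= s -> forall e, 0 < e -> exists2 dl, 0 < dl &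
  forall s', 0 <= s' -> `|s - s'| < dl -> `|G s y - G s' y| < e.
Notation S := (stable_mean alpha f).
Hypothesis uE : forall t x, 0 <= t ->
  u t x = S t u0 x + \int[mu]_(s in `[0, t]) S (t - s) (G s) x.

Let mG : measurable_fun setT (fun p : R * R => G `|p.1| p.2).
Proof.
apply: measurable_caratheodory => // x x0.
by apply: continuous_measurable_fun; exact: cG.
Qed.

Let F (t x s z : R) : R := f z * G `|s| (x - (t - s) `^ alpha^-1 * z).

Let mF3 t : measurable_fun setT (fun q : R * R * R => F t q.1.1 q.1.2 q.2).
Proof.
have m11 : measurable_fun setT (fun q : R * R * R => q.1.1).
  exact: (measurableT_comp measurable_fst measurable_fst).
have m12 : measurable_fun setT (fun q : R * R * R => q.1.2).
  exact: (measurableT_comp measurable_snd measurable_fst).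
have mr : measurable_fun setT (fun l : R => l `^ alpha^-1) by exact: measurable_powR.
have mp : measurable_fun setT (fun q : R * R * R => (t - q.1.2) `^ alpha^-1).
  by apply: (measurableT_comp mr); apply: measurable_funB.
apply: measurable_funM; first exact: (measurableT_comp mf measurable_snd).
have mpair : measurable_fun setT
    (fun q : R * R * R => (q.1.2, q.1.1 - (t - q.1.2) `^ alpha^-1 * q.2)).
  apply: measurable_fun_pair => //; apply: measurable_funB => //.
  by apply: measurable_funM => //; exact: measurable_snd.
exact: (measurableT_comp mG mpair).
Qed.

Let mF t x : measurable_fun setT (fun p : R * R => F t x p.1 p.2).
Proof.
have mpair : measurable_fun setT (fun p : R * R => (x, p.1, p.2)).
  apply: measurable_fun_pair; last exact: measurable_snd.
  by apply: measurable_fun_pair => //; exact: measurable_fst.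
exact: (measurableT_comp (mF3 t) mpair).
Qed.

Let F_le t x s z : `|F t x s z| <= K * f z.
Proof.
rewrite normrM ger0_norm ?(density_ge0 hf)// mulrC ler_wpM2r ?(density_ge0 hf)//.
exact: GK.
Qed.

Let J (t x s : R) := \int[mu]_z F t x s z.

Let JE t x s : 0 <= s -> J t x s = S (t - s) (G s) x.
Proof. by move=> s0; apply: eq_Rintegral => z _; rewrite /F ger0_norm. Qed.

Let mJ t x : measurable_fun setT (J t x).
Proof. by apply: (@measurable_Rintegral _ _ (measurableTypeR R) _ R mu) => //; exact: mF. Qed.

Let iF t x s : mu.-integrable setT (EFin \o F t x s).
Proof.
have iK := integrableZl measurableT K fi.
apply: (@integrable_dominated _ (measurableTypeR R) R mu _ _ _ _ _ _ iK) => //.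
exact: (measurableT_comp (mF t x) (pair1_measurable s)).
Qed.

Let J_le t x s : `|J t x s| <= K.
Proof.
rewrite /J (le_trans (le_normr_Rintegral _ (iF t x s)))//.
rewrite -[leRHS]mulr1 -(Rintegral_density hf) -RintegralZl//.
by apply: le_Rintegral => //; [exact: integrable_norm (iF t x s)|exact: (integrableZl measurableT K fi)].
Qed.

Let icst (a b : R) : mu.-integrable `[a, b]%classic (EFin \o (fun _ : R => K)).
Proof.
apply: continuous_compact_integrable; first exact: segment_compact.
by apply: continuous_subspaceT => x; exact: cvg_cst.
Qed.

Let iJ t x (a b : R) : mu.-integrable `[a, b]%classic (EFin \o J t x).
Proof.
apply: (@integrable_dominated _ (measurableTypeR R) R mu _ _ _ _ _ _ (icst a b)) => //.
exact: (measurable_funS measurableT _ (mJ t x)).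
Qed.

Lemma integrable_duhamel t x (r : R) : 0 <= r ->
  mu.-integrable `[r, t]%classic (EFin \o (fun s => S (t - s) (G s) x)).
Proof.
move=> r0; have := iJ t x r t; apply: eq_integrable => // s.
by rewrite inE/= in_itv/= => /andP[rs _]; rewrite JE// (le_trans r0).
Qed.

(** The semigroup law carries both the initial datum and the forcing before time [r]
    from [r] to [t]; the integral over past times and the average over the kernel are
    exchanged by Fubini, which is where joint measurability of [G] enters. *)
Lemma duhamel_restart (r t x : R) : 0 <= r <= t ->
  u t x = S (t - r) (u r) x + \int[mu]_(s in `[r, t]) S (t - s) (G s) x.
Proof.
move=> /andP[r0 rt]; have t0 := le_trans r0 rt.
have tr0 : 0 <= t - r by rewrite subr_ge0.
pose c := (t - r) `^ alpha^-1.
have uJ (q y : R) : 0 <= q -> u q y = S q u0 y + \int[mu]_(s in `[0, q]) J q y s.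
  move=> q0; rewrite (uE y q0).
  have -> // : \int[mu]_(s in `[0, q]) S (q - s) (G s) y = \int[mu]_(s in `[0, q]) J q y s.
  by apply: eq_Rintegral => s; rewrite inE/= in_itv/= => /andP[s0 _]; rewrite JE.
have -> : \int[mu]_(s in `[r, t]) S (t - s) (G s) x = \int[mu]_(s in `[r, t]) J t x s.
  apply: eq_Rintegral => s; rewrite inE/= in_itv/= => /andP[rs _].
  by rewrite JE// (le_trans r0).
rewrite (uJ t x t0).
have split0 : \int[mu]_(s in `[0, t]) J t x s =
    \int[mu]_(s in `[0, r]) J t x s + \int[mu]_(s in `[r, t]) J t x s.
  rewrite -(@Rintegral_itv_obnd_cbnd _ r (BRight t)); last first.
    have sub : `]r, t]%classic `<=` (`[r, t]%classic : set R).
      by move=> s /=; rewrite !in_itv/= => /andP[/ltW -> ->].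
    have m1 : measurable (`[r, t]%classic : set R) by [].
    have m2 : measurable (`]r, t]%classic : set R) by [].
    exact: (@integrableS _ (measurableTypeR R) R mu _ _ _ m1 m2 sub (iJ t x r t)).
  by rewrite -(Rintegral_itvB (iJ t x 0 t)) ?bnd_simp// addrC subrK.
rewrite split0 addrA; congr (_ + _).
rewrite {2}/stable_mean.
have mu0 : measurable_fun setT u0 by exact: continuous_measurable_fun.
have mS : measurable_fun setT (S r u0).
  apply: (@measurable_Rintegral _ _ (measurableTypeR R) _ R mu _
    (fun y z => f z * u0 (y - r `^ alpha^-1 * z))) => //.
  apply: measurable_funM; first exact: (measurableT_comp mf measurable_snd).
  apply: (measurableT_comp mu0); apply: measurable_funB; first exact: measurable_fst.
  by apply: measurable_funM => //; exact: measurable_snd.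
have mc : measurable_fun setT (fun z : R => x - c * z).
  by apply: measurable_funB => //; exact: measurable_funM.
have iz1 : mu.-integrable setT (EFin \o (fun z => f z * S r u0 (x - c * z))).
  apply: (integrable_mul_bounded (K := K0)) => //; first exact: (measurableT_comp mS mc).
  move=> z _; exact: stable_mean_norm_le.
have mH : measurable_fun setT (fun p : R * R => f p.1 * J r (x - c * p.1) p.2).
  apply: measurable_funM; first exact: (measurableT_comp mf measurable_fst).
  have mJ2 : measurable_fun setT (fun p : R * R => \int[mu]_w F r p.1 p.2 w).
    by apply: (@measurable_Rintegral _ _ _ _ R mu _ (fun (p : R * R) w => F r p.1 p.2 w)) => //; exact: mF3.
  have mpair : measurable_fun setT (fun p : R * R => (x - c * p.1, p.2)).
    apply: measurable_fun_pair; last exact: measurable_snd.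
    exact: (measurableT_comp mc measurable_fst).
  exact: (measurableT_comp mJ2 mpair).
have HG z s : setT z -> `[0, r]%classic s -> `|f z * J r (x - c * z) s| <= f z * K.
  by move=> _ _; rewrite normrM ger0_norm ?(density_ge0 hf)// ler_wpM2l ?(density_ge0 hf).
have m0r : measurable (`[0, r]%classic : set R) by [].
have iz2 := @integrable_section _ _ (measurableTypeR R) (measurableTypeR R) R mu mu setT `[0, r]%classic
  (fun z s => f z * J r (x - c * z) s) f (fun _ => K) measurableT m0r mH fi (icst 0 r) HG.
have EX := @Rintegral_exchange _ _ (measurableTypeR R) (measurableTypeR R) R mu mu setT `[0, r]%classic
  (fun z s => f z * J r (x - c * z) s) f (fun _ => K) measurableT m0r mH fi (icst 0 r) HG.
have -> : \int[mu]_(s in `[0, r]) J t x s =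
    \int[mu]_(s in `[0, r]) \int[mu]_z (f z * J r (x - c * z) s).
  apply: eq_Rintegral => s; rewrite inE/= in_itv/= => /andP[s0 sr].
  have rs0 : 0 <= r - s by rewrite subr_ge0.
  rewrite (JE t x s0).
  have -> : t - s = (t - r) + (r - s) by rewrite addrA subrK.
  rewrite -(@stable_mean_add _ _ _ _ halpha hf _ _ K x (G s) tr0 rs0 (cG s0) (fun y => GK y s0)).
  by apply: eq_Rintegral => z _; rewrite (JE r _ s0).
rewrite -EX.
have -> : S t u0 x = S (t - r) (S r u0) x.
  by rewrite (@stable_mean_add _ _ _ _ halpha hf _ _ K0 x u0 tr0 r0 cu0 u0K) subrK.
pose Q z := \int[mu]_(s in `[0, r]) J r (x - c * z) s.
have QE : (fun z => \int[mu]_(s in `[0, r]) (f z * J r (x - c * z) s)) = (fun z => f z * Q z).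
  apply/funext => z; rewrite /Q; have h := iJ r (x - c * z) 0 r.
  exact: (@RintegralZl _ (measurableTypeR R) R mu _ _ (f z) m0r h).
rewrite QE in iz2 *.
have <- := @RintegralD _ (measurableTypeR R) R mu _ _ _ measurableT iz1 iz2.
apply: eq_Rintegral => z _.
by rewrite (uJ r _ r0) mulrDr.
Qed.

End Duhamel.

(** * Comparison estimates for mild solutions *)

Section MildSolution.
Context (R : realType) (alpha beta : R) (f : R -> R).
Notation mu := (@lebesgue_measure R).
Hypotheses (halpha : 0 < alpha < 2) (hbeta : -1 < beta < 1).
Hypothesis hf : is_stable_density alpha beta f.
Context (g u0 : R -> R) (u : R -> R -> R).
Hypothesis cg : {within `[0, 1], continuous g}.
Hypothesis g_ge0 : forall z, 0 <= z <= 1 -> 0 <= g z.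
Hypotheses (cu0 : continuous u0) (u0_01 : forall x, 0 <= u0 x <= 1).
Hypothesis hu : mild_solution alpha f g u0 u.
Hypothesis u_01 : forall t x, 0 <= t -> 0 <= u t x <= 1.
Notation S := (stable_mean alpha f).

Let cu s : 0 <= s -> continuous (u s).
Proof. by case: hu => + _ _ => /[apply] -[]. Qed.

Let unif_le (s e : R) : 0 <= s -> 0 < e -> exists2 dl, 0 < dl &
  forall s', 0 <= s' -> `|s - s'| < dl -> forall y, `|u s y - u s' y| < e.
Proof.
move=> s0 e0; case: hu => _ /subspace_continuousP ct _.
have s0' : `[0, +oo[%classic s by rewrite /= in_itv/= s0.
have N : nbhs (u s : {uniform R -> R}) [set h : {uniform R -> R} | forall y, `|u s y - h y| < e].
  apply/uniform_nbhs; exists [set p : R * R | `|p.1 - p.2| < e]; split.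
    exact: entourage_ball (PosNum e0).
  by move=> h /= H y; exact: H.
have := ct s s0' _ N; rewrite /nbhs/= /within/= => -[dl dl0 H].
exists dl => // s' s'0 ss' y.
by apply: (H s') => //=; rewrite in_itv/= s'0.
Qed.

Let gcont z : 0 <= z <= 1 -> forall e, 0 < e -> exists2 dl, 0 < dl &
  forall z', 0 <= z' <= 1 -> `|z - z'| < dl -> `|g z - g z'| < e.
Proof.
move=> z01 e e0; move/subspace_continuousP : cg => /(_ z); rewrite /= in_itv/= => /(_ z01).
move=> /cvgrPdist_lt /(_ e e0); rewrite near_withinE => -[dl dl0 H].
by exists dl => // z' z'01 zz'; apply: (H z') => //=; rewrite in_itv.
Qed.

Let cG s : 0 <= s -> continuous (g \o u s).
Proof.
move=> s0 y; apply/cvgrPdist_lt => e e0.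
have [dl dl0 H] := gcont (u_01 y s0) e0.
have cs : continuous (u s) := cu s0.
have := cs y => /cvgrPdist_lt /(_ dl dl0); apply: filterS => y' yy'.
exact: (H _ (u_01 y' s0) yy').
Qed.

Let tG s y : 0 <= s -> forall e, 0 < e -> exists2 dl, 0 < dl &
  forall s', 0 <= s' -> `|s - s'| < dl -> `|(g \o u s) y - (g \o u s') y| < e.
Proof.
move=> s0 e e0; have [dl dl0 H] := gcont (u_01 y s0) e0.
have [dl' dl'0 H'] := unif_le s0 dl0.
by exists dl' => // s' s'0 ss'; apply: H; [exact: u_01|exact: H'].
Qed.

Let Gbound : exists K, forall s y, 0 <= s -> `|(g \o u s) y| <= K.
Proof.
have [c c01 gc] := EVT_max (@ler01 R) cg.
exists (g c) => s y s0 /=; rewrite ger0_norm; last exact/g_ge0/u_01.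
by apply: gc; rewrite in_itv/=; exact: u_01.
Qed.

Let u0_le1 y : `|u0 y| <= 1.
Proof. by have /andP[h1 h2] := u0_01 y; rewrite ger0_norm. Qed.

Let u_le1 s y : 0 <= s -> `|u s y| <= 1.
Proof. by move=> s0; have /andP[h1 h2] := u_01 y s0; rewrite ger0_norm. Qed.

Let uE t x : 0 <= t -> u t x = S t u0 x + \int[mu]_(s in `[0, t]) S (t - s) (g \o u s) x.
Proof.
move=> t0; have [K GK] := Gbound; case: hu => _ _ -> //.
have -> : semigroup alpha f t u0 x = S t u0 x.
  apply: (semigroup_stable_mean halpha hf (K := 1)) => //.
  exact: continuous_measurable_fun.
congr (S t u0 x + _); apply: eq_Rintegral => s; rewrite inE/= in_itv/= => /andP[s0 st].
apply: (semigroup_stable_mean halpha hf (K := K)); first by rewrite subr_ge0.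
  by apply: continuous_measurable_fun; exact: cG.
by move=> y; exact: GK.
Qed.

Let restart r t x : 0 <= r <= t ->
  u t x = S (t - r) (u r) x + \int[mu]_(s in `[r, t]) S (t - s) (g \o u s) x.
Proof.
have [K GK] := Gbound.
exact: (duhamel_restart halpha hf cu0 u0_le1 cG GK tG uE).
Qed.

Let iforce r t x : 0 <= r -> mu.-integrable `[r, t] (EFin \o (fun s => S (t - s) (g \o u s) x)).
Proof.
have [K GK] := Gbound.
exact: (integrable_duhamel hf cG GK tG).
Qed.

Let mean_ge0 t x phi : (forall y, 0 <= phi y) -> 0 <= S t phi x.
Proof. by move=> h; apply: Rintegral_ge0 => z _; rewrite mulr_ge0 ?(density_ge0 hf). Qed.

Let gu_ge0 s y : 0 <= s -> 0 <= (g \o u s) y. Proof. by move=> s0; exact/g_ge0/u_01. Qed.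

Let force_ge0 r t x : 0 <= r -> 0 <= \int[mu]_(s in `[r, t]) S (t - s) (g \o u s) x.
Proof.
move=> r0; apply: Rintegral_ge0 => s /=; rewrite in_itv/= => /andP[rs _].
by apply: mean_ge0 => y; apply: gu_ge0; exact: le_trans rs.
Qed.

(** As the forcing is nonnegative, [s |-> S (t - s) (u s)] is nondecreasing. *)
Lemma mild_ge_mean r t x : 0 <= r <= t -> S (t - r) (u r) x <= u t x.
Proof.
move=> rt; rewrite (restart x rt) lerDl; apply: force_ge0.
by case/andP: rt.
Qed.

Lemma mild_ge_force r t x : 0 <= r <= t ->
  \int[mu]_(s in `[r, t]) S (t - s) (g \o u s) x <= u t x.
Proof.
move=> rt; rewrite (restart x rt) lerDr; apply: mean_ge0 => y.
by have /andP[] := u_01 y (proj1 (andP rt)).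
Qed.

Lemma mild_ge_initial t x : 0 <= t -> S t u0 x <= u t x.
Proof. by move=> t0; rewrite (uE x t0) lerDl; exact: force_ge0. Qed.

(** Logistic growth ahead of a front.  Where [y >= - L] the forcing dominates
    [k (b - u)]; averaging it with the kernel costs only the mass [1 - stable_cdf f M]
    coming from beyond [- L], and the averaged loss is at most [k] times the final value
    by [mild_ge_mean].  Comparing with the final value replaces a Gronwall argument. *)
Lemma mild_growth (r t k b L M x : R) : 0 <= r <= t -> 0 <= M -> 0 <= k -> 0 <= b ->
  (t - r) `^ alpha^-1 * M <= x + L ->
  (forall s y, r <= s <= t -> - L <= y -> k * (b - u s y) <= g (u s y)) ->
  k * (t - r) * (b * stable_cdf f M) <= u t x * (1 + k * (t - r)).
Proof.
move=> rt M0 k0 b0 ML H; have /andP[r0 rlet] := rt.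
pose W := k * (b * stable_cdf f M - u t x).
have key s : `[r, t]%classic s -> W <= S (t - s) (g \o u s) x.
  rewrite /= in_itv/= => /andP[rs st]; have s0 := le_trans r0 rs.
  have ts0 : 0 <= t - s by rewrite subr_ge0.
  have [K GK] := Gbound.
  have mus : measurable_fun setT (u s) by apply: continuous_measurable_fun; exact: cu.
  have mGs : measurable_fun setT (g \o u s) by apply: continuous_measurable_fun; exact: cG.
  have i1 := integrable_stable_indic hf (measurable_itv (`]-oo, M])).
  have i2 := integrable_stable_mean hf (t - s) x mus (fun y => u_le1 y s0).
  have i3 := integrable_stable_mean hf (t - s) x mGs (fun y => GK s y s0).
  have i1' := integrableZl measurableT (k * b) i1.
  have i2' := integrableZl measurableT k i2.
  apply: (@le_trans _ _ (k * b * stable_cdf f M - k * S (t - s) (u s) x)).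
    rewrite /W mulrBr mulrA lerD2l lerN2 ler_wpM2l//.
    by apply: mild_ge_mean; rewrite s0.
  rewrite /stable_cdf /stable_mean -!RintegralZl//.
  rewrite -RintegralB//; apply: le_Rintegral => //.
    exact: (integrableB measurableT i1' i2').
  move=> z _; rewrite indic_ray; set y := x - _ * z.
  rewrite !(mulrCA _ (f z)) -mulrBr ler_wpM2l ?(density_ge0 hf)//.
  have us0 : 0 <= u s y by have /andP[] := u_01 y s0.
  have [zM|zM] := leP z M; last first.
    rewrite mulr0 sub0r (@le_trans _ _ 0)// ?oppr_le0 ?mulr_ge0//.
    exact: gu_ge0.
  rewrite mulr1 -mulrBr; apply: H; first by rewrite rs st.
  rewrite /y lerBrDr addrC -lerBrDr opprK (le_trans _ ML)//.
  rewrite (@le_trans _ _ ((t - s) `^ alpha^-1 * M))//.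
    by rewrite ler_wpM2l ?powR_ge0.
  rewrite ler_wpM2r// ge0_ler_powR ?nnegrE ?invr_ge0 ?subr_ge0//.
  - by case/andP: halpha => /ltW.
  - by rewrite lerD2l lerN2.
have icst : mu.-integrable `[r, t]%classic (EFin \o (fun _ : R => W)).
  apply: continuous_compact_integrable; first exact: segment_compact.
  by apply: continuous_subspaceT => v; exact: cvg_cst.
have : W * (t - r) <= u t x.
  apply: le_trans (mild_ge_force x rt).
  rewrite (_ : W * (t - r) = \int[mu]_(s in `[r, t]) W).
    by apply: le_Rintegral => //; exact: iforce.
  rewrite Rintegral_cst//= lebesgue_measure_itv/= lte_fin.
  by move: rlet; rewrite le_eqVlt => /predU1P[->|->] //=; rewrite ltxx subrr.
rewrite /W => ?; lra.
Qed.

Lemma mild_initial_lower (b w t x y : R) : 0 < t -> 0 <= b -> (forall v, w <= v -> b <= u0 v) ->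
  t `^ alpha^-1 * y <= x - w -> b * stable_cdf f y <= u t x.
Proof.
move=> t0 b0 H yx; apply: le_trans (mild_ge_initial x (ltW t0)).
have i1 := integrable_stable_indic hf (measurable_itv (`]-oo, y])).
have mu0 : measurable_fun setT u0 by exact: continuous_measurable_fun.
have i2 := integrable_stable_mean hf t x mu0 u0_le1.
rewrite /stable_cdf /stable_mean -RintegralZl//; apply: le_Rintegral => //.
  exact: (integrableZl measurableT b i1).
move=> z _; rewrite indic_ray mulrCA ler_wpM2l ?(density_ge0 hf)//.
have [zy|zy] := leP z y; last by rewrite mulr0; case/andP: (u0_01 (x - t `^ alpha^-1 * z)).
rewrite mulr1; apply: H; rewrite lerBrDr addrC -lerBrDr (le_trans _ yx)//.
by rewrite ler_wpM2l ?powR_ge0.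
Qed.

End MildSolution.

(** * Propagation of lower bounds ahead of fronts *)

Section Fronts.
Context (R : realType) (alpha beta : R) (f : R -> R).
Hypotheses (halpha : 0 < alpha < 2) (hbeta : -1 < beta < 1).
Hypothesis hf : is_stable_density alpha beta f.
Context (g u0 : R -> R) (u : R -> R -> R).
Hypothesis cg : {within `[0, 1], continuous g}.
Hypothesis g_ge0 : forall z, 0 <= z <= 1 -> 0 <= g z.
Hypotheses (cu0 : continuous u0) (u0_01 : forall x, 0 <= u0 x <= 1).
Hypothesis u0_lim : u0 x @[x --> +oo] --> (1 : R).
Hypothesis hu : mild_solution alpha f g u0 u.
Hypothesis u_01 : forall t x, 0 <= t -> 0 <= u t x <= 1.

Let a0 : 0 < alpha. Proof. by case/andP: halpha. Qed.
Let growth := mild_growth halpha hf cg g_ge0 cu0 u0_01 hu u_01.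
Let initial := mild_initial_lower halpha hf cg g_ge0 cu0 u0_01 hu u_01.

(** The bounds are required ahead of all lines [x = - C t] at once, so that a bound used
    on a half-line can be improved on a smaller one. *)
Definition front_decay (q : R) := forall C, 0 < C -> exists k T, [/\ 0 < k, 1 <= T &
  forall t x, T <= t -> - (C * t) <= x -> k * t `^ (- q) <= u t x].

Definition front_level (a : R) := forall C, 0 < C -> exists2 T, 0 < T &
  forall t x, T <= t -> - (C * t) <= x -> a <= u t x.

Lemma powR_sublinear (p M C : R) : p < 1 -> 0 <= M -> 0 < C ->
  exists2 T, 1 <= T & forall t, T <= t -> M * t `^ p <= C * t.
Proof.
move=> p1 M0 C0; exists (Num.max 1 ((M / C) `^ (1 - p)^-1)); first by rewrite le_max lexx.
move=> t; rewrite ge_max => /andP[t1 tT]; have t0 : 0 < t by exact: lt_le_trans t1.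
have q0 : 0 < 1 - p by rewrite subr_gt0.
have MC : M / C <= t `^ (1 - p).
  have -> : M / C = ((M / C) `^ (1 - p)^-1) `^ (1 - p).
    by rewrite -powRrM mulVf ?gt_eqF// powRr1// divr_ge0// ltW.
  by rewrite ge0_ler_powR ?nnegrE ?powR_ge0 ?(ltW q0) ?(ltW t0).
have tE : t = t `^ (1 - p) * t `^ p.
  by rewrite -powRD ?(gt_eqF t0) ?implybT// subrK powRr1// ltW.
by rewrite [in leRHS]tE mulrA ler_wpM2r ?powR_ge0// mulrC -ler_pdivrMr.
Qed.

Let initial_half_line b : b < 1 -> exists2 w, 0 < w & forall v, w <= v -> b <= u0 v.
Proof.
move=> b1; have : \forall x \near +oo, b <= u0 x.
  by apply: filterS (cvgr_gt _ u0_lim _ b1) => x /ltW.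
case=> w [_ H]; exists (Num.max w 0 + 1); first by rewrite ltr_wpDl// le_max lexx orbT.
move=> v wv; apply: H; apply: lt_le_trans wv.
by rewrite (@le_lt_trans _ _ (Num.max w 0))// ?le_max ?lexx// ltrDl.
Qed.

Let cdf_near1 e : 0 < e -> exists2 M, 0 <= M & 1 - e <= stable_cdf f M.
Proof.
move=> e0; have e1 : 1 - e < 1 by rewrite ltrBlDr ltrDl.
have [n _ H] := cvgr_gt _ (stable_cdfy_cvg hf) _ e1.
by exists n%:R => //; apply: ltW; apply: H => /=.
Qed.

(** To reach [x >= - C t] from the region where [u0] is close to one, the jump law must
    go at least [2 D t] to the left in time [t], which by the tail bound has
    probability at least of order [t ^ (1 - alpha)]. *)
Lemma initial_front_decay : 1 <= alpha -> front_decay (alpha - 1).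
Proof.
move=> a1 C C0.
have [c [y0 [c0 y00 tail]]] := stable_left_tail halpha hbeta hf (stable_tail_sign halpha hbeta a1).
have half1 : 2^-1 < 1 :> R by lra.
have [w w0 H] := initial_half_line half1.
pose D := Num.max C y0; have D0 : 0 < D by rewrite lt_max C0.
have CD : C <= D by rewrite le_max lexx.
have yD : y0 <= D by rewrite le_max lexx orbT.
exists (2^-1 * (c * (2 * D) `^ (- alpha))), (Num.max 1 (w / D)).
split; first by rewrite !mulr_gt0 ?powR_gt0 ?mulr_gt0.
  by rewrite le_max lexx.
move=> t x; rewrite ge_max => /andP[t1 wt] Cx.
have t0 : 0 < t by exact: lt_le_trans t1.
pose y := 2 * D * t `^ (1 - alpha^-1).
have ai1 : alpha^-1 <= 1 by rewrite invf_le1.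
have t1' : 1 <= t `^ (1 - alpha^-1).
  by rewrite -[leLHS](powRr0 t) ler_powR ?subr_ge0.
have y0y : y0 <= y.
  rewrite (le_trans yD)// /y -[leLHS]mulr1 ler_pM ?(ltW D0)//.
  by rewrite ler_peMl ?(ltW D0)// ler1n.
have le1 : t `^ alpha^-1 * - y <= x - w.
  have -> : t `^ alpha^-1 * - y = - (2 * D * t).
    rewrite /y mulrN mulrCA -powRD ?(gt_eqF t0) ?implybT//.
    by rewrite addrC subrK powRr1 ?(ltW t0).
  have h1 : w <= D * t by rewrite mulrC -ler_pdivrMr.
  have h2 : C * t <= D * t by rewrite ler_wpM2r ?(ltW t0).
  by rewrite -mulrA; lra.
apply: le_trans (initial t0 _ H le1); last by rewrite invr_ge0.
rewrite -!mulrA ler_wpM2l ?invr_ge0// mulrA (le_trans _ (tail _ y0y))//.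
rewrite -mulrA ler_wpM2l ?(ltW c0)// /y (powRM _ _ (powR_ge0 _ _)) ?mulr_ge0 ?(ltW D0)//.
rewrite -powRrM le_eqVlt; apply/orP; left; apply/eqP; congr (_ * t `^ _).
by field; rewrite gt_eqF.
Qed.

(** The spatial scale [t ^ (1 / alpha)] eventually exceeds every linear distance, so the
    datum looks like a unit step at the origin, whose value under the semigroup tends to
    the mass of the negative half-line. *)
Lemma initial_front_level : alpha < 1 -> forall a, 0 < a < (1 - beta) / 2 -> front_level a.
Proof.
move=> a1 a /andP[a_gt0 aL] C C0; set l := (1 - beta) / 2 in aL *.
have lE : 2^-1 - stable_angle alpha beta / (pi * alpha) = l.
  rewrite /stable_angle /skewness a1 /l.
  move: (pi_gt0 R); move: (pi : R) => P P0.
  by field; rewrite !gt_eqF.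
have m_lt : (a + l) / 2 < l by lra.
have cv := stable_cdf_step_cvg halpha hbeta hf; rewrite lE in cv.
have [n _ /(_ n (leqnn n)) Hn] := cvgr_gt _ cv _ m_lt.
pose b := 2 * a / (a + l).
have al0 : 0 < a + l by rewrite addr_gt0// (lt_trans a_gt0).
have b0 : 0 <= b by rewrite divr_ge0 ?(ltW al0)// mulr_ge0// ltW.
have b1 : b < 1 by rewrite /b ltr_pdivrMr// mul1r; lra.
have [w w0 H] := initial_half_line b1.
pose d : R := n.+1%:R^-1; have d0 : 0 < d by rewrite invr_gt0.
have [T T1 HT] := powR_sublinear a1 (ltW (mulr_gt0 (ltr0Sn _ 1) C0)) d0.
have T0 : 0 < T by exact: lt_le_trans T1.
exists (Num.max (T `^ alpha) (w / C)); first by rewrite lt_max powR_gt0.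
move=> t x; rewrite ge_max => /andP[Tt wt] Cx.
have t0 : 0 < t by apply: lt_le_trans Tt; rewrite powR_gt0.
have wt' : w <= C * t by rewrite mulrC -ler_pdivrMr.
have tT : T <= t `^ alpha^-1.
  have -> : T = (T `^ alpha) `^ alpha^-1 by rewrite -powRrM mulfV ?gt_eqF// powRr1// ltW.
  by rewrite ge0_ler_powR ?nnegrE ?invr_ge0 ?powR_ge0 ?(ltW a0) ?(ltW t0).
have := HT _ tT; rewrite -powRrM mulVf ?gt_eqF// powRr1 ?(ltW t0)// => Ct.
have le1 : t `^ alpha^-1 * - d <= x - w by rewrite mulrN mulrC; lra.
apply: le_trans (initial t0 b0 H le1).
have -> : a = b * ((a + l) / 2) by rewrite /b; field; rewrite gt_eqF.
by rewrite ler_wpM2l// ltW.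
Qed.

(** Improvement of the decay exponent: on a time interval of length comparable to
    [t] the reaction rate at height [t ^ (- q)] is [t ^ (- gam q)], so the solution
    climbs to any height [t ^ (- q')] with [q' >= gam q - 1]. *)
Lemma front_decay_improve (c0 gam q q' : R) : 1 < alpha -> 0 < c0 -> 0 < gam ->
  (forall z, 0 <= z <= 2^-1 -> c0 * z `^ gam <= g z) ->
  0 <= q -> 0 <= q' -> gam * q - 1 <= q' -> front_decay q -> front_decay q'.
Proof.
move=> a1 c00 gam0 gz q0 q'0 qq' Hq C C0.
have C40 : 0 < 4 * C by rewrite mulr_gt0.
have [k [T [k0 T1 HT]]] := Hq _ C40.
have half0 : (0 : R) < 2^-1 by rewrite invr_gt0.
have [M M0 cdfM] := cdf_near1 half0.
have ai1 : alpha^-1 < 1 by rewrite invf_lt1.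
have [T' T'1 HT'] := powR_sublinear ai1 M0 C0.
pose m := c0 * k `^ gam; have m0 : 0 < m by rewrite mulr_gt0 ?powR_gt0.
exists (m / (1 + m) / 4), (Num.max (2 * T) T').
split; first by rewrite !divr_gt0 ?addr_gt0.
  by rewrite le_max T'1 orbT.
move=> t x; rewrite ge_max => /andP[Tt T't] Cx.
have t1 : 1 <= t by exact: le_trans T't.
have t0 : 0 < t by exact: lt_le_trans t1.
pose b := 2^-1 * t `^ (- q'); have b0 : 0 < b by rewrite mulr_gt0 ?powR_gt0.
have b2 : b <= 2^-1.
  rewrite /b ger_pMr// -[leRHS](powRr0 t) ler_powR//.
  by rewrite oppr_le0.
pose a := k * t `^ (- q); have a_gt0 : 0 < a by rewrite mulr_gt0 ?powR_gt0.
pose kk := c0 * a `^ gam / b.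
have kk0 : 0 < kk by rewrite divr_gt0 ?mulr_gt0 ?powR_gt0.
have t2 : 0 <= t / 2 <= t by apply/andP; split; lra.
have ML : (t - t / 2) `^ alpha^-1 * M <= x + 2 * C * t.
  apply: (@le_trans _ _ (C * t)); last by rewrite -mulrA; lra.
  rewrite mulrC (le_trans _ (HT' _ T't))// ler_wpM2l//.
  by rewrite ge0_ler_powR ?nnegrE ?invr_ge0 ?(ltW a0)//; lra.
(* Before the value [b] is reached, [a <= u s y <= 1 / 2] and the power bound on [g]
   applies; above it the logistic term is negative. *)
have HG s y : t / 2 <= s <= t -> - (2 * C * t) <= y -> kk * (b - u s y) <= g (u s y).
  move=> /andP[s1 s2] Cy; have s0 : 0 < s by lra.
  have us := u_01 y (ltW s0); have /andP[us0 us1] := us.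
  have [bu|ub] := leP b (u s y).
    by rewrite (le_trans _ (g_ge0 us))// mulr_ge0_le0 ?(ltW kk0)// subr_le0.
  have au : a <= u s y.
    apply: le_trans (HT s y _ _); [|lra|].
      by rewrite /a ler_wpM2l ?(ltW k0)// !powRN lef_pV2 ?posrE ?powR_gt0// ge0_ler_powR ?nnegrE ?(ltW s0) ?(ltW t0).
    apply: le_trans Cy; rewrite lerN2 -!mulrA.
    have : C * t <= C * (2 * s) by rewrite ler_wpM2l ?(ltW C0)//; lra.
    by lra.
  apply: le_trans (gz _ _); last by rewrite us0 (le_trans (ltW ub)).
  apply: (@le_trans _ _ (kk * b)).
    by rewrite ler_wpM2l ?(ltW kk0)// gerBl.
  rewrite /kk divfK ?gt_eqF// ler_wpM2l ?(ltW c00)//.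
  by rewrite ge0_ler_powR ?nnegrE ?(ltW gam0) ?(ltW a_gt0).
have := growth t2 M0 (ltW kk0) (ltW b0) ML HG.
set K := kk * (t - t / 2) => G.
have Km : m <= K.
  have -> : K = m * t `^ (1 + q' - gam * q).
    rewrite /K /kk /a /b powRM ?powR_ge0 ?(ltW k0)// -powRrM.
    have -> : 1 + q' - gam * q = 1 + (q' + - q * gam) by ring.
    rewrite [in RHS]powRD ?(gt_eqF t0) ?implybT// powRr1 ?(ltW t0)//.
    rewrite [in RHS]powRD ?(gt_eqF t0) ?implybT// powRN.
    have : t `^ q' != 0 by rewrite gt_eqF ?powR_gt0.
    move: (t `^ q') => P P0; rewrite /m; field.
    by rewrite P0.
  rewrite ler_peMr ?(ltW m0)// -[leLHS](powRr0 t) ler_powR//.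
  by lra.
have cM : 2^-1 <= stable_cdf f M by apply: le_trans cdfM; lra.
have hb : b / 2 <= b * stable_cdf f M by rewrite ler_wpM2l ?(ltW b0).
have K0 : 0 < K by exact: lt_le_trans Km.
have hK : m / (1 + m) <= K / (1 + K).
  rewrite ler_pdivrMr ?addr_gt0// mulrAC ler_pdivlMr ?addr_gt0//.
  by rewrite !mulrDr !mulr1 (mulrC m K) lerD2r.
apply: (@le_trans _ _ (K / (1 + K) * (b / 2))).
  have -> : m / (1 + m) / 4 * t `^ (- q') = m / (1 + m) * (b / 2).
    by rewrite /b; move: (m / (1 + m)) => w; field.
  by rewrite ler_wpM2r// divr_ge0 ?(ltW b0).
apply: (@le_trans _ _ (K / (1 + K) * (b * stable_cdf f M))).
  by rewrite ler_wpM2l// divr_ge0 ?addr_ge0 ?(ltW K0).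
by rewrite mulrAC ler_pdivrMr ?addr_gt0.
Qed.

(** Each application of the improvement lowers the exponent by a fixed amount as
    long as [(gam - 1) (alpha - 1) < 1]; finitely many reach zero. *)
Lemma front_decay0 (c0 gam : R) : 1 < alpha -> 0 < c0 -> 0 < gam < alpha / (alpha - 1) ->
  (forall z, 0 <= z <= 2^-1 -> c0 * z `^ gam <= g z) -> front_decay 0.
Proof.
move=> a1 c00 /andP[gam0 gam1] gz.
have am0 : 0 < alpha - 1 by rewrite subr_gt0.
pose eta := Num.min 1 (1 - (gam - 1) * (alpha - 1)).
have eta0 : 0 < eta.
  rewrite lt_min ltr01/= subr_gt0.
  by move: gam1; rewrite ltr_pdivlMr// mulrBl mul1r; lra.
have P n : front_decay (Num.max (alpha - 1 - n%:R * eta) 0).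
  elim: n => [|n IH].
    rewrite mul0r subr0 max_l ?(ltW am0)//; apply: initial_front_decay; exact: ltW.
  set q := Num.max _ _ in IH.
  have q0 : 0 <= q by rewrite le_max lexx orbT.
  have qa : q <= alpha - 1.
    by rewrite ge_max (ltW am0) andbT gerBl mulr_ge0 ?(ltW eta0).
  apply: (front_decay_improve a1 c00 gam0 gz q0 _ _ IH); first by rewrite le_max lexx orbT.
  apply: (@le_trans _ _ (q - eta)); last first.
    rewrite /q le_max; case: (leP (alpha - 1 - n%:R * eta) 0) => h.
      by apply/orP; right; rewrite sub0r oppr_le0 ltW.
    by apply/orP; left; rewrite -natr1; lra.
  have e1 : eta <= 1 by rewrite ge_min lexx.
  have e2 : eta <= 1 - (gam - 1) * (alpha - 1) by rewrite ge_min lexx orbT.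
  have [g1|g1] := leP 1 gam.
    have : (gam - 1) * q <= (gam - 1) * (alpha - 1) by rewrite ler_wpM2l ?subr_ge0.
    by rewrite mulrBl mul1r; lra.
  have : gam * q <= q by rewrite ler_piMl// ltW.
  by lra.
have [n nE] : exists n, (alpha - 1) / eta < n%:R.
  by exists (Num.truncn ((alpha - 1) / eta)).+1; exact: truncnS_gt.
have := P n; rewrite max_r// subr_le0 -ler_pdivrMr//; exact: ltW.
Qed.

(** Once the solution stays above a level from which the reaction pushes up to one,
    logistic growth over a fixed waiting time [tau] suffices: with [k tau = 1 / d] the
    growth estimate gives at least [(1 - d) ^ 2 / (1 + d) >= 1 - 3 d]. *)
Lemma front_level1 : (forall C, 0 < C -> exists2 a, 0 < a & exists2 T, 0 < T &
    [/\ (forall z, a <= z < 1 -> 0 < g z) &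
      forall t x, T <= t -> - (C * t) <= x -> a <= u t x]) ->
  forall e, 0 < e -> front_level (1 - e).
Proof.
move=> level e e0 c c_gt0.
pose d := Num.min e 1 / 3.
have m0 : 0 < Num.min e 1 by rewrite lt_min e0 ltr01.
have d0 : 0 < d by rewrite divr_gt0.
have d1 : d <= 3^-1 by rewrite /d ler_pdivrMr// mulVf// ge_min lexx orbT.
have de : 3 * d <= e by rewrite /d mulrC divfK// ge_min lexx.
have c40 : 0 < 4 * c by rewrite mulr_gt0.
have [a a_gt0 [T T0 [ga HT]]] := level _ c40.
pose b := 1 - d; have b0 : 0 <= b by rewrite /b; lra.
have [k k0 Hk] : exists2 k, 0 < k & forall v, a <= v <= 1 -> k * (b - v) <= g v.
  have [ab|ba] := ltP a b; last first.
    exists 1 => // v /andP[av v1]; rewrite mul1r (@le_trans _ _ 0)//.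
      by rewrite subr_le0 (le_trans ba).
    by apply: g_ge0; rewrite v1 andbT (le_trans (ltW a_gt0)).
  have cgab : {within `[a, b], continuous g}.
    apply: continuous_subspaceW cg => v /=; rewrite !in_itv/= => /andP[av vb].
    by rewrite (le_trans (ltW a_gt0))//= (le_trans vb)// /b gerBl ltW.
  have [v0 v0ab mg] := EVT_min (ltW ab) cgab.
  have gv0 : 0 < g v0.
    move: v0ab; rewrite in_itv/= => /andP[h1 h2]; apply: ga; rewrite h1/=.
    by rewrite (le_lt_trans h2)// /b ltrBlDr ltrDl.
  exists (g v0) => // v /andP[av v1]; have [vb|bv] := leP v b.
    rewrite (le_trans _ (mg v _)) ?in_itv/= ?av ?vb//.
    rewrite ger_pMr// /b; have := lt_le_trans a_gt0 av; lra.
  rewrite (@le_trans _ _ 0) ?g_ge0 ?v1 ?(le_trans (ltW a_gt0))//.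
  by rewrite mulr_ge0_le0 ?(ltW gv0)// subr_le0 ltW.
have [M M0 cdfM] := cdf_near1 d0.
pose tau := (d * k)^-1; have tau0 : 0 < tau by rewrite invr_gt0 mulr_gt0.
pose W := tau `^ alpha^-1 * M.
exists (Num.max (2 * T) (Num.max (2 * tau) (W / c))); first by rewrite lt_max mulr_gt0.
move=> t x; rewrite !ge_max => /and3P[tT ttau tW] cx.
have rt : 0 <= t - tau <= t by apply/andP; split; lra.
have tW' : W <= c * t by rewrite mulrC -ler_pdivrMr.
have ML : (t - (t - tau)) `^ alpha^-1 * M <= x + 2 * c * t.
  by rewrite subKr -/W -mulrA; lra.
have HG s y : t - tau <= s <= t -> - (2 * c * t) <= y -> k * (b - u s y) <= g (u s y).
  move=> /andP[s1 s2] cy; apply: Hk; apply/andP; split.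
    apply: HT; first by lra.
    apply: le_trans cy; rewrite lerN2 -!mulrA.
    have : c * t <= c * (2 * s) by rewrite ler_wpM2l ?(ltW c_gt0)//; lra.
    by lra.
  by have /andP[] : 0 <= u s y <= 1 by apply: u_01; lra.
have := growth rt M0 (ltW k0) b0 ML HG.
rewrite subKr (_ : k * tau = d^-1); last by rewrite /tau; field; rewrite !gt_eqF.
move: (u t x) => U G.
have G1 : b * stable_cdf f M <= U * (d + 1).
  have := ler_wpM2l (ltW d0) G; rewrite mulVKf ?gt_eqF//.
  by rewrite mulrCA mulrDr mulr1 mulfV ?gt_eqF.
have G2 : b * b <= b * stable_cdf f M by rewrite ler_wpM2l.
have : (1 - 3 * d) * (d + 1) <= U * (d + 1).
  by rewrite (le_trans _ (le_trans G2 G1))// /b; nra.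
rewrite ler_pM2r ?addr_gt0//; lra.
Qed.

End Fronts.

Lemma limf_einf_inf_eq1 (R : realType) (u : R -> R -> R) (c : R) :
  (forall t x, 0 <= t -> 0 <= u t x <= 1) ->
  (forall e, 0 < e -> exists2 T, 0 < T &
    forall t x, T <= t -> - (c * t) <= x -> 1 - e <= u t x) ->
  limf_einf (fun t : R =>
    ereal_inf [set (u t x)%:E | x in [set x | - (c * t) <= x]]) +oo = 1%E.
Proof.
move=> u01 H; rewrite limf_einfE; apply/eqP; rewrite eq_le; apply/andP; split.
  apply: ge_ereal_sup => _ [V [M [_ MV]] <-].
  pose t := Num.max M 0 + 1.
  have t0 : 0 <= t by rewrite addr_ge0// le_max lexx orbT.
  have Vt : V t.
    by apply: MV; rewrite (@le_lt_trans _ _ (Num.max M 0)) ?le_max ?lexx// ltrDl.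
  apply: (@le_trans _ _ (ereal_inf [set (u t x)%:E | x in [set x | - (c * t) <= x]])).
    by apply: ereal_inf_lbound; exists t.
  apply: (@le_trans _ _ (u t (- (c * t)))%:E).
    by apply: ereal_inf_lbound; exists (- (c * t)) => /=.
  by rewrite lee_fin; have /andP[] := u01 t (- (c * t)) t0.
apply/lee_addgt0Pr => e e0; have [T T0 HT] := H e e0.
rewrite -leeBlDr//; apply: (@le_trans _ _ (ereal_inf ((fun t : R =>
    ereal_inf [set (u t x)%:E | x in [set x | - (c * t) <= x]]) @` [set t | T < t]))).
  apply: le_ereal_inf_tmp => _ [t /= Tt <-].
  apply: le_ereal_inf_tmp => _ [x /= cx <-].
  by rewrite -EFinB lee_fin; apply: HT => //; exact: ltW.
apply: ereal_sup_ubound; exists [set t | T < t] => //.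
by exists T; split; rewrite ?num_real.
Qed.

(** * The invasion theorem *)

Unset Implicit Arguments.

Theorem theorem3p1 (R : realType) (alpha beta : R)
    (halpha : 0 < alpha < 2) (hbeta : -1 < beta < 1)
    (f : R -> R) (hf : is_stable_density alpha beta f)
    (g : R -> R) (hg : C1_itv 0 1 g) (hg0 : g 0 = 0) (hg1 : g 1 = 0)
    (u0 : R -> R) (hu0 : continuous u0)
    (hu0_01 : forall x, 0 <= u0 x <= 1)
    (hu0_lim : u0 x @[x --> +oo] --> (1 : R))
    (hu0_supp : closure [set x | u0 x != 0] `<=` [set x | 0 <= x])
    (u : R -> R -> R) (hu : mild_solution alpha f g u0 u)
    (hu_01 : forall t x, 0 <= t -> 0 <= u t x <= 1) :
  [/\ 1 < alpha ->
      (forall z, 0 < z < 1 -> 0 < g z) ->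
      (exists c0 gamma : R,
        [/\ 0 < c0, 0 < gamma < alpha / (alpha - 1) &
            forall z, 0 <= z <= 2^-1 -> c0 * z `^ gamma <= g z]) ->
      forall c, 0 < c ->
        limf_einf (fun t : R =>
          ereal_inf [set (u t x)%:E | x in [set x | - (c * t) <= x]]) +oo
        = 1%E,
      alpha = 1 ->
      (forall z, 0 < z < 1 -> 0 < g z) ->
      forall c, 0 < c ->
        limf_einf (fun t : R =>
          ereal_inf [set (u t x)%:E | x in [set x | - (c * t) <= x]]) +oo
        = 1%E &
      alpha < 1 ->
      (forall z, 0 < z < 1 -> 0 <= g z) ->
      (forall z, (1 - beta) / 2 <= z < 1 -> 0 < g z) ->
      forall c, 0 < c ->
        limf_einf (fun t : R =>
          ereal_inf [set (u t x)%:E | x in [set x | - (c * t) <= x]]) +oo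
        = 1%E].
Proof.
have cg : {within `[0, 1], continuous g}.
  by apply: derivable_oo_LRcontinuous_within; case: hg.
have g_pos_ge0 : (forall z, 0 < z < 1 -> 0 <= g z) -> forall z, 0 <= z <= 1 -> 0 <= g z.
  move=> gp z /andP[]; rewrite le_eqVlt => /predU1P[<-|z0]; first by rewrite hg0.
  by rewrite le_eqVlt => /predU1P[->|z1]; rewrite ?hg1// gp// z0.
have g_gt_ge : (forall z, 0 < z < 1 -> 0 < g z) -> forall z, 0 <= z <= 1 -> 0 <= g z.
  by move=> gp; apply: g_pos_ge0 => z /gp /ltW.
have decay_level : front_decay u 0 -> forall C, 0 < C -> exists2 a, 0 < a &
    exists2 T, 0 < T & forall t x, T <= t -> - (C * t) <= x -> a <= u t x.
  move=> H C /H[k [T [k0 T1 HT]]]; exists k => //; exists T; first exact: lt_le_trans T1.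
  by move=> t x Tt Cx; have := HT t x Tt Cx; rewrite oppr0 powRr0 mulr1.
have concl : (forall z, 0 <= z <= 1 -> 0 <= g z) ->
    (forall C, 0 < C -> exists2 a, 0 < a & exists2 T, 0 < T &
      [/\ (forall z, a <= z < 1 -> 0 < g z) &
        forall t x, T <= t -> - (C * t) <= x -> a <= u t x]) ->
    forall c, 0 < c ->
      limf_einf (fun t : R =>
        ereal_inf [set (u t x)%:E | x in [set x | - (c * t) <= x]]) +oo = 1%E.
  move=> g_ge0 level c c0; apply: limf_einf_inf_eq1 => // e e0.
  exact: (front_level1 halpha hf cg g_ge0 hu0 hu0_01 hu hu_01 level e0 c0).
split.
- move=> a1 gpos [c0 [gam [c00 gam01 gz]]]; have g_ge0 := g_gt_ge gpos.
  have H0 := front_decay0 halpha hbeta hf cg g_ge0 hu0 hu0_01 hu0_lim hu hu_01 a1 c00 gam01 gz.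
  apply: concl => // C C_gt0; have [a a_gt0 [T T0 HT]] := decay_level H0 C C_gt0.
  exists a => //; exists T => //; split=> // z /andP[az z1].
  by apply: gpos; rewrite z1 (lt_le_trans a_gt0).
- move=> a1 gpos; have g_ge0 := g_gt_ge gpos.
  have a1' : 1 <= alpha by rewrite a1.
  have := initial_front_decay halpha hbeta hf cg g_ge0 hu0 hu0_01 hu0_lim hu hu_01 a1'.
  rewrite a1 subrr => H0.
  apply: concl => // C C_gt0; have [a a_gt0 [T T0 HT]] := decay_level H0 C C_gt0.
  exists a => //; exists T => //; split=> // z /andP[az z1].
  by apply: gpos; rewrite z1 (lt_le_trans a_gt0).
- move=> a1 gpos0 gpos; have g_ge0 := g_pos_ge0 gpos0.
  have /andP[b1 b2] := hbeta.
  set l := (1 - beta) / 2 in gpos; have l0 : 0 < l by rewrite /l; lra.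
  have l1 : l < 1 by rewrite /l; lra.
  have gl : 0 < g l by apply: gpos; rewrite lexx.
  (* Positivity of [g] at the limiting height extends to slightly lower heights. *)
  have [dl dl0 Hdl] : exists2 dl, 0 < dl & forall z, 0 <= z <= 1 -> `|l - z| < dl -> 0 < g z.
    move/subspace_continuousP : cg => /(_ l); rewrite /= in_itv/= (ltW l0) (ltW l1) => /(_ isT).
    move=> /cvgrPdist_lt /(_ _ gl); rewrite near_withinE => -[dl dl0 H].
    exists dl => // z z01 zz; have := H z zz; rewrite /= in_itv/= z01 => /(_ isT).
    by rewrite ltr_norml => /andP[_]; rewrite ltrBlDr ltrDl.
  pose a := Num.max (l / 2) (l - dl / 2).
  have a_gt0 : 0 < a by rewrite lt_max divr_gt0.
  have al : a < l by rewrite gt_max; apply/andP; split; lra.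
  have a0l : 0 < a < (1 - beta) / 2 by rewrite a_gt0.
  have lev := initial_front_level halpha hbeta hf cg g_ge0 hu0 hu0_01 hu0_lim hu hu_01 a1 a0l.
  apply: concl => // C C_gt0; have [T T0 HT] := lev C C_gt0.
  exists a => //; exists T => //; split=> // z /andP[az z1].
  have [lz|zl] := leP l z; first by apply: gpos; rewrite lz.
  apply: Hdl; first by rewrite (ltW z1) (le_trans (ltW a_gt0)).
  rewrite gtr0_norm ?subr_gt0//; have : l - dl / 2 <= z.
    by apply: le_trans az; rewrite le_max lexx orbT.
  by lra.
Qed.
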